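(* Consider the shock interaction problem described in the context. Suppose that $(\alpha_1,\beta_1,t_1,r_1)$ and $(\alpha_2,\beta_2,t_2,r_2)$ are two $C^2$ solutions of the shock interaction problem on some $T_{\bar\varepsilon}$, $\bar\varepsilon>0$, with the same states ahead (the same future developments of the data) and the same solution of the jump conditions at the interaction point. Then, when $\varepsilon\in(0,\bar\varepsilon]$ is sufficiently small, the two solutions coincide on $T_\varepsilon$: $\alpha_1=\alpha_2$, $\beta_1=\beta_2$, $t_1=t_2$, $r_1=r_2$ on $T_\varepsilon$.
   Context: **Fluid.** Let $p=p(\rho)$ be a given smooth function of $\rho>0$ with $\frac{dp}{d\rho}>0$, and $\eta(\rho)=\sqrt{dp/d\rho}$. The equations of motion (spherically symmetric barotropic Euler equations) for the density $\rho(t,r)>0$ and radial velocity $w(t,r)$, $r>0$, are $\partial_t\rho+\partial_r(\rho w)+\frac2r\rho w=0$ and $\partial_t w+w\partial_r w+\frac1\rho\partial_r p=0$. Riemann invariants: $\alpha=\int^\rho\frac{\eta(\rho')}{\rho'}d\rho'+w$, $\beta=\int^\rho\frac{\eta(\rho')}{\rho'}d\rho'-w$ (with a fixed lower limit $>0$); the map $(\rho,w)\mapsto(\alpha,\beta)$ is a diffeomorphism onto its image, and $\rho(\alpha,\beta)$, $w(\alpha,\beta)$ denote the components of its (smooth) inverse; so $w=\frac{\alpha-\beta}2$. Via these, $c_{out}=w+\eta$, $c_{in}=w-\eta$ are smooth functions of $(\alpha,\beta)$. Put $A(\alpha,\beta,r)=-\frac{2\eta w}{r}$. For states $\pm$ write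 $[f]=f_+-f_-$ and $$J(\alpha_+,\beta_+,\alpha_-,\beta_-)=[\rho w]^2-[\rho w^2+p]\,[\rho],$$ where $\rho_\pm=\rho(\alpha_\pm,\beta_\pm)$, $w_\pm=w(\alpha_\pm,\beta_\pm)$, $p_\pm=p(\rho_\pm)$. **States ahead.** Fix $r_0>0$. Index $1$ refers to the left moving shock, index $2$ to the right moving shock. Given are smooth solutions $(\rho_i^*,w_i^* )$, $i=1,2$, of the equations of motion (the future developments of smooth data at $t=0$ given on $r\le r_0$ for $i=1$ and on $r\ge r_0$ for $i=2$), smooth up to the boundary of their domains: $(\rho_1^*,w_1^* )$ on $D_1=\{0\le t\le T_1,\ 0<r\le b_1(t)\}$, where $b_1$ is the left moving characteristic $b_1'(t)=(w_1^*-\eta(\rho_1^* ))(t,b_1(t))$, $b_1(0)=r_0$; and $(\rho_2^*,w_2^* )$ on $D_2=\{0\le t\le T_2,\ r\ge b_2(t)\}$, where $b_2'(t)=(w_2^*+\eta(\rho_2^* ))(t,b_2(t))$, $b_2(0)=r_0$ (with $T_1,T_2>0$, $b_1>0$). Let $\alpha_i^*(t,r),\beta_i^*(t,r)$ be the corresponding Riemann invariants, and $\rho_{i,-0},w_{i,-0},\alpha_{i,-0},\beta_{i,-0}$ the values of $\rho_i^*,w_i^*,\alpha_i^*,\beta_i^*$ at $(t,r)=(0,r_0)$. **Interaction point.** Given are $\rho_0>0$, $w_0=0$ (common state behind at the interaction point) and shock speeds $V_{1,0},V_{2,0}$ satisfying, for $i=1,2$, the jump conditions $[\rho]V_{i,0}=[\rho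 w]$, $[\rho w]V_{i,0}=[\rho w^2+p]$ with state $+$ equal to $(\rho_0,0)$ and state $-$ equal to $(\rho_{i,-0},w_{i,-0})$, and the determinism condition, with $\eta_0=\eta(\rho_0)$: $$-\eta_0<V_{1,0}<w_{1,-0}-\eta(\rho_{1,-0})<0,\qquad 0<w_{2,-0}+\eta(\rho_{2,-0})<V_{2,0}<\eta_0.$$ Let $\beta_0$ be the common value of $\alpha$ and $\beta$ at the state $(\rho_0,0)$. Define $$\Gamma_0=-\frac{\eta_0+V_{1,0}}{\eta_0-V_{1,0}}<0,\qquad a=\frac{\eta_0+V_{1,0}}{\eta_0-V_{1,0}}\cdot\frac{\eta_0-V_{2,0}}{\eta_0+V_{2,0}}\in(0,1).$$ By the implicit function theorem there are smooth functions $H_1$ near $(\beta_0,\alpha_{1,-0},\beta_{1,-0})$ and $H_2$ near $(\beta_0,\alpha_{2,-0},\beta_{2,-0})$, equal to $\beta_0$ at those points, with $J(H_1(\beta_+,\alpha_-,\beta_-),\beta_+,\alpha_-,\beta_-)=0$ and $J(\alpha_+,H_2(\alpha_+,\alpha_-,\beta_-),\alpha_-,\beta_-)=0$. Let $F_{i,0},M_{i1,0},M_{i2,0}$ be the partial derivatives of $H_i$ in its first, second and third argument at $(\beta_0,\alpha_{i,-0},\beta_{i,-0})$; one has $F_{1,0}F_{2,0}=a^2$. With $a_1=1$, $a_2=a$, put, for $f=\alpha,\beta$, $$f_{i,-}'(0)=\partial_t f_i^*(0,r_0)\,\tfrac1{\eta_0}\Big(1-\tfrac{a_i}{\Gamma_0}\Big)+\partial_r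 f_i^*(0,r_0)\Big(1+\tfrac{a_i}{\Gamma_0}\Big).$$ The constants $\alpha_0',\beta_0'$ are defined as the unique solution of $$\alpha_0'=F_{1,0}\beta_0'+M_{11,0}\alpha_{1,-}'(0)+M_{12,0}\beta_{1,-}'(0),\qquad \beta_0'=aF_{2,0}\alpha_0'+M_{21,0}\alpha_{2,-}'(0)+M_{22,0}\beta_{2,-}'(0).$$ **Domain.** For $\varepsilon>0$, $T_\varepsilon=\{(u,v)\in\mathbb R^2: 0\le u\le v\le \frac ua\le\varepsilon\}$. $C^k(T_\varepsilon)$ means $k$ times continuously differentiable up to the boundary. **Shock interaction problem on $T_\varepsilon$.** Find functions $\alpha,\beta,t,r$ of $(u,v)\in T_\varepsilon$ such that the following hold. (i) In $T_\varepsilon$: $\frac{\partial r}{\partial u}=c_{in}\frac{\partial t}{\partial u}$, $\frac{\partial r}{\partial v}=c_{out}\frac{\partial t}{\partial v}$, $\frac{\partial\alpha}{\partial v}=A\frac{\partial t}{\partial v}$, $\frac{\partial\beta}{\partial u}=A\frac{\partial t}{\partial u}$, with $c_{in},c_{out}$ evaluated at $(\alpha,\beta)$ and $A$ at $(\alpha,\beta,r)$. (ii) For any function $f$ on $T_\varepsilon$ put $f_{1,+}(u)=f(u,u)$ for $u\in[0,a\varepsilon]$ and $f_{2,+}(v)=f(av,v)$ for $v\in[0,\varepsilon]$. The curves $(t_{i,+},r_{i,+})$ lie in $D_i$, and $\alpha_{i,-}=\alpha_i^*(t_{i,+},r_{i,+})$, $\beta_{i,-}=\beta_i^*(t_{i,+},r_{i,+})$.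 With $\rho_{i,\pm}=\rho(\alpha_{i,\pm},\beta_{i,\pm})$, $w_{i,\pm}=w(\alpha_{i,\pm},\beta_{i,\pm})$ and $V_i=\frac{\rho_{i,+}w_{i,+}-\rho_{i,-}w_{i,-}}{\rho_{i,+}-\rho_{i,-}}$, one has the boundary conditions $\frac{dr_{1,+}}{du}=V_1\frac{dt_{1,+}}{du}$ on $[0,a\varepsilon]$ and $\frac{dr_{2,+}}{dv}=V_2\frac{dt_{2,+}}{dv}$ on $[0,\varepsilon]$. (iii) Jump conditions: $J(\alpha_{i,+},\beta_{i,+},\alpha_{i,-},\beta_{i,-})=0$, $i=1,2$. (iv) At the origin: $t(0,0)=0$, $r(0,0)=r_0$, $\frac{\partial r}{\partial v}(0,0)=1$, $\alpha(0,0)=\beta(0,0)=\beta_0$, $\frac{\partial\alpha}{\partial u}(0,0)=\alpha_0'$, $\frac{\partial\beta}{\partial v}(0,0)=\beta_0'$, $V_i(0)=V_{i,0}$, $i=1,2$. (v) Determinism: with $c_{in,1,\pm}=c_{in}(\alpha_{1,\pm},\beta_{1,\pm})$ and $c_{out,2,\pm}=c_{out}(\alpha_{2,\pm},\beta_{2,\pm})$, one has $c_{in,1,+}(u)<V_1(u)<c_{in,1,-}(u)$ for $u\in[0,a\varepsilon]$ and $c_{out,2,-}(v)<V_2(v)<c_{out,2,+}(v)$ for $v\in[0,\varepsilon]$. In the claim, the subscripts $1,2$ on $(\alpha_k,\beta_k,t_k,r_k)$, $k=1,2$, number the two solutions and have nothing to do with the shock index. *)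

(* Defs.v *)
From Stdlib Require Import Reals ClassicalEpsilon.
From Coquelicot Require Import Coquelicot.
Open Scope R_scope.

(** [C^k up to the boundary] on a set [D] means: the derivatives up to order [k] exist
    in the interior of [D] and extend continuously to [D].  Here [locally z D] says that
    [z] is an interior point of [D].  The notion is meant for sets [D] contained in the
    closure of their interior, where the extensions are unique. *)

Definition uncurry2 (f : R -> R -> R) (z : R * R) : R := f (fst z) (snd z).

(** [g] is the partial derivative of [f] in the interior of [D], together with its
    continuous extension to [D]; hence [g] is determined on all of [D]. *)
Definition is_pd1 (D : R * R -> Prop) (f g : R -> R -> R) : Prop :=
  continuous_on D (uncurry2 g) /\
  forall x y, locally (x, y) D -> is_derive (fun s => f s y) x (g x y).

Definition is_pd2 (D : R * R -> Prop) (f g : R -> R -> R) : Prop :=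
  continuous_on D (uncurry2 g) /\
  forall x y, locally (x, y) D -> is_derive (fun s => f x s) y (g x y).

(** Partial derivatives on [D], boundary included. They mean something only when the
    extension exists, as is guaranteed by [Ck 1 D f]. *)
Definition pd1 (D : R * R -> Prop) (f : R -> R -> R) : R -> R -> R :=
  epsilon (inhabits (fun _ _ => 0)) (is_pd1 D f).

Definition pd2 (D : R * R -> Prop) (f : R -> R -> R) : R -> R -> R :=
  epsilon (inhabits (fun _ _ => 0)) (is_pd2 D f).

Fixpoint Ck (k : nat) (D : R * R -> Prop) (f : R -> R -> R) : Prop :=
  continuous_on D (uncurry2 f) /\
  match k with
  | O => True
  | S k' =>
      (exists g, is_pd1 D f g) /\ (exists g, is_pd2 D f g) /\
      Ck k' D (pd1 D f) /\ Ck k' D (pd2 D f)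
  end.

Definition smooth_on (D : R * R -> Prop) (f : R -> R -> R) : Prop :=
  forall k, Ck k D f.

(** Derivative relative to [[lo, hi]], thus one-sided at the end points. *)
Definition is_derive_on (lo hi : R) (f : R -> R) (x l : R) : Prop :=
  filterdiff f (within (fun s => lo <= s <= hi) (locally x)) (fun h => scal h l).

(** [C^k] in three variables on an open set [U]. *)
Fixpoint Ck3 (k : nat) (U : R * R * R -> Prop) (f : R -> R -> R -> R) : Prop :=
  (forall q, U q -> continuous (fun q => f (fst (fst q)) (snd (fst q)) (snd q)) q) /\
  match k with
  | O => True
  | S k' =>
      (forall x y z, U (x, y, z) ->
         ex_derive (fun s => f s y z) x /\
         ex_derive (fun s => f x s z) y /\
         ex_derive (fun s => f x y s) z) /\
      Ck3 k' U (fun x y z => Derive (fun s => f s y z) x) /\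
      Ck3 k' U (fun x y z => Derive (fun s => f x s z) y) /\
      Ck3 k' U (fun x y z => Derive (fun s => f x y s) z)
  end.

(** [Lft] and [Rgt] stand for the left and right moving shock, [i = 1] and [i = 2]. *)
Inductive side := Lft | Rgt.

Record setting := Setting {
  pr : R -> R;                      (* pressure p(rho) *)
  rref : R;                         (* lower limit in the Riemann invariants *)
  r0 : R;
  Tmax : side -> R;                 (* T_i *)
  bdry : side -> R -> R;            (* b_i *)
  rhos : side -> R -> R -> R;       (* rho_i^*(t,r) *)
  ws : side -> R -> R -> R;         (* w_i^*(t,r) *)
  rho0 : R;
  V0 : side -> R                    (* V_{i,0} *)
}.

Definition eta (S : setting) (rho : R) : R := sqrt (Derive (pr S) rho).

Definition alphaRI (S : setting) (rho w : R) : R :=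
  RInt (fun s => eta S s / s) (rref S) rho + w.

Definition betaRI (S : setting) (rho w : R) : R :=
  RInt (fun s => eta S s / s) (rref S) rho - w.

Definition has_invariants (S : setting) (al be : R) (q : R * R) : Prop :=
  0 < fst q /\ alphaRI S (fst q) (snd q) = al /\ betaRI S (fst q) (snd q) = be.

(** The image of [(rho, w) |-> (alpha, beta)]. *)
Definition RI_image (S : setting) (al be : R) : Prop :=
  exists q, has_invariants S al be q.

(** The inverse of [(rho, w) |-> (alpha, beta)]; meaningful on [RI_image] only. *)
Definition state_of (S : setting) (al be : R) : R * R :=
  epsilon (inhabits (1, 0)) (has_invariants S al be).

Definition rho_of (S : setting) (al be : R) : R := fst (state_of S al be).
Definition w_of (S : setting) (al be : R) : R := snd (state_of S al be).

Definition c_out (S : setting) (al be : R) : R := w_of S al be + eta S (rho_of S al be).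
Definition c_in (S : setting) (al be : R) : R := w_of S al be - eta S (rho_of S al be).

Definition A_coef (S : setting) (al be r : R) : R :=
  - (2 * eta S (rho_of S al be) * w_of S al be / r).

Definition J (S : setting) (alp bep alm bem : R) : R :=
  let rp := rho_of S alp bep in let wp := w_of S alp bep in
  let rm := rho_of S alm bem in let wm := w_of S alm bem in
  (rp * wp - rm * wm) ^ 2
  - ((rp * wp ^ 2 + pr S rp) - (rm * wm ^ 2 + pr S rm)) * (rp - rm).

Definition shock_speed (S : setting) (alp bep alm bem : R) : R :=
  let rp := rho_of S alp bep in let wp := w_of S alp bep in
  let rm := rho_of S alm bem in let wm := w_of S alm bem in
  (rp * wp - rm * wm) / (rp - rm).

(** The domain [D_i] of the state ahead, in the coordinates [(t, r)]. *)
Definition Dom (S : setting) (i : side) (z : R * R) : Prop :=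
  0 <= fst z <= Tmax S i /\
  match i with
  | Lft => 0 < snd z <= bdry S Lft (fst z)
  | Rgt => bdry S Rgt (fst z) <= snd z
  end.

Definition char_speed (S : setting) (i : side) (rho w : R) : R :=
  match i with Lft => w - eta S rho | Rgt => w + eta S rho end.

Definition equations_of_motion (p : R -> R) (D : R * R -> Prop)
    (rho w : R -> R -> R) : Prop :=
  forall t r, D (t, r) ->
    pd1 D rho t r + pd2 D (fun t r => rho t r * w t r) t r
      + 2 / r * rho t r * w t r = 0 /\
    pd1 D w t r + w t r * pd2 D w t r
      + / rho t r * pd2 D (fun t r => p (rho t r)) t r = 0.

Definition als (S : setting) (i : side) (t r : R) : R :=
  alphaRI S (rhos S i t r) (ws S i t r).
Definition bes (S : setting) (i : side) (t r : R) : R :=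
  betaRI S (rhos S i t r) (ws S i t r).

Definition rho_m0 (S : setting) (i : side) : R := rhos S i 0 (r0 S).
Definition w_m0 (S : setting) (i : side) : R := ws S i 0 (r0 S).
Definition al_m0 (S : setting) (i : side) : R := als S i 0 (r0 S).
Definition be_m0 (S : setting) (i : side) : R := bes S i 0 (r0 S).

Definition eta0 (S : setting) : R := eta S (rho0 S).
(** At [w = 0] the two Riemann invariants agree. *)
Definition beta0 (S : setting) : R := betaRI S (rho0 S) 0.

Definition Gamma0 (S : setting) : R :=
  - ((eta0 S + V0 S Lft) / (eta0 S - V0 S Lft)).

Definition acst (S : setting) : R :=
  (eta0 S + V0 S Lft) / (eta0 S - V0 S Lft)
  * ((eta0 S - V0 S Rgt) / (eta0 S + V0 S Rgt)).

Definition jump_conditions (p : R -> R) (rp wp rm wm V : R) : Prop :=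
  (rp - rm) * V = rp * wp - rm * wm /\
  (rp * wp - rm * wm) * V = (rp * wp ^ 2 + p rp) - (rm * wm ^ 2 + p rm).

Record admissible (S : setting) : Prop := {
  adm_p_smooth : forall n rho, 0 < rho -> ex_derive_n (pr S) n rho;
  adm_p_incr : forall rho, 0 < rho -> 0 < Derive (pr S) rho;
  adm_rref : 0 < rref S;
  adm_r0 : 0 < r0 S;
  adm_Tmax : forall i, 0 < Tmax S i;
  adm_bdry_0 : forall i, bdry S i 0 = r0 S;
  adm_bdry_pos : forall t, 0 <= t <= Tmax S Lft -> 0 < bdry S Lft t;
  adm_bdry_char : forall i t, 0 <= t <= Tmax S i ->
    is_derive_on 0 (Tmax S i) (bdry S i) t
      (char_speed S i (rhos S i t (bdry S i t)) (ws S i t (bdry S i t)));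
  adm_rhos_pos : forall i t r, Dom S i (t, r) -> 0 < rhos S i t r;
  adm_rhos_smooth : forall i, smooth_on (Dom S i) (rhos S i);
  adm_ws_smooth : forall i, smooth_on (Dom S i) (ws S i);
  adm_motion : forall i, equations_of_motion (pr S) (Dom S i) (rhos S i) (ws S i);
  adm_rho0 : 0 < rho0 S;
  adm_jump : forall i,
    jump_conditions (pr S) (rho0 S) 0 (rho_m0 S i) (w_m0 S i) (V0 S i);
  adm_determinism_l :
    - eta0 S < V0 S Lft /\
    V0 S Lft < w_m0 S Lft - eta S (rho_m0 S Lft) /\
    w_m0 S Lft - eta S (rho_m0 S Lft) < 0;
  adm_determinism_r :
    0 < w_m0 S Rgt + eta S (rho_m0 S Rgt) /\
    w_m0 S Rgt + eta S (rho_m0 S Rgt) < V0 S Rgt /\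
    V0 S Rgt < eta0 S
}.

(** [H] is the function [H_i] given near the interaction point by the implicit
    function theorem: the jump condition is solved for [alpha_+] in terms of
    [(beta_+, alpha_-, beta_-)] if [i = 1], for [beta_+] in terms of
    [(alpha_+, alpha_-, beta_-)] if [i = 2]. *)
Definition solves_jump (S : setting) (i : side) (H : R -> R -> R -> R) : Prop :=
  H (beta0 S) (al_m0 S i) (be_m0 S i) = beta0 S /\
  exists U : R * R * R -> Prop,
    open U /\ U (beta0 S, al_m0 S i, be_m0 S i) /\
    (forall k, Ck3 k U H) /\
    forall x alm bem, U (x, alm, bem) ->
      match i with
      | Lft => J S (H x alm bem) x alm bem = 0
      | Rgt => J S x (H x alm bem) alm bem = 0
      end.

Definition F0 (S : setting) (H : side -> R -> R -> R -> R) (i : side) : R :=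
  Derive (fun s => H i s (al_m0 S i) (be_m0 S i)) (beta0 S).
Definition M10 (S : setting) (H : side -> R -> R -> R -> R) (i : side) : R :=
  Derive (fun s => H i (beta0 S) s (be_m0 S i)) (al_m0 S i).
Definition M20 (S : setting) (H : side -> R -> R -> R -> R) (i : side) : R :=
  Derive (fun s => H i (beta0 S) (al_m0 S i) s) (be_m0 S i).

(** [f_{i,-}'(0)], for [f] a function of [(t, r)] on [Dom S i]. *)
Definition ahead_slope (S : setting) (i : side) (f : R -> R -> R) : R :=
  let ai := match i with Lft => 1 | Rgt => acst S end in
  pd1 (Dom S i) f 0 (r0 S) * (1 / eta0 S) * (1 - ai / Gamma0 S)
  + pd2 (Dom S i) f 0 (r0 S) * (1 + ai / Gamma0 S).

(** The linear system defining [alpha_0'] and [beta_0']. *)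
Definition corner_slopes (S : setting) (H : side -> R -> R -> R -> R)
    (al0' be0' : R) : Prop :=
  al0' = F0 S H Lft * be0'
         + M10 S H Lft * ahead_slope S Lft (als S Lft)
         + M20 S H Lft * ahead_slope S Lft (bes S Lft) /\
  be0' = acst S * F0 S H Rgt * al0'
         + M10 S H Rgt * ahead_slope S Rgt (als S Rgt)
         + M20 S H Rgt * ahead_slope S Rgt (bes S Rgt).

Definition Teps (a eps : R) (z : R * R) : Prop :=
  0 <= fst z /\ fst z <= snd z /\ snd z <= fst z / a /\ fst z / a <= eps.

(** [f_{1,+}(u) = f(u,u)] and [f_{2,+}(v) = f(av,v)], for a parameter in
    [[0, trace_end a eps i]]. *)
Definition trace (a : R) (i : side) (f : R -> R -> R) (s : R) : R :=
  match i with Lft => f s s | Rgt => f (a * s) s end.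

Definition trace_end (a eps : R) (i : side) : R :=
  match i with Lft => a * eps | Rgt => eps end.

Record fields := Fields {
  f_al : R -> R -> R;
  f_be : R -> R -> R;
  f_t : R -> R -> R;
  f_r : R -> R -> R
}.

Definition al_plus (S : setting) (X : fields) (i : side) (s : R) : R :=
  trace (acst S) i (f_al X) s.
Definition be_plus (S : setting) (X : fields) (i : side) (s : R) : R :=
  trace (acst S) i (f_be X) s.
Definition al_minus (S : setting) (X : fields) (i : side) (s : R) : R :=
  als S i (trace (acst S) i (f_t X) s) (trace (acst S) i (f_r X) s).
Definition be_minus (S : setting) (X : fields) (i : side) (s : R) : R :=
  bes S i (trace (acst S) i (f_t X) s) (trace (acst S) i (f_r X) s).
Definition V (S : setting) (X : fields) (i : side) (s : R) : R :=
  shock_speed S (al_plus S X i s) (be_plus S X i s) (al_minus S X i s) (be_minus S X i s).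

Record shock_interaction (S : setting) (al0' be0' eps : R) (X : fields) : Prop := {
  si_C2_al : Ck 2 (Teps (acst S) eps) (f_al X);
  si_C2_be : Ck 2 (Teps (acst S) eps) (f_be X);
  si_C2_t : Ck 2 (Teps (acst S) eps) (f_t X);
  si_C2_r : Ck 2 (Teps (acst S) eps) (f_r X);
  (* the coefficients below are evaluated within their domains of definition *)
  si_image : forall u v, Teps (acst S) eps (u, v) ->
    RI_image S (f_al X u v) (f_be X u v);
  si_r_pos : forall u v, Teps (acst S) eps (u, v) -> 0 < f_r X u v;
  si_char : forall u v, Teps (acst S) eps (u, v) ->
    let D := Teps (acst S) eps in
    let al := f_al X u v in let be := f_be X u v in let r := f_r X u v in
    pd1 D (f_r X) u v = c_in S al be * pd1 D (f_t X) u v /\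
    pd2 D (f_r X) u v = c_out S al be * pd2 D (f_t X) u v /\
    pd2 D (f_al X) u v = A_coef S al be r * pd2 D (f_t X) u v /\
    pd1 D (f_be X) u v = A_coef S al be r * pd1 D (f_t X) u v;
  si_ahead : forall i s, 0 <= s <= trace_end (acst S) eps i ->
    Dom S i (trace (acst S) i (f_t X) s, trace (acst S) i (f_r X) s);
  si_boundary : forall i s, 0 <= s <= trace_end (acst S) eps i ->
    exists dt dr,
      is_derive_on 0 (trace_end (acst S) eps i) (trace (acst S) i (f_t X)) s dt /\
      is_derive_on 0 (trace_end (acst S) eps i) (trace (acst S) i (f_r X)) s dr /\
      dr = V S X i s * dt;
  si_jump : forall i s, 0 <= s <= trace_end (acst S) eps i ->
    J S (al_plus S X i s) (be_plus S X i s) (al_minus S X i s) (be_minus S X i s) = 0;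
  si_t0 : f_t X 0 0 = 0;
  si_r0 : f_r X 0 0 = r0 S;
  si_drdv0 : pd2 (Teps (acst S) eps) (f_r X) 0 0 = 1;
  si_al0 : f_al X 0 0 = beta0 S;
  si_be0 : f_be X 0 0 = beta0 S;
  si_daldu0 : pd1 (Teps (acst S) eps) (f_al X) 0 0 = al0';
  si_dbedv0 : pd2 (Teps (acst S) eps) (f_be X) 0 0 = be0';
  si_V0 : forall i, V S X i 0 = V0 S i;
  si_determinism_l : forall u, 0 <= u <= trace_end (acst S) eps Lft ->
    c_in S (al_plus S X Lft u) (be_plus S X Lft u) < V S X Lft u /\
    V S X Lft u < c_in S (al_minus S X Lft u) (be_minus S X Lft u);
  si_determinism_r : forall v, 0 <= v <= trace_end (acst S) eps Rgt ->
    c_out S (al_minus S X Rgt v) (be_minus S X Rgt v) < V S X Rgt v /\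
    V S X Rgt v < c_out S (al_plus S X Rgt v) (be_plus S X Rgt v)
}.

(* Main.v *)
From Stdlib Require Import Reals Lra Psatz ClassicalEpsilon.
From Coquelicot Require Import Coquelicot.
Require Import Defs.
Open Scope R_scope.

(** Write [d] for the difference of the two solutions.  The characteristic equations give
    four of the eight first derivatives in terms of the other four, [dt/du], [dt/dv],
    [dalpha/du], [dbeta/dv], and of the unknowns.  Differentiating them across yields the mixed
    derivatives of [t], [alpha], [beta] in terms of the same quantities
    ([solution_wave_equations]).  Let [m] be the sum of the absolute differences of the
    unknowns, and [n] this sum with those of the four derivatives added.  The differences of
    [dt/du] and [dalpha/du] then vary by at most [C n] per unit length on the lines of
    constant [u], those of [dt/dv] and [dbeta/dv] on the lines of constant [v].

    On the two edges there are two linear homogeneous relations between the four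
    derivatives, with coefficients that depend on the unknowns only: the boundary condition
    ([edge_boundary_relation]) and the derivative of the jump condition along the edge
    ([edge_jump_relation]).  Their limits at the corner follow from the Rankine-Hugoniot
    conditions, which make the derivatives of [J] in [alpha_+] and [beta_+] proportional to
    [(eta0 - V)^2] and [(eta0 + V)^2] ([J_derivatives_at_rest]).  With
    [gam = (eta0 + V1) / (eta0 - V1)], and up to errors [C m + o(1) n],

      - on [u = v]: [|d t_u| <= |d t_v| / gam] and
        [|d alpha_u| <= gam^2 |d beta_v| + C (|d t_u| + |d t_v|)];
      - on [u = a v]: [|d t_v| <= gam |d t_u|] and
        [|d beta_v| <= a |d alpha_u| + C (|d t_u| + |d t_v|)].

    A pair of reflections reproduces [d t_u] with factor one, so that these bounds alone do
    not contract.  But the solutions are [C^2] and have the same first derivatives at the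
    corner, whence [d t_u = O(u)] and [d t_v = O(v)]; and [u = a v] with [a < 1] on the
    second edge.  In the bounds [|d t_u| <= Q u], [|d t_v| <= lam Q v],
    [|d alpha_u| <= K Q u], [|d beta_v| <= K Q v], with [gam a < lam < gam] and a large [K],
    the constant [Q] can therefore be replaced by a fixed fraction of itself, on a small
    sector: the differences of the unknowns are [O(Q v^2)], and all remaining errors carry a
    small factor ([weighted_bound_contracts]).  Iteration gives zero
    ([contraction_vanishing]).

    The derivatives are defined in the interior and extended continuously.  What replaces
    differentiability at the boundary is strict differentiability relative to the closed
    domain ([Teps_strict_diff], [Dom_strict_diff]), which implies the chain rule along
    the edges and along the shocks ([is_derive_curve]). *)

(** * Segments, strict differentiability and the chain rule up to the boundary *)

Lemma continuous_on_eps (D : R * R -> Prop) (f : R -> R -> R) (x y : R) (e : R) :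
  continuous_on D (uncurry2 f) -> D (x, y) -> 0 < e ->
  exists d, 0 < d /\ forall x' y', D (x', y') ->
    Rabs (x' - x) < d -> Rabs (y' - y) < d -> Rabs (f x' y' - f x y) < e.
Proof.
  intros Hc HD He.
  destruct (Hc (x, y) HD (fun r => Rabs (r - f x y) < e)) as [d Hd].
  { exists (mkposreal e He). intros r Hr. exact Hr. }
  exists d. split; [apply cond_pos|].
  intros x' y' HD' Hx Hy.
  apply (Hd (x', y')); [split; assumption | exact HD'].
Qed.

Lemma locally_continuous (D : R * R -> Prop) (f : R -> R -> R) (x y : R) :
  continuous_on D (uncurry2 f) -> locally (x, y) D ->
  continuous (fun z : R * R => f (fst z) (snd z)) (x, y).
Proof.
  intros Hc HD.
  apply (continuous_continuous_on D (uncurry2 f)); [|exact Hc]. exact HD.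
Qed.

(** The segment from [(x1,y1)] to [(x2,y2)], translated by [h (d1,d2)]. *)
Definition shifted_segment (x1 y1 x2 y2 d1 d2 h s : R) : R * R :=
  (x1 + s * (x2 - x1) + h * d1, y1 + s * (y2 - y1) + h * d2).

Lemma segment_estimate (D : R * R -> Prop) (f g1 g2 : R -> R -> R)
    (x1 y1 x2 y2 d1 d2 h c1 c2 e : R) :
  is_pd1 D f g1 -> is_pd2 D f g2 ->
  (forall s, 0 <= s <= 1 ->
     let z := shifted_segment x1 y1 x2 y2 d1 d2 h s in
     locally z D /\
     Rabs (uncurry2 g1 z - c1) <= e /\ Rabs (uncurry2 g2 z - c2) <= e) ->
  Rabs (f (x2 + h * d1) (y2 + h * d2) - f (x1 + h * d1) (y1 + h * d2)
        - c1 * (x2 - x1) - c2 * (y2 - y1))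
  <= e * (Rabs (x2 - x1) + Rabs (y2 - y1)).
Proof.
  intros [Hg1 Hd1] [Hg2 Hd2] Hs.
  set (X := fun s => x1 + s * (x2 - x1) + h * d1).
  set (Y := fun s => y1 + s * (y2 - y1) + h * d2).
  assert (Hder : forall s, 0 <= s <= 1 -> is_derive (fun s => f (X s) (Y s)) s
            ((x2 - x1) * g1 (X s) (Y s) + (y2 - y1) * g2 (X s) (Y s))).
  { intros s H01. destruct (Hs s H01) as [Hloc _].
    assert (Hloc' : locally (X s, Y s) D) by exact Hloc.
    assert (HF := is_derive_filterdiff f (X s) (Y s) g1 (g2 (X s) (Y s))).
    assert (HX : is_derive X s (x2 - x1)) by (unfold X; auto_derive; [easy | ring]).
    assert (HY : is_derive Y s (y2 - y1)) by (unfold Y; auto_derive; [easy | ring]).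
    assert (HF' : filterdiff (fun u : R * R => f (fst u) (snd u)) (locally (X s, Y s))
              (fun u : R * R => plus (scal (fst u) (g1 (X s) (Y s)))
                                     (scal (snd u) (g2 (X s) (Y s))))).
    { apply HF.
      - apply locally_locally in Hloc'.
        apply filter_imp with (2 := Hloc'). intros [a b] Hab. apply Hd1, Hab.
      - apply Hd2, Hloc'.
      - exact (locally_continuous D g1 _ _ Hg1 Hloc'). }
    assert (HC := filterdiff_comp'_2 (U := R_NormedModule) (T := R_NormedModule)
      (V := R_NormedModule) (W := R_NormedModule) X Y f s _ _
      (fun p q => plus (scal p (g1 (X s) (Y s))) (scal q (g2 (X s) (Y s)))) HX HY HF').
    apply filterdiff_ext_lin with (1 := HC).
    intros t. unfold scal, plus; simpl; unfold mult; simpl. ring. }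
  destruct (MVT_gen (fun s => f (X s) (Y s)) 0 1
      (fun s => (x2 - x1) * g1 (X s) (Y s) + (y2 - y1) * g2 (X s) (Y s)))
    as [s [H01 Heq]].
  { intros s. rewrite Rmin_left, Rmax_right by lra. intros; apply Hder; lra. }
  { intros s. rewrite Rmin_left, Rmax_right by lra. intros H01.
    apply derivable_continuous_pt. eexists. apply is_derive_Reals, Hder, H01. }
  rewrite Rmin_left, Rmax_right in H01 by lra.
  destruct (Hs s H01) as [_ [E1 E2]].
  change (Rabs (g1 (X s) (Y s) - c1) <= e) in E1.
  change (Rabs (g2 (X s) (Y s) - c2) <= e) in E2.
  assert (EX0 : X 0 = x1 + h * d1) by (unfold X; ring).
  assert (EY0 : Y 0 = y1 + h * d2) by (unfold Y; ring).
  assert (EX1 : X 1 = x2 + h * d1) by (unfold X; ring).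
  assert (EY1 : Y 1 = y2 + h * d2) by (unfold Y; ring).
  rewrite EX0, EY0, EX1, EY1 in Heq.
  replace (f (x2 + h * d1) (y2 + h * d2) - f (x1 + h * d1) (y1 + h * d2)
           - c1 * (x2 - x1) - c2 * (y2 - y1))
    with ((g1 (X s) (Y s) - c1) * (x2 - x1) + (g2 (X s) (Y s) - c2) * (y2 - y1))
    by (rewrite Heq; ring).
  eapply Rle_trans; [apply Rabs_triang|]. rewrite !Rabs_mult.
  assert (A1 := Rabs_pos (x2 - x1)). assert (A2 := Rabs_pos (y2 - y1)). nra.
Qed.

(** End points on the boundary of [D] are reached as limits of segments translated
    into the interior. *)
Lemma boundary_segment_estimate (D : R * R -> Prop) (f g1 g2 : R -> R -> R)
    (x1 y1 x2 y2 d1 d2 h0 c1 c2 e : R) :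
  continuous_on D (uncurry2 f) -> is_pd1 D f g1 -> is_pd2 D f g2 ->
  D (x1, y1) -> D (x2, y2) -> 0 < h0 ->
  (forall h s, 0 < h < h0 -> 0 <= s <= 1 ->
     let z := shifted_segment x1 y1 x2 y2 d1 d2 h s in
     locally z D /\
     Rabs (uncurry2 g1 z - c1) <= e /\ Rabs (uncurry2 g2 z - c2) <= e) ->
  Rabs (f x2 y2 - f x1 y1 - c1 * (x2 - x1) - c2 * (y2 - y1))
  <= e * (Rabs (x2 - x1) + Rabs (y2 - y1)).
Proof.
  intros Hc Hp1 Hp2 HD1 HD2 Hh0 Hs.
  apply Rle_plus_epsilon. intros eps Heps.
  destruct (continuous_on_eps D f x1 y1 (eps / 2) Hc HD1) as [e1 [He1 HC1]]; [lra|].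
  destruct (continuous_on_eps D f x2 y2 (eps / 2) Hc HD2) as [e2 [He2 HC2]]; [lra|].
  set (k := Rabs d1 + Rabs d2 + 1).
  assert (P1 := Rabs_pos d1). assert (P2 := Rabs_pos d2).
  assert (Hk : 0 < k) by (unfold k; lra).
  set (h := Rmin h0 (Rmin e1 e2 / k) / 2).
  assert (He12 : 0 < Rmin e1 e2 / k)
    by (apply Rdiv_lt_0_compat; [now apply Rmin_glb_lt | exact Hk]).
  assert (Hh1 := Rmin_l h0 (Rmin e1 e2 / k)). assert (Hh2 := Rmin_r h0 (Rmin e1 e2 / k)).
  assert (Hh3 := Rmin_glb_lt _ _ _ Hh0 He12).
  assert (Hh : 0 < h < h0) by (unfold h; lra).
  assert (Hhk : h * k < Rmin e1 e2).
  { apply Rlt_le_trans with (Rmin e1 e2 / k * k); [|right; field; lra].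
    apply Rmult_lt_compat_r; [exact Hk | unfold h; lra]. }
  assert (M1 := Rmin_l e1 e2). assert (M2 := Rmin_r e1 e2).
  assert (Hsm1 : Rabs (h * d1) <= h * k).
  { rewrite Rabs_mult, (Rabs_pos_eq h) by lra. apply Rmult_le_compat_l; unfold k; lra. }
  assert (Hsm2 : Rabs (h * d2) <= h * k).
  { rewrite Rabs_mult, (Rabs_pos_eq h) by lra. apply Rmult_le_compat_l; unfold k; lra. }
  assert (Hmain := segment_estimate D f g1 g2 x1 y1 x2 y2 d1 d2 h c1 c2 e Hp1 Hp2
    (fun s Hs01 => Hs h s Hh Hs01)).
  assert (B1 : Rabs (f (x1 + h * d1) (y1 + h * d2) - f x1 y1) < eps / 2).
  { apply HC1.
    - assert (H0 : 0 <= 0 <= 1) by lra.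
      destruct (Hs h 0 Hh H0) as [Hl _]. apply locally_singleton in Hl.
      unfold shifted_segment in Hl. rewrite !Rmult_0_l, !Rplus_0_r in Hl. exact Hl.
    - replace (x1 + h * d1 - x1) with (h * d1) by ring. lra.
    - replace (y1 + h * d2 - y1) with (h * d2) by ring. lra. }
  assert (B2 : Rabs (f (x2 + h * d1) (y2 + h * d2) - f x2 y2) < eps / 2).
  { apply HC2.
    - assert (H0 : 0 <= 1 <= 1) by lra.
      destruct (Hs h 1 Hh H0) as [Hl _]. apply locally_singleton in Hl.
      unfold shifted_segment in Hl. rewrite !Rmult_1_l in Hl.
      replace (x1 + (x2 - x1)) with x2 in Hl by ring.
      replace (y1 + (y2 - y1)) with y2 in Hl by ring. exact Hl.
    - replace (x2 + h * d1 - x2) with (h * d1) by ring. lra.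
    - replace (y2 + h * d2 - y2) with (h * d2) by ring. lra. }
  apply Rabs_lt_between in B1. apply Rabs_lt_between in B2.
  apply Rabs_le_between in Hmain. apply Rabs_le_between. lra.
Qed.

(** [f] is strictly differentiable at [(x0, y0)] relative to [D], with gradient
    [(c1, c2)]. *)
Definition strict_diff_on (D : R * R -> Prop) (f : R -> R -> R) (x0 y0 c1 c2 : R) : Prop :=
  forall e, 0 < e -> exists d, 0 < d /\
    forall x1 y1 x2 y2, D (x1, y1) -> D (x2, y2) ->
      Rabs (x1 - x0) < d -> Rabs (y1 - y0) < d ->
      Rabs (x2 - x0) < d -> Rabs (y2 - y0) < d ->
      Rabs (f x2 y2 - f x1 y1 - c1 * (x2 - x1) - c2 * (y2 - y1))
      <= e * (Rabs (x2 - x1) + Rabs (y2 - y1)).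

Lemma is_derive_eps (f : R -> R) (s l : R) :
  is_derive f s l <->
  forall e, 0 < e -> locally s (fun s' =>
    Rabs (f s' - f s - l * (s' - s)) <= e * Rabs (s' - s)).
Proof.
  assert (E : forall s', minus (minus (f s') (f s)) (scal (minus s' s) l)
                         = f s' - f s - l * (s' - s)).
  { intros s'. unfold minus, plus, opp, scal; simpl. unfold mult; simpl. ring. }
  split.
  - intros [_ Hf] e He.
    assert (Hd := Hf s (fun P HP => HP) (mkposreal e He)).
    revert Hd. apply filter_imp. intros s' Hs'. rewrite E in Hs'. exact Hs'.
  - intros Hf. split; [apply is_linear_scal_l|].
    intros x Hx e.
    apply (is_filter_lim_locally_unique (K := R_AbsRing) (V := R_NormedModule)) in Hx.
    subst x.
    apply filter_imp with (2 := Hf e (cond_pos e)).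
    intros s' Hs'. rewrite E. exact Hs'.
Qed.

(** Chain rule along a curve that stays in [D], possibly on its boundary. *)
Lemma is_derive_curve (D : R * R -> Prop) (f : R -> R -> R) (X Y : R -> R)
    (s lx ly c1 c2 : R) :
  strict_diff_on D f (X s) (Y s) c1 c2 ->
  is_derive X s lx -> is_derive Y s ly ->
  locally s (fun s' => D (X s', Y s')) ->
  is_derive (fun s' => f (X s') (Y s')) s (c1 * lx + c2 * ly).
Proof.
  intros Hf HX HY HD. apply is_derive_eps. intros e He.
  assert (HX' := proj1 (is_derive_eps _ _ _) HX).
  assert (HY' := proj1 (is_derive_eps _ _ _) HY).
  set (k := Rabs c1 + Rabs c2 + (Rabs lx + Rabs ly + 2)).
  assert (P1 := Rabs_pos c1). assert (P2 := Rabs_pos c2).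
  assert (P3 := Rabs_pos lx). assert (P4 := Rabs_pos ly).
  assert (Hk : 0 < k) by (unfold k; lra).
  set (q := e / (2 * k)).
  assert (Hq : e = q * (2 * k)) by (unfold q; field; lra).
  assert (Hq0 : 0 < q) by (apply Rdiv_lt_0_compat; lra).
  destruct (Hf q Hq0) as [df [Hdf HF]].
  assert (HcX : locally s (fun s' => Rabs (X s' - X s) < df)).
  { apply (ex_derive_continuous X s (ex_intro _ _ HX)
             (fun r => Rabs (r - X s) < df)). now exists (mkposreal df Hdf). }
  assert (HcY : locally s (fun s' => Rabs (Y s' - Y s) < df)).
  { apply (ex_derive_continuous Y s (ex_intro _ _ HY)
             (fun r => Rabs (r - Y s) < df)). now exists (mkposreal df Hdf). }
  assert (HDs := locally_singleton s _ HD). cbv beta in HDs.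
  generalize (filter_and _ _ (filter_and _ _ (HX' 1 Rlt_0_1) (HY' 1 Rlt_0_1))
    (filter_and _ _ (filter_and _ _ (HX' q Hq0) (HY' q Hq0))
       (filter_and _ _ HD (filter_and _ _ HcX HcY)))).
  apply filter_imp.
  intros s' [[HX1 HY1] [[HX2 HY2] [HDs' [Hdx Hdy]]]].
  set (D0 := Rabs (s' - s)) in *.
  assert (HD0 : 0 <= D0) by apply Rabs_pos.
  assert (BX : Rabs (X s' - X s) <= (Rabs lx + 1) * D0).
  { replace (X s' - X s) with ((X s' - X s - lx * (s' - s)) + lx * (s' - s)) by ring.
    eapply Rle_trans; [apply Rabs_triang|]. rewrite Rabs_mult. fold D0. lra. }
  assert (BY : Rabs (Y s' - Y s) <= (Rabs ly + 1) * D0).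
  { replace (Y s' - Y s) with ((Y s' - Y s - ly * (s' - s)) + ly * (s' - s)) by ring.
    eapply Rle_trans; [apply Rabs_triang|]. rewrite Rabs_mult. fold D0. lra. }
  assert (HFs : Rabs (f (X s') (Y s') - f (X s) (Y s) - c1 * (X s' - X s) - c2 * (Y s' - Y s))
      <= q * (Rabs (X s' - X s) + Rabs (Y s' - Y s))).
  { apply HF; try assumption; rewrite Rminus_diag, Rabs_R0; assumption. }
  replace (f (X s') (Y s') - f (X s) (Y s) - (c1 * lx + c2 * ly) * (s' - s))
    with ((f (X s') (Y s') - f (X s) (Y s) - c1 * (X s' - X s) - c2 * (Y s' - Y s))
          + (c1 * (X s' - X s - lx * (s' - s)) + c2 * (Y s' - Y s - ly * (s' - s)))) by ring.
  eapply Rle_trans; [apply Rabs_triang|].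
  eapply Rle_trans; [apply Rplus_le_compat; [exact HFs | apply Rabs_triang]|].
  rewrite !Rabs_mult, Hq.
  assert (T1 : Rabs c1 * Rabs (X s' - X s - lx * (s' - s)) <= Rabs c1 * (q * D0))
    by (apply Rmult_le_compat_l; assumption).
  assert (T2 : Rabs c2 * Rabs (Y s' - Y s - ly * (s' - s)) <= Rabs c2 * (q * D0))
    by (apply Rmult_le_compat_l; assumption).
  assert (T3 : q * (Rabs (X s' - X s) + Rabs (Y s' - Y s)) <= q * ((Rabs lx + Rabs ly + 2) * D0))
    by (apply Rmult_le_compat_l; lra).
  assert (0 <= q * D0) by (apply Rmult_le_pos; lra).
  unfold k. nra.
Qed.

(** * Strict differentiability on a sector and on a region bounded by a graph *)

Lemma Rdiv_le_iff (a x y : R) : 0 < a -> (y <= x / a <-> a * y <= x).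
Proof.
  intros Ha. split; intros HH.
  - apply (Rmult_le_compat_l a) in HH; [|lra].
    replace (a * (x / a)) with x in HH by (field; lra). exact HH.
  - apply Rmult_le_reg_l with a; [exact Ha|].
    replace (a * (x / a)) with x by (field; lra). exact HH.
Qed.

Lemma Teps_iff (a eps u v : R) : 0 < a ->
  (Teps a eps (u, v) <-> 0 <= u /\ u <= v /\ a * v <= u /\ u <= a * eps).
Proof.
  intros Ha. unfold Teps; simpl.
  assert (E1 := Rdiv_le_iff a u v Ha).
  assert (E2 : u / a <= eps <-> u <= a * eps).
  { split; intros HH.
    - apply (Rmult_le_compat_l a) in HH; [|lra].
      replace (a * (u / a)) with u in HH by (field; lra). exact HH.
    - apply Rmult_le_reg_l with a; [exact Ha|].
      replace (a * (u / a)) with u by (field; lra). exact HH. }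
  tauto.
Qed.

Lemma locally_lt {T : UniformSpace} (f g : T -> R) (z : T) :
  continuous f z -> continuous g z -> f z < g z ->
  locally z (fun z' => f z' < g z').
Proof.
  intros Hf Hg Hlt.
  set (c := (f z + g z) / 2).
  assert (Hc : f z < c /\ c < g z) by (unfold c; lra). destruct Hc as [Hc1 Hc2].
  assert (L1 : locally z (fun z' => f z' < c))
    by exact (Hf (fun r => r < c) (open_lt c (f z) Hc1)).
  assert (L2 : locally z (fun z' => c < g z'))
    by exact (Hg (fun r => c < r) (open_gt c (g z) Hc2)).
  generalize (filter_and _ _ L1 L2).
  apply filter_imp. intros z' [H1 H2]. lra.
Qed.

Lemma Teps_interior (a eps u v : R) : 0 < a ->
  0 < u -> u < v -> a * v < u -> u < a * eps -> locally (u, v) (Teps a eps).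
Proof.
  intros Ha H1 H2 H3 H4.
  assert (C1 : continuous (fun z : R * R => fst z) (u, v)) by apply continuous_fst.
  assert (C2 : continuous (fun z : R * R => snd z) (u, v)) by apply continuous_snd.
  assert (C3 : continuous (fun z : R * R => a * snd z) (u, v)).
  { apply (continuous_scal_r (K := R_AbsRing) (V := R_NormedModule) a _ _ C2). }
  generalize (filter_and _ _
    (filter_and _ _ (locally_lt (fun _ => 0) _ _ (continuous_const 0 _) C1 H1)
                    (locally_lt _ _ _ C1 C2 H2))
    (filter_and _ _ (locally_lt _ _ _ C3 C1 H3)
                    (locally_lt _ _ _ C1 (continuous_const (a * eps) _) H4))).
  apply filter_imp. intros [u' v'] [[K1 K2] [K3 K4]]. simpl in *.
  apply Teps_iff; [exact Ha|]. lra.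
Qed.

Lemma convex_between (p q x y s : R) :
  0 <= s <= 1 -> p <= x <= q -> p <= y <= q -> p <= x + s * (y - x) <= q.
Proof. intros. split; nra. Qed.

Lemma convex_nonneg (x y s : R) :
  0 <= s <= 1 -> 0 <= x -> 0 <= y -> 0 <= x + s * (y - x).
Proof. intros. nra. Qed.

Lemma Teps_strict_diff (a eps : R) (f g1 g2 : R -> R -> R) (u0 v0 : R) :
  0 < a < 1 ->
  continuous_on (Teps a eps) (uncurry2 f) ->
  is_pd1 (Teps a eps) f g1 -> is_pd2 (Teps a eps) f g2 ->
  Teps a eps (u0, v0) -> u0 < a * eps ->
  strict_diff_on (Teps a eps) f u0 v0 (g1 u0 v0) (g2 u0 v0).
Proof.
  intros Ha Hc Hg1 Hg2 Hz Hu0 e He.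
  destruct (continuous_on_eps _ _ _ _ e (proj1 Hg1) Hz He) as [e1 [He1 HC1]].
  destruct (continuous_on_eps _ _ _ _ e (proj1 Hg2) Hz He) as [e2 [He2 HC2]].
  set (del := Rmin (Rmin e1 e2) (a * eps - u0)).
  assert (Hdel : 0 < del) by (unfold del; repeat apply Rmin_glb_lt; lra).
  assert (Hdel1 : del <= e1) by (unfold del; eapply Rle_trans; apply Rmin_l).
  assert (Hdel2 : del <= e2)
    by (unfold del; eapply Rle_trans; [apply Rmin_l | apply Rmin_r]).
  assert (Hdel3 : del <= a * eps - u0) by apply Rmin_r.
  (* slope of a direction pointing into the sector from each of its points *)
  set (m := (1 + / a) / 2).
  assert (Hia : 1 < / a) by (rewrite <- Rinv_1; apply Rinv_lt_contravar; lra).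
  assert (Ham : a * m < 1) by (unfold m; replace (a * ((1 + / a) / 2)) with ((a + 1) / 2) by (field; lra); lra).
  assert (Hm : 1 < m) by (unfold m; lra).
  exists (del / 2). split; [lra|].
  intros x1 y1 x2 y2 HD1 HD2 Hx1 Hy1 Hx2 Hy2.
  apply boundary_segment_estimate with (D := Teps a eps) (g1 := g1) (g2 := g2)
    (d1 := 1) (d2 := m) (h0 := del / (2 * m)); try assumption.
  { apply Rdiv_lt_0_compat; lra. }
  intros h s Hh Hs z.
  assert (Hhm : h * m < del / 2).
  { apply Rmult_lt_reg_r with (/ m); [apply Rinv_0_lt_compat; lra|].
    replace (h * m * / m) with h by (field; lra).
    replace (del / 2 * / m) with (del / (2 * m)) by (field; lra). lra. }
  assert (Hh1 : h < del / 2) by nra.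
  apply Teps_iff in HD1; [|lra]. apply Teps_iff in HD2; [|lra].
  set (cx := x1 + s * (x2 - x1)). set (cy := y1 + s * (y2 - y1)).
  assert (Hz' : z = (cx + h * 1, cy + h * m)) by reflexivity. clearbody z. subst z.
  apply Rabs_lt_between in Hx1. apply Rabs_lt_between in Hy1.
  apply Rabs_lt_between in Hx2. apply Rabs_lt_between in Hy2.
  assert (Bx : u0 - del / 2 <= cx <= u0 + del / 2) by (apply convex_between; lra).
  assert (By : v0 - del / 2 <= cy <= v0 + del / 2) by (apply convex_between; lra).
  assert (P1 : 0 <= cx) by (apply convex_nonneg; lra).
  assert (P2 : 0 <= cy - cx).
  { replace (cy - cx) with (y1 - x1 + s * ((y2 - x2) - (y1 - x1))) by (unfold cx, cy; ring).
    apply convex_nonneg; lra. }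
  assert (P3 : 0 <= cx - a * cy).
  { replace (cx - a * cy) with (x1 - a * y1 + s * ((x2 - a * y2) - (x1 - a * y1)))
      by (unfold cx, cy; ring).
    apply convex_nonneg; lra. }
  clearbody cx cy.
  assert (Hm1 : h * 1 < h * m) by (apply Rmult_lt_compat_l; lra).
  assert (Hm2 : h * (a * m) < h * 1) by (apply Rmult_lt_compat_l; lra).
  set (hm := h * m) in *.
  assert (Eam : h * (a * m) = a * hm) by (unfold hm; ring).
  assert (Hloc : locally (cx + h * 1, cy + hm) (Teps a eps)).
  { apply Teps_interior; lra. }
  assert (Hxx : Rabs (cx + h * 1 - u0) < del) by (apply Rabs_lt_between; lra).
  assert (Hyy : Rabs (cy + hm - v0) < del) by (apply Rabs_lt_between; lra).
  assert (HT := locally_singleton _ _ Hloc).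
  split; [exact Hloc|].
  split; apply Rlt_le; [apply HC1 | apply HC2]; try assumption; simpl; lra.
Qed.

(** Strict differentiability up to the boundary of a region bounded by [t = 0] and by
    a Lipschitz graph [r = b(t)], lying above the graph if [sg = 1] and below it if
    [sg = -1].  Two points are joined by two segments of constant [t] and one of constant
    [r], so far from the graph that it does not cross it. *)
Lemma graph_region_strict_diff (D : R * R -> Prop) (sg tau L : R) (b : R -> R)
    (f g1 g2 : R -> R -> R) (t0 r0 : R) :
  sg = 1 \/ sg = -1 -> 0 <= L ->
  (forall t r, D (t, r) -> 0 <= t /\ 0 <= sg * (r - b t)) ->
  (forall t r, 0 < t < tau -> 0 < sg * (r - b t) -> 0 < r -> locally (t, r) D) ->
  (forall t r, 0 <= t < tau -> 0 <= sg * (r - b t) -> 0 < r -> D (t, r)) ->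
  (forall t t', 0 <= t < tau -> 0 <= t' < tau -> Rabs (b t' - b t) <= L * Rabs (t' - t)) ->
  continuous_on D (uncurry2 f) -> is_pd1 D f g1 -> is_pd2 D f g2 ->
  D (t0, r0) -> t0 < tau -> 0 < r0 ->
  strict_diff_on D f t0 r0 (g1 t0 r0) (g2 t0 r0).
Proof.
  intros Hsg HL HDin Hint HDout HLip Hc Hg1 Hg2 Hz Ht0 Hr0 e He.
  set (e' := e / (2 * L + 3)).
  assert (He' : 0 < e') by (apply Rdiv_lt_0_compat; lra).
  assert (Ee : e = e' * (2 * L + 3)) by (unfold e'; field; lra).
  destruct (continuous_on_eps _ _ _ _ e' (proj1 Hg1) Hz He') as [e1 [He1 HC1]].
  destruct (continuous_on_eps _ _ _ _ e' (proj1 Hg2) Hz He') as [e2 [He2 HC2]].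
  set (del := Rmin (Rmin e1 e2) (Rmin (tau - t0) r0)).
  assert (Hdel : 0 < del) by (unfold del; repeat apply Rmin_glb_lt; lra).
  assert (Hdel1 : del <= e1) by (unfold del; eapply Rle_trans; apply Rmin_l).
  assert (Hdel2 : del <= e2)
    by (unfold del; eapply Rle_trans; [apply Rmin_l | apply Rmin_r]).
  assert (Hdel3 : del <= tau - t0)
    by (unfold del; eapply Rle_trans; [apply Rmin_r | apply Rmin_l]).
  assert (Hdel4 : del <= r0)
    by (unfold del; eapply Rle_trans; [apply Rmin_r | apply Rmin_r]).
  set (d := del / (4 * L + 4)).
  assert (Hd : 0 < d) by (apply Rdiv_lt_0_compat; lra).
  assert (Ed : del = d * (4 * L + 4)) by (unfold d; field; lra).
  assert (HLd : 0 <= L * d) by nra.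
  set (good := fun t r => 0 <= t /\ Rabs (t - t0) <= d /\ 0 <= sg * (r - b t) /\
                          Rabs (r - r0) <= d + 2 * (L * d)).
  assert (Hgood : forall t r, good t r -> D (t, r)).
  { intros t r (G1 & G2 & G3 & G4).
    apply Rabs_le_between in G2. apply Rabs_le_between in G4.
    apply HDout; [split; [exact G1 | nra] | exact G3 | nra]. }
  assert (Hleg : forall x1 y1 x2 y2,
    (forall s, 0 <= s <= 1 -> good (x1 + s * (x2 - x1)) (y1 + s * (y2 - y1))) ->
    Rabs (f x2 y2 - f x1 y1 - g1 t0 r0 * (x2 - x1) - g2 t0 r0 * (y2 - y1))
    <= e' * (Rabs (x2 - x1) + Rabs (y2 - y1))).
  { intros x1 y1 x2 y2 HG.
    apply boundary_segment_estimate with (D := D) (g1 := g1) (g2 := g2)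
      (d1 := 1) (d2 := sg * (L + 1)) (h0 := d); try assumption.
    { apply Hgood. specialize (HG 0 ltac:(lra)).
      replace (x1 + 0 * (x2 - x1)) with x1 in HG by ring.
      replace (y1 + 0 * (y2 - y1)) with y1 in HG by ring. exact HG. }
    { apply Hgood. specialize (HG 1 ltac:(lra)).
      replace (x1 + 1 * (x2 - x1)) with x2 in HG by ring.
      replace (y1 + 1 * (y2 - y1)) with y2 in HG by ring. exact HG. }
    intros h s Hh Hs z.
    specialize (HG s Hs).
    set (t := x1 + s * (x2 - x1)) in *. set (r := y1 + s * (y2 - y1)) in *.
    assert (Hz' : z = (t + h * 1, r + h * (sg * (L + 1)))) by reflexivity.
    clearbody z t r. subst z. destruct HG as (G1 & G2 & G3 & G4).
    apply Rabs_le_between in G2. apply Rabs_le_between in G4.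
    assert (HLb := HLip t (t + h * 1) ltac:(nra) ltac:(nra)).
    replace (t + h * 1 - t) with h in HLb by ring.
    rewrite (Rabs_pos_eq h) in HLb by lra. apply Rabs_le_between in HLb.
    assert (HLh : 0 <= L * h <= L * d) by nra.
    assert (K1 : Rabs (t + h * 1 - t0) < del) by (apply Rabs_lt_between; nra).
    assert (K2 : Rabs (r + h * (sg * (L + 1)) - r0) < del)
      by (apply Rabs_lt_between; destruct Hsg; subst sg; nra).
    assert (Hloc : locally (t + h * 1, r + h * (sg * (L + 1))) D).
    { apply Rabs_lt_between in K1. apply Rabs_lt_between in K2.
      apply Hint; [lra | | lra]. destruct Hsg; subst sg; lra. }
    assert (HD' := locally_singleton _ _ Hloc).
    split; [exact Hloc|].
    split; apply Rlt_le; [apply HC1 | apply HC2]; try assumption; simpl; lra. }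
  exists d. split; [exact Hd|].
  intros x1 y1 x2 y2 HD1 HD2 Hx1 Hy1 Hx2 Hy2.
  destruct (HDin _ _ HD1) as [P1 Q1]. destruct (HDin _ _ HD2) as [P2 Q2].
  set (dx := Rabs (x2 - x1)). set (dy := Rabs (y2 - y1)).
  apply Rabs_lt_between in Hx1. apply Rabs_lt_between in Hy1.
  apply Rabs_lt_between in Hx2. apply Rabs_lt_between in Hy2.
  assert (Hdx : 0 <= dx <= 2 * d).
  { split; [apply Rabs_pos|]. apply Rabs_le_between. lra. }
  assert (HLdx : 0 <= L * dx <= L * (2 * d)) by nra.
  set (mx := Rmax (sg * y1) (sg * y2)). set (rho := sg * (mx + L * dx)).
  assert (Hmx1 : sg * y1 <= mx) by apply Rmax_l.
  assert (Hmx2 : sg * y2 <= mx) by apply Rmax_r.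
  assert (Hmx : mx = sg * y1 \/ mx = sg * y2)
    by (unfold mx; destruct (Rle_dec (sg * y1) (sg * y2));
        [rewrite Rmax_right by lra | rewrite Rmax_left by lra]; auto).
  assert (Hdy : 0 <= dy /\ y2 - y1 <= dy /\ y1 - y2 <= dy).
  { unfold dy. split; [apply Rabs_pos|]. split; [apply Rle_abs|].
    rewrite Rabs_minus_sym. apply Rle_abs. }
  assert (Hrho : Rabs (rho - r0) <= d + 2 * (L * d)).
  { unfold rho. apply Rabs_le_between. destruct Hsg; subst sg; nra. }
  assert (Hr1 : Rabs (rho - y1) <= dy + L * dx).
  { unfold rho. apply Rabs_le_between. destruct Hsg; subst sg; nra. }
  assert (Hr2 : Rabs (y2 - rho) <= dy + L * dx).
  { unfold rho. apply Rabs_le_between. destruct Hsg; subst sg; nra. }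
  assert (Hmid : forall t, 0 <= t < tau -> Rabs (t - x1) <= dx ->
            0 <= sg * (rho - b t)).
  { intros t Ht Htx. assert (HLb := HLip x1 t ltac:(nra) Ht).
    assert (HLt : L * Rabs (t - x1) <= L * dx) by (apply Rmult_le_compat_l; assumption).
    apply Rabs_le_between in HLb. unfold rho. destruct Hsg; subst sg; nra. }
  assert (Hend : 0 <= sg * (rho - b x1) /\ 0 <= sg * (rho - b x2)).
  { split; apply Hmid; try nra.
    - rewrite Rminus_diag, Rabs_R0. lra.
    - unfold dx; lra. }
  apply Rabs_le_between in Hrho.
  assert (L1 := Hleg x1 y1 x1 rho). assert (L2 := Hleg x1 rho x2 rho).
  assert (L3 := Hleg x2 rho x2 y2).
  assert (HLe : 0 <= L * d) by nra.
  assert (B1 : Rabs (f x1 rho - f x1 y1 - g1 t0 r0 * (x1 - x1) - g2 t0 r0 * (rho - y1))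
               <= e' * (Rabs (x1 - x1) + Rabs (rho - y1))).
  { apply L1. intros s Hs. unfold good.
    replace (x1 + s * (x1 - x1)) with x1 by ring.
    repeat split; [exact P1 | apply Rabs_le_between; lra | |apply Rabs_le_between].
    - replace (sg * (y1 + s * (rho - y1) - b x1))
        with (sg * (y1 - b x1) + s * (sg * (rho - b x1) - sg * (y1 - b x1))) by ring.
      apply convex_nonneg; tauto.
    - replace (y1 + s * (rho - y1) - r0) with (y1 - r0 + s * ((rho - r0) - (y1 - r0))) by ring.
      apply convex_between; lra. }
  assert (B2 : Rabs (f x2 rho - f x1 rho - g1 t0 r0 * (x2 - x1) - g2 t0 r0 * (rho - rho))
               <= e' * (Rabs (x2 - x1) + Rabs (rho - rho))).
  { apply L2. intros s Hs. unfold good.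
    replace (rho + s * (rho - rho)) with rho by ring.
    assert (Hx0 : 0 <= x1 + s * (x2 - x1)) by (apply convex_nonneg; assumption).
    assert (Hxt : - d <= x1 + s * (x2 - x1) - t0 <= d).
    { replace (x1 + s * (x2 - x1) - t0) with (x1 - t0 + s * ((x2 - t0) - (x1 - t0))) by ring.
      apply convex_between; lra. }
    repeat split; [exact Hx0 | apply Rabs_le_between; lra | | apply Rabs_le_between; lra].
    apply Hmid; [lra|].
    replace (x1 + s * (x2 - x1) - x1) with (s * (x2 - x1)) by ring.
    rewrite Rabs_mult, (Rabs_pos_eq s) by lra. fold dx.
    rewrite <- (Rmult_1_l dx) at 2. apply Rmult_le_compat_r; lra. }
  assert (B3 : Rabs (f x2 y2 - f x2 rho - g1 t0 r0 * (x2 - x2) - g2 t0 r0 * (y2 - rho))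
               <= e' * (Rabs (x2 - x2) + Rabs (y2 - rho))).
  { apply L3. intros s Hs. unfold good.
    replace (x2 + s * (x2 - x2)) with x2 by ring.
    repeat split; [exact P2 | apply Rabs_le_between; lra | |apply Rabs_le_between].
    - replace (sg * (rho + s * (y2 - rho) - b x2))
        with (sg * (rho - b x2) + s * (sg * (y2 - b x2) - sg * (rho - b x2))) by ring.
      apply convex_nonneg; tauto.
    - replace (rho + s * (y2 - rho) - r0) with (rho - r0 + s * ((y2 - r0) - (rho - r0))) by ring.
      apply convex_between; lra. }
  replace (f x2 y2 - f x1 y1 - g1 t0 r0 * (x2 - x1) - g2 t0 r0 * (y2 - y1))
    with ((f x1 rho - f x1 y1 - g1 t0 r0 * (x1 - x1) - g2 t0 r0 * (rho - y1))
          + ((f x2 rho - f x1 rho - g1 t0 r0 * (x2 - x1) - g2 t0 r0 * (rho - rho))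
             + (f x2 y2 - f x2 rho - g1 t0 r0 * (x2 - x2) - g2 t0 r0 * (y2 - rho)))) by ring.
  eapply Rle_trans; [apply Rabs_triang|].
  eapply Rle_trans; [apply Rplus_le_compat_l, Rabs_triang|].
  replace (x1 - x1) with 0 in B1 at 2 by ring.
  replace (rho - rho) with 0 in B2 at 2 by ring.
  replace (x2 - x2) with 0 in B3 at 2 by ring.
  rewrite Rabs_R0 in B1, B2, B3. fold dx in B2 |- *. fold dy.
  rewrite Ee.
  assert (e' * (0 + Rabs (rho - y1)) <= e' * (dy + L * dx)) by (apply Rmult_le_compat_l; lra).
  assert (e' * (0 + Rabs (y2 - rho)) <= e' * (dy + L * dx)) by (apply Rmult_le_compat_l; lra).
  assert (0 <= e' * dy) by (apply Rmult_le_pos; lra).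
  assert (0 <= L * (e' * dy)) by (apply Rmult_le_pos; lra).
  assert (0 <= e' * dx) by (apply Rmult_le_pos; lra).
  assert (0 <= L * (e' * dx)) by (apply Rmult_le_pos; lra).
  replace (e' * (2 * L + 3) * (dx + dy))
    with (2 * (L * (e' * dx)) + 2 * (L * (e' * dy)) + 3 * (e' * dx) + 3 * (e' * dy)) by ring.
  lra.
Qed.

(** * Differences of two solutions: the calculus of [lip] and [principal_part] *)

Lemma filterlim_locally_eps {I : Type} (F : (I -> Prop) -> Prop) {FF : Filter F}
    (q : I -> R) (q0 : R) :
  filterlim q F (locally q0) <->
  forall e, 0 < e -> F (fun z => Rabs (q z - q0) < e).
Proof.
  split.
  - intros Hq e He. apply (Hq (fun r => Rabs (r - q0) < e)).
    now exists (mkposreal e He).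
  - intros Hq P [e He]. unfold filtermap.
    apply filter_imp with (2 := Hq e (cond_pos e)). intros z Hz. now apply He.
Qed.

(** [q true] and [q false] are the values of a quantity on two solutions, as functions
    of a point; both tend to [q0] along [F], and their difference is bounded by a
    multiple of the weight [m]. *)
Definition lip {I : Type} (F : (I -> Prop) -> Prop) (m : I -> R)
    (q : bool -> I -> R) (q0 : R) : Prop :=
  (forall k, filterlim (q k) F (locally q0)) /\
  exists C, 0 <= C /\ F (fun z => Rabs (q true z - q false z) <= C * m z).

(** [f] is Lipschitz in some neighbourhood of [x0]. *)
Definition locally_lipschitz (f : R -> R) (x0 : R) : Prop :=
  exists C, 0 <= C /\ exists d, 0 < d /\ forall x y,
    Rabs (x - x0) < d -> Rabs (y - x0) < d -> Rabs (f x - f y) <= C * Rabs (x - y).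

Lemma mean_value_bound (f df : R -> R) (M a b : R) :
  (forall x, Rmin a b < x < Rmax a b -> is_derive f x (df x)) ->
  (forall x, Rmin a b <= x <= Rmax a b -> continuity_pt f x) ->
  (forall x, Rmin a b <= x <= Rmax a b -> Rabs (df x) <= M) ->
  Rabs (f b - f a) <= M * Rabs (b - a).
Proof.
  intros Hd Hc HM.
  destruct (MVT_gen f a b df Hd Hc) as [c [Hc1 Hc2]].
  rewrite Hc2, Rabs_mult. apply Rmult_le_compat_r; [apply Rabs_pos | now apply HM].
Qed.

Lemma locally_lipschitz_C1 (f df : R -> R) (x0 : R) :
  locally x0 (fun x => is_derive f x (df x)) -> continuous df x0 ->
  locally_lipschitz f x0.
Proof.
  intros Hd Hc.
  assert (Hb : locally x0 (fun x => Rabs (df x - df x0) < 1)).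
  { apply (Hc (fun r => Rabs (r - df x0) < 1)). now exists (mkposreal 1 Rlt_0_1). }
  destruct (filter_and _ _ Hd Hb) as [d HH].
  exists (Rabs (df x0) + 1). split; [generalize (Rabs_pos (df x0)); lra|].
  exists d. split; [apply cond_pos|].
  intros x y Hx Hy.
  assert (HH' : forall z, Rmin y x <= z <= Rmax y x ->
            is_derive f z (df z) /\ Rabs (df z - df x0) < 1).
  { intros z Hz. apply HH. change (Rabs (z - x0) < d).
    apply Rabs_lt_between in Hx. apply Rabs_lt_between in Hy. apply Rabs_lt_between.
    revert Hz. unfold Rmin, Rmax. destruct (Rle_dec y x); lra. }
  apply mean_value_bound with df.
  - intros z Hz. apply HH'. lra.
  - intros z Hz. apply derivable_continuous_pt. eexists. apply is_derive_Reals, HH', Hz.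
  - intros z Hz. destruct (HH' z Hz) as [_ H1].
    replace (df z) with ((df z - df x0) + df x0) by ring.
    eapply Rle_trans; [apply Rabs_triang|]. lra.
Qed.

Section Lip.
Context {I : Type} {F : (I -> Prop) -> Prop} {FF : Filter F}.

Section Weight.
Context {m : I -> R}.

Lemma lip_const (c : R) : lip F m (fun _ _ => c) c.
Proof.
  split; [intros k; apply filterlim_const|].
  exists 0. split; [lra|]. apply filter_forall. intros z.
  rewrite Rminus_diag, Rabs_R0. lra.
Qed.

Lemma lip_ext (q r : bool -> I -> R) (q0 : R) :
  (forall k, F (fun z => q k z = r k z)) -> lip F m q q0 -> lip F m r q0.
Proof.
  intros He [Hl [C [HC Hb]]]. split.
  - intros k. apply filterlim_ext_loc with (2 := Hl k). apply He.
  - exists C. split; [exact HC|].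
    generalize (filter_and _ _ Hb (filter_and _ _ (He true) (He false))).
    apply filter_imp. intros z [H1 [H2 H3]]. now rewrite <- H2, <- H3.
Qed.

Lemma lip_plus (q r : bool -> I -> R) (q0 r0 : R) :
  lip F m q q0 -> lip F m r r0 -> lip F m (fun k z => q k z + r k z) (q0 + r0).
Proof.
  intros [Hq [C [HC Hb]]] [Hr [C' [HC' Hb']]]. split.
  - intros k.
    apply (filterlim_comp_2 (q k) (r k) Rplus (Hq k) (Hr k)).
    apply (filterlim_plus (K := R_AbsRing) (V := R_NormedModule)).
  - exists (C + C'). split; [lra|].
    generalize (filter_and _ _ Hb Hb'). apply filter_imp. intros z [H1 H2].
    replace (q true z + r true z - (q false z + r false z))
      with ((q true z - q false z) + (r true z - r false z)) by ring.
    eapply Rle_trans; [apply Rabs_triang|]. lra.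
Qed.

Lemma lip_mult (q r : bool -> I -> R) (q0 r0 : R) :
  lip F m q q0 -> lip F m r r0 -> lip F m (fun k z => q k z * r k z) (q0 * r0).
Proof.
  intros [Hq [C [HC Hb]]] [Hr [C' [HC' Hb']]]. split.
  - intros k.
    apply (filterlim_comp_2 (q k) (r k) Rmult (Hq k) (Hr k)).
    apply (filterlim_mult (K := R_AbsRing)).
  - assert (P1 := Rabs_pos q0). assert (P2 := Rabs_pos r0).
    exists ((Rabs q0 + 1) * C' + (Rabs r0 + 1) * C). split; [nra|].
    assert (L1 := proj1 (filterlim_locally_eps F _ _) (Hq true) 1 Rlt_0_1).
    assert (L2 := proj1 (filterlim_locally_eps F _ _) (Hr false) 1 Rlt_0_1).
    generalize (filter_and _ _ (filter_and _ _ Hb Hb') (filter_and _ _ L1 L2)).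
    apply filter_imp. intros z [[H1 H2] [H3 H4]].
    replace (q true z * r true z - q false z * r false z)
      with (q true z * (r true z - r false z) + r false z * (q true z - q false z)) by ring.
    eapply Rle_trans; [apply Rabs_triang|]. rewrite !Rabs_mult.
    assert (H5 : Rabs (q true z) <= Rabs q0 + 1).
    { replace (q true z) with ((q true z - q0) + q0) by ring.
      eapply Rle_trans; [apply Rabs_triang|]. lra. }
    assert (H6 : Rabs (r false z) <= Rabs r0 + 1).
    { replace (r false z) with ((r false z - r0) + r0) by ring.
      eapply Rle_trans; [apply Rabs_triang|]. lra. }
    rewrite Rmult_plus_distr_r, !Rmult_assoc.
    apply Rplus_le_compat; apply Rmult_le_compat; try assumption; apply Rabs_pos.
Qed.

Lemma lip_comp (f : R -> R) (q : bool -> I -> R) (q0 : R) :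
  locally_lipschitz f q0 -> lip F m q q0 -> lip F m (fun k z => f (q k z)) (f q0).
Proof.
  intros [L [HL [d [Hd Hf]]]] [Hq [C [HC Hb]]]. split.
  - intros k. apply filterlim_locally_eps; [assumption|]. intros e He.
    assert (He' : 0 < Rmin d (e / (L + 1))).
    { apply Rmin_glb_lt; [exact Hd|]. apply Rdiv_lt_0_compat; lra. }
    apply filter_imp with (2 := proj1 (filterlim_locally_eps F _ _) (Hq k) _ He').
    intros z Hz.
    assert (H1 : Rabs (q k z - q0) < d) by (eapply Rlt_le_trans; [exact Hz | apply Rmin_l]).
    assert (H2 : Rabs (q k z - q0) < e / (L + 1))
      by (eapply Rlt_le_trans; [exact Hz | apply Rmin_r]).
    eapply Rle_lt_trans; [apply Hf; [exact H1|]|].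
    { rewrite Rminus_diag, Rabs_R0. exact Hd. }
    assert (P := Rabs_pos (q k z - q0)).
    assert (e = (L + 1) * (e / (L + 1))) by (field; lra). nra.
  - exists (L * C). split; [nra|].
    assert (L1 := proj1 (filterlim_locally_eps F _ _) (Hq true) d Hd).
    assert (L2 := proj1 (filterlim_locally_eps F _ _) (Hq false) d Hd).
    generalize (filter_and _ _ Hb (filter_and _ _ L1 L2)).
    apply filter_imp. intros z [H1 [H2 H3]].
    eapply Rle_trans; [apply Hf; assumption|].
    rewrite Rmult_assoc. now apply Rmult_le_compat_l.
Qed.

Lemma lip_opp (q : bool -> I -> R) (q0 : R) :
  lip F m q q0 -> lip F m (fun k z => - q k z) (- q0).
Proof.
  intros [Hq [C [HC Hb]]]. split.
  - intros k. apply (filterlim_comp _ _ _ (q k) Ropp _ _ _ (Hq k)).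
    apply (filterlim_opp (K := R_AbsRing) (V := R_NormedModule)).
  - exists C. split; [exact HC|]. revert Hb. apply filter_imp. intros z Hz.
    replace (- q true z - - q false z) with (- (q true z - q false z)) by ring.
    now rewrite Rabs_Ropp.
Qed.

Lemma lip_minus (q r : bool -> I -> R) (q0 r0 : R) :
  lip F m q q0 -> lip F m r r0 -> lip F m (fun k z => q k z - r k z) (q0 - r0).
Proof. intros Hq Hr. apply lip_plus; [exact Hq | now apply lip_opp]. Qed.

Lemma locally_lipschitz_inv (x0 : R) : x0 <> 0 -> locally_lipschitz Rinv x0.
Proof.
  intros Hx0. apply locally_lipschitz_C1 with (df := fun x => - / x ^ 2).
  - assert (HR : 0 < Rabs x0) by now apply Rabs_pos_lt.
    exists (mkposreal _ HR). intros y Hy. change (Rabs (y - x0) < Rabs x0) in Hy.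
    assert (y <> 0).
    { intros ->. rewrite Rminus_0_l, Rabs_Ropp in Hy. lra. }
    auto_derive; [assumption | field; assumption].
  - apply (ex_derive_continuous (V := R_NormedModule)). auto_derive.
    now apply Rmult_integral_contrapositive_currified; [|rewrite Rmult_1_r].
Qed.

Lemma lip_inv (q : bool -> I -> R) (q0 : R) :
  q0 <> 0 -> lip F m q q0 -> lip F m (fun k z => / q k z) (/ q0).
Proof. intros H0. now apply lip_comp, locally_lipschitz_inv. Qed.

Lemma lip_div (q r : bool -> I -> R) (q0 r0 : R) :
  r0 <> 0 -> lip F m q q0 -> lip F m r r0 -> lip F m (fun k z => q k z / r k z) (q0 / r0).
Proof. intros H0 Hq Hr. apply lip_mult; [exact Hq | now apply lip_inv]. Qed.

Lemma lip_pow (q : bool -> I -> R) (q0 : R) (n : nat) :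
  lip F m q q0 -> lip F m (fun k z => q k z ^ n) (q0 ^ n).
Proof.
  intros Hq. induction n as [|n IH]; simpl; [apply lip_const | now apply lip_mult].
Qed.

(** Composition with a function of two variables that is strictly differentiable, hence
    Lipschitz, relative to a set [D] in which the arguments stay. *)
Lemma lip_comp2 (D : R * R -> Prop) (f : R -> R -> R) (q r : bool -> I -> R)
    (q0 r0 c1 c2 : R) :
  strict_diff_on D f q0 r0 c1 c2 -> D (q0, r0) ->
  (forall k, F (fun z => D (q k z, r k z))) ->
  lip F m q q0 -> lip F m r r0 -> lip F m (fun k z => f (q k z) (r k z)) (f q0 r0).
Proof.
  intros Hf HD0 HD [Hq [C [HC Hb]]] [Hr [C' [HC' Hb']]].
  destruct (Hf 1 Rlt_0_1) as [d [Hd Hfd]].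
  assert (P1 := Rabs_pos c1). assert (P2 := Rabs_pos c2).
  set (L := Rabs c1 + Rabs c2 + 1).
  assert (HL : 0 <= L) by (unfold L; lra).
  assert (HLip : forall x1 y1 x2 y2, D (x1, y1) -> D (x2, y2) ->
      Rabs (x1 - q0) < d -> Rabs (y1 - r0) < d ->
      Rabs (x2 - q0) < d -> Rabs (y2 - r0) < d ->
      Rabs (f x2 y2 - f x1 y1) <= L * (Rabs (x2 - x1) + Rabs (y2 - y1))).
  { intros x1 y1 x2 y2 K1 K2 K3 K4 K5 K6.
    assert (HH := Hfd x1 y1 x2 y2 K1 K2 K3 K4 K5 K6).
    replace (f x2 y2 - f x1 y1)
      with ((f x2 y2 - f x1 y1 - c1 * (x2 - x1) - c2 * (y2 - y1))
            + (c1 * (x2 - x1) + c2 * (y2 - y1))) by ring.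
    eapply Rle_trans; [apply Rabs_triang|].
    eapply Rle_trans; [apply Rplus_le_compat; [exact HH | apply Rabs_triang]|].
    rewrite !Rabs_mult. assert (K7 := Rabs_pos (x2 - x1)). assert (K8 := Rabs_pos (y2 - y1)).
    assert (K9 := Rmult_le_pos _ _ P1 K8). assert (K10 := Rmult_le_pos _ _ P2 K7).
    unfold L. lra. }
  assert (Lq := fun k => proj1 (filterlim_locally_eps F _ _) (Hq k)).
  assert (Lr := fun k => proj1 (filterlim_locally_eps F _ _) (Hr k)).
  split.
  - intros k. apply filterlim_locally_eps; [assumption|]. intros e He.
    assert (He' : 0 < Rmin d (e / (2 * (L + 1)))).
    { apply Rmin_glb_lt; [exact Hd|]. apply Rdiv_lt_0_compat; lra. }
    generalize (filter_and _ _ (HD k) (filter_and _ _ (Lq k _ He') (Lr k _ He'))).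
    apply filter_imp. intros z [H1 [H2 H3]].
    assert (M1 := Rmin_l d (e / (2 * (L + 1)))). assert (M2 := Rmin_r d (e / (2 * (L + 1)))).
    eapply Rle_lt_trans.
    { apply HLip; try assumption; try lra; rewrite Rminus_diag, Rabs_R0; exact Hd. }
    assert (Ee : e = 2 * ((L + 1) * (e / (2 * (L + 1))))) by (field; lra).
    assert (Q1 := Rabs_pos (q k z - q0)). assert (Q2 := Rabs_pos (r k z - r0)). nra.
  - exists (L * (C + C')). split; [nra|].
    generalize (filter_and _ _ (filter_and _ _ Hb Hb')
      (filter_and _ _ (filter_and _ _ (HD true) (HD false))
         (filter_and _ _ (filter_and _ _ (Lq true d Hd) (Lq false d Hd))
                         (filter_and _ _ (Lr true d Hd) (Lr false d Hd))))).
    apply filter_imp. intros z [[B1 B2] [[D1 D2] [[Q1 Q2] [R1 R2]]]].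
    eapply Rle_trans; [apply HLip; assumption|].
    rewrite Rmult_assoc. apply Rmult_le_compat_l; lra.
Qed.

End Weight.

Lemma lip_weight (m n : I -> R) (q : bool -> I -> R) (q0 : R) :
  (forall z, m z <= n z) -> lip F m q q0 -> lip F n q q0.
Proof.
  intros Hmn [Hq [C [HC Hb]]]. split; [exact Hq|].
  exists C. split; [exact HC|]. revert Hb. apply filter_imp. intros z Hz.
  eapply Rle_trans; [exact Hz|]. now apply Rmult_le_compat_l.
Qed.

Lemma lip_filter_le (G : (I -> Prop) -> Prop) (m : I -> R) (q : bool -> I -> R) (q0 : R) :
  filter_le F G -> lip G m q q0 -> lip F m q q0.
Proof.
  intros HFG [Hq [C [HC Hb]]]. split.
  - intros k. exact (filterlim_filter_le_1 _ HFG (Hq k)).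
  - exists C. split; [exact HC | now apply HFG].
Qed.

(** The difference of the two values of [g] is [l], up to [O(m) + o(n)]. *)
Definition principal_part (m n : I -> R) (g : bool -> I -> R) (l : I -> R) : Prop :=
  exists C, 0 <= C /\ forall e, 0 < e -> F (fun z =>
    Rabs (g true z - g false z - l z) <= C * m z + e * n z).

Lemma principal_part_plus (m n : I -> R) (g g' : bool -> I -> R) (l l' : I -> R) :
  principal_part m n g l -> principal_part m n g' l' ->
  principal_part m n (fun k z => g k z + g' k z) (fun z => l z + l' z).
Proof.
  intros [C [HC Hg]] [C' [HC' Hg']].
  exists (C + C'). split; [lra|]. intros e He.
  assert (He2 : 0 < e / 2) by lra.
  generalize (filter_and _ _ (Hg _ He2) (Hg' _ He2)).
  apply filter_imp. intros z [H1 H2].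
  replace (g true z + g' true z - (g false z + g' false z) - (l z + l' z))
    with ((g true z - g false z - l z) + (g' true z - g' false z - l' z)) by ring.
  eapply Rle_trans; [apply Rabs_triang|]. lra.
Qed.

(** If the coefficient [c] differs by [O(m)] from one solution to the other, and the
    unknown [y] by [O(n)], the difference of [c y] is that of [y] times the limit of [c]. *)
Lemma principal_part_mult (m n : I -> R) (c y : bool -> I -> R) (c0 y0 : R) :
  (forall z, 0 <= n z) -> lip F m c c0 -> lip F n y y0 ->
  principal_part m n (fun k z => c k z * y k z) (fun z => c0 * (y true z - y false z)).
Proof.
  intros Hn [Hc [C [HC Hb]]] [Hy [C' [HC' Hb']]].
  exists (C * (Rabs y0 + 1)). assert (P := Rabs_pos y0). split; [nra|].
  intros e He.
  assert (He' : 0 < e / (C' + 1)) by (apply Rdiv_lt_0_compat; lra).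
  assert (L1 := proj1 (filterlim_locally_eps F _ _) (Hc true) _ He').
  assert (L2 := proj1 (filterlim_locally_eps F _ _) (Hy false) 1 Rlt_0_1).
  generalize (filter_and _ _ (filter_and _ _ Hb Hb') (filter_and _ _ L1 L2)).
  apply filter_imp. intros z [[H1 H2] [H3 H4]].
  replace (c true z * y true z - c false z * y false z - c0 * (y true z - y false z))
    with ((c true z - c false z) * y false z + (c true z - c0) * (y true z - y false z)) by ring.
  eapply Rle_trans; [apply Rabs_triang|]. rewrite !Rabs_mult.
  assert (H5 : Rabs (y false z) <= Rabs y0 + 1).
  { replace (y false z) with ((y false z - y0) + y0) by ring.
    eapply Rle_trans; [apply Rabs_triang|]. lra. }
  specialize (Hn z).
  set (dq := Rabs (c true z - c false z)) in *. set (dy := Rabs (y true z - y false z)) in *.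
  assert (0 <= dq) by apply Rabs_pos. assert (0 <= dy) by apply Rabs_pos.
  assert (0 <= Rabs (y false z)) by apply Rabs_pos.
  assert (T1 : dq * Rabs (y false z) <= C * m z * (Rabs y0 + 1))
    by (apply Rmult_le_compat; assumption).
  assert (T2 : Rabs (c true z - c0) * dy <= e / (C' + 1) * dy)
    by (apply Rmult_le_compat_r; lra).
  assert (T3 : e / (C' + 1) * dy <= e / (C' + 1) * (C' * n z))
    by (apply Rmult_le_compat_l; lra).
  assert (T4 : e * n z = e / (C' + 1) * (C' * n z) + e / (C' + 1) * n z) by (field; lra).
  assert (0 <= e / (C' + 1) * n z) by (apply Rmult_le_pos; lra).
  lra.
Qed.

Lemma principal_part_relation (m n : I -> R) (g : bool -> I -> R) (l : I -> R) :
  (forall k, F (fun z => g k z = 0)) -> principal_part m n g l ->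
  exists C, 0 <= C /\ forall e, 0 < e -> F (fun z => Rabs (l z) <= C * m z + e * n z).
Proof.
  intros H0 [C [HC Hg]]. exists C. split; [exact HC|]. intros e He.
  generalize (filter_and _ _ (Hg e He) (filter_and _ _ (H0 true) (H0 false))).
  apply filter_imp. intros z [H1 [H2 H3]].
  rewrite H2, H3 in H1. rewrite <- Rabs_Ropp.
  now replace (- l z) with (0 - 0 - l z) by ring.
Qed.
End Lip.

(** * Equation of state and Riemann invariants *)

(** An increasing function [P] on the positive half-line, with derivative [dP > 0]: its
    inverse is continuous, locally Lipschitz and differentiable.  The inverse appears as a
    solution [r] of [P (r s) = x s], so that no inverse function has to be chosen. *)
Section Inverse.
Context (P dP : R -> R).
Context (HP : forall x, 0 < x -> is_derive P x (dP x)).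
Context (HdP : forall x, 0 < x -> 0 < dP x).

Lemma derivative_pos_increasing (x y : R) : 0 < x -> x < y -> P x < P y.
Proof.
  intros Hx Hxy.
  destruct (MVT_gen P x y dP) as [c [Hc Heq]].
  - intros z. rewrite Rmin_left by lra. intros. apply HP. lra.
  - intros z. rewrite Rmin_left by lra. intros.
    apply derivable_continuous_pt. eexists. apply is_derive_Reals, HP. lra.
  - rewrite Rmin_left in Hc by lra. assert (0 < dP c) by (apply HdP; lra). nra.
Qed.

Lemma increasing_inverse_continuous (x0 e : R) : 0 < x0 -> 0 < e ->
  exists d, 0 < d /\ forall x, 0 < x -> Rabs (P x - P x0) < d -> Rabs (x - x0) < e.
Proof.
  intros Hx0 He.
  set (e1 := Rmin e (x0 / 2)).
  assert (He1 : 0 < e1) by (apply Rmin_glb_lt; lra).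
  assert (He2 : e1 <= e) by apply Rmin_l. assert (He3 : e1 <= x0 / 2) by apply Rmin_r.
  assert (I1 := derivative_pos_increasing (x0 - e1) x0 ltac:(lra) ltac:(lra)).
  assert (I2 := derivative_pos_increasing x0 (x0 + e1) ltac:(lra) ltac:(lra)).
  exists (Rmin (P x0 - P (x0 - e1)) (P (x0 + e1) - P x0)).
  split; [apply Rmin_glb_lt; lra|].
  intros x Hx Hd.
  assert (M1 := Rmin_l (P x0 - P (x0 - e1)) (P (x0 + e1) - P x0)).
  assert (M2 := Rmin_r (P x0 - P (x0 - e1)) (P (x0 + e1) - P x0)).
  apply Rabs_lt_between in Hd. apply Rabs_lt_between. split.
  - destruct (Rle_lt_dec x (x0 - e1)) as [Hle | Hlt]; [|lra].
    destruct Hle as [Hlt | ->]; [|lra].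
    assert (P x < P (x0 - e1)) by (apply derivative_pos_increasing; lra). lra.
  - destruct (Rle_lt_dec (x0 + e1) x) as [Hle | Hlt]; [|lra].
    destruct Hle as [Hlt | <-]; [|lra].
    assert (P (x0 + e1) < P x) by (apply derivative_pos_increasing; lra). lra.
Qed.

Lemma increasing_inverse_lipschitz (x0 : R) : 0 < x0 -> continuous dP x0 ->
  exists C, 0 <= C /\ exists d, 0 < d /\ forall x y, 0 < x -> 0 < y ->
    Rabs (P x - P x0) < d -> Rabs (P y - P x0) < d ->
    Rabs (x - y) <= C * Rabs (P x - P y).
Proof.
  intros Hx0 Hc. assert (Hd0 := HdP x0 Hx0).
  assert (Hl : locally x0 (fun x => dP x0 / 2 < dP x)).
  { apply (Hc (fun r => dP x0 / 2 < r)), open_gt. lra. }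
  destruct Hl as [e He].
  destruct (increasing_inverse_continuous x0 e Hx0 (cond_pos e)) as [d [Hd Hinv]].
  exists (2 / dP x0). split; [apply Rlt_le, Rdiv_lt_0_compat; lra|].
  exists d. split; [exact Hd|]. intros x y Hx Hy Hxd Hyd.
  apply Hinv in Hxd; [|exact Hx]. apply Hinv in Hyd; [|exact Hy].
  apply Rabs_lt_between in Hxd. apply Rabs_lt_between in Hyd.
  assert (Hbet : forall z, Rmin y x <= z <= Rmax y x -> 0 < z /\ dP x0 / 2 < dP z).
  { intros z Hz.
    assert (H1 : 0 < z) by (revert Hz; unfold Rmin; destruct (Rle_dec y x); lra).
    split; [exact H1|]. apply He. change (Rabs (z - x0) < e).
    apply Rabs_lt_between. revert Hz. unfold Rmin, Rmax. destruct (Rle_dec y x); lra. }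
  destruct (MVT_gen P y x dP) as [c [Hc1 Hc2]].
  - intros z Hz. apply HP, Hbet. lra.
  - intros z Hz. apply derivable_continuous_pt. eexists. apply is_derive_Reals, HP, Hbet, Hz.
  - destruct (Hbet c Hc1) as [H1 H2].
    rewrite Hc2, Rabs_mult, (Rabs_pos_eq (dP c)) by lra.
    assert (HA := Rabs_pos (x - y)).
    apply Rmult_le_reg_l with (dP x0 / 2); [lra|].
    replace (dP x0 / 2 * (2 / dP x0 * (dP c * Rabs (x - y)))) with (dP c * Rabs (x - y))
      by (field; lra).
    apply Rmult_le_compat_r; lra.
Qed.

Lemma is_derive_increasing_inverse (x r : R -> R) (s l : R) :
  continuous dP (r s) ->
  locally s (fun s' => 0 < r s' /\ P (r s') = x s') ->
  is_derive x s l -> is_derive r s (l / dP (r s)).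
Proof.
  intros Hc Hr Hx.
  destruct (locally_singleton _ _ Hr) as [Hr0 HPr].
  assert (Hd0 := HdP _ Hr0).
  destruct (increasing_inverse_lipschitz (r s) Hr0 Hc) as [C [HC [d [Hd HLip]]]].
  assert (Hcx : forall e, 0 < e -> locally s (fun s' => Rabs (x s' - x s) < e)).
  { intros e He. apply (ex_derive_continuous x s (ex_intro _ _ Hx)
             (fun y => Rabs (y - x s) < e)). now exists (mkposreal e He). }
  assert (HlipR : locally s (fun s' => Rabs (r s' - r s) <= C * Rabs (x s' - x s))).
  { generalize (filter_and _ _ Hr (Hcx d Hd)). apply filter_imp.
    intros s' [[H1 H2] H3]. rewrite <- H2, <- HPr. apply HLip; try assumption.
    - rewrite H2, HPr. exact H3.
    - rewrite Rminus_diag, Rabs_R0. exact Hd. }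
  assert (Hcr : forall e, 0 < e -> locally s (fun s' => Rabs (r s' - r s) < e)).
  { intros e He.
    assert (He' : 0 < e / (C + 1)) by (apply Rdiv_lt_0_compat; lra).
    generalize (filter_and _ _ HlipR (Hcx _ He')). apply filter_imp. intros s' [H1 H2].
    assert (E : e = (C + 1) * (e / (C + 1))) by (field; lra).
    assert (Rabs (x s' - x s) >= 0) by (apply Rle_ge, Rabs_pos). nra. }
  apply is_derive_eps. intros e He.
  set (q := e * dP (r s) / (1 + C * (Rabs l + 1))).
  assert (Pl := Rabs_pos l).
  assert (Hden : 0 < 1 + C * (Rabs l + 1)) by nra.
  assert (Hq : 0 < q) by (unfold q; apply Rdiv_lt_0_compat; [nra | exact Hden]).
  assert (Eq : e * dP (r s) = q * (1 + C * (Rabs l + 1))) by (unfold q; field; lra).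
  assert (HdPs : locally s (fun s' =>
     Rabs (P (r s') - P (r s) - dP (r s) * (r s' - r s)) <= q * Rabs (r s' - r s))).
  { destruct (proj1 (is_derive_eps _ _ _) (HP _ Hr0) q Hq) as [d' Hd'].
    generalize (Hcr d' (cond_pos d')). apply filter_imp. intros s' Hs'. now apply Hd'. }
  generalize (filter_and _ _ (filter_and _ _ Hr HdPs) (filter_and _ _ HlipR
    (filter_and _ _ (proj1 (is_derive_eps _ _ _) Hx 1 Rlt_0_1)
                    (proj1 (is_derive_eps _ _ _) Hx q Hq)))).
  apply filter_imp. intros s' [[[H1 H2] H3] [H4 [H5 H6]]].
  rewrite H2, HPr in H3.
  set (D0 := Rabs (s' - s)) in *. assert (HD0 : 0 <= D0) by apply Rabs_pos.
  assert (BX : Rabs (x s' - x s) <= (Rabs l + 1) * D0).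
  { replace (x s' - x s) with ((x s' - x s - l * (s' - s)) + l * (s' - s)) by ring.
    eapply Rle_trans; [apply Rabs_triang|]. rewrite Rabs_mult. fold D0. lra. }
  apply Rmult_le_reg_l with (dP (r s)); [exact Hd0|].
  replace (dP (r s) * Rabs (r s' - r s - l / dP (r s) * (s' - s)))
    with (Rabs ((x s' - x s - l * (s' - s)) - (x s' - x s - dP (r s) * (r s' - r s)))).
  2:{ rewrite <- (Rabs_pos_eq (dP (r s))) at 2 by lra. rewrite <- Rabs_mult.
      f_equal. field. lra. }
  eapply Rle_trans; [apply Rabs_triang|]. rewrite Rabs_Ropp.
  assert (K1 : Rabs (r s' - r s) <= C * ((Rabs l + 1) * D0))
    by (eapply Rle_trans; [exact H4 | apply Rmult_le_compat_l; assumption]).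
  assert (K2 : q * Rabs (r s' - r s) <= q * (C * ((Rabs l + 1) * D0)))
    by (apply Rmult_le_compat_l; lra).
  replace (dP (r s) * (e * D0)) with (e * dP (r s) * D0) by ring. rewrite Eq. lra.
Qed.

Lemma lip_increasing_inverse {I : Type} {F : (I -> Prop) -> Prop} {FF : Filter F}
    (m : I -> R) (x r : bool -> I -> R) (r0 : R) :
  0 < r0 -> continuous dP r0 ->
  (forall k, F (fun z => 0 < r k z /\ P (r k z) = x k z)) ->
  lip F m x (P r0) -> lip F m r r0.
Proof.
  intros Hr0 Hc Hr [Hx [C [HC Hb]]].
  destruct (increasing_inverse_lipschitz r0 Hr0 Hc) as [L [HL [d [Hd HLip]]]].
  assert (Lx := fun k => proj1 (filterlim_locally_eps F _ _) (Hx k)).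
  split.
  - intros k. apply filterlim_locally_eps; [assumption|]. intros e He.
    destruct (increasing_inverse_continuous r0 e Hr0 He) as [d' [Hd' Hinv]].
    generalize (filter_and _ _ (Hr k) (Lx k d' Hd')). apply filter_imp.
    intros z [[H1 H2] H3]. apply Hinv; [exact H1|]. now rewrite H2.
  - exists (L * C). split; [nra|].
    generalize (filter_and _ _ (filter_and _ _ Hb (filter_and _ _ (Hr true) (Hr false)))
       (filter_and _ _ (Lx true d Hd) (Lx false d Hd))).
    apply filter_imp. intros z [[B1 [[K1 K2] [K3 K4]]] [B2 B3]].
    rewrite <- K2, <- K4 in B1. rewrite <- K2 in B2. rewrite <- K4 in B3.
    eapply Rle_trans; [now apply HLip|]. rewrite Rmult_assoc. now apply Rmult_le_compat_l.
Qed.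
End Inverse.

Section EquationOfState.
Context (S : setting) (HS : admissible S).

(** [Phi(rho)], the thermodynamic part of the Riemann invariants. *)
Definition Phi (rho : R) : R := RInt (fun s => eta S s / s) (rref S) rho.

(** First and second derivative of the pressure. *)
Definition dpr (rho : R) : R := Derive (pr S) rho.
Definition ddpr (rho : R) : R := Derive_n (pr S) 2 rho.

Lemma is_derive_pr (rho : R) : 0 < rho -> is_derive (pr S) rho (dpr rho).
Proof.
  intros Hr. apply Derive_correct. exact (adm_p_smooth S HS 1 rho Hr).
Qed.

Lemma is_derive_dpr (rho : R) : 0 < rho -> is_derive dpr rho (ddpr rho).
Proof.
  intros Hr. apply (Derive_correct dpr). exact (adm_p_smooth S HS 2 rho Hr).
Qed.

Lemma is_derive_ddpr (rho : R) :
  0 < rho -> is_derive ddpr rho (Derive_n (pr S) 3 rho).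
Proof.
  intros Hr. apply (Derive_correct ddpr). exact (adm_p_smooth S HS 3 rho Hr).
Qed.

Lemma eta_pos (rho : R) : 0 < rho -> 0 < eta S rho.
Proof. intros Hr. apply sqrt_lt_R0, adm_p_incr; assumption. Qed.

Lemma eta_sqr (rho : R) : 0 < rho -> eta S rho ^ 2 = dpr rho.
Proof. intros Hr. apply pow2_sqrt, Rlt_le, adm_p_incr; assumption. Qed.

Lemma is_derive_eta (rho : R) :
  0 < rho -> is_derive (eta S) rho (ddpr rho / (2 * eta S rho)).
Proof.
  intros Hr. assert (He := eta_pos rho Hr).
  assert (HH : is_derive (fun x => sqrt (dpr x)) rho (/ (2 * sqrt (dpr rho)) * ddpr rho)).
  { apply (is_derive_Reals (fun x => sqrt (dpr x))).
    apply (derivable_pt_lim_comp dpr sqrt).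
    - apply is_derive_Reals, is_derive_dpr, Hr.
    - apply derivable_pt_lim_sqrt, (adm_p_incr S HS rho Hr). }
  unfold eta at 1. fold dpr in He |- *.
  replace (ddpr rho / (2 * eta S rho)) with (/ (2 * sqrt (dpr rho)) * ddpr rho).
  - exact HH.
  - unfold eta, dpr. field. unfold eta in He. lra.
Qed.

Lemma continuous_eta_ratio (rho : R) : 0 < rho -> continuous (fun s => eta S s / s) rho.
Proof.
  intros Hr. apply (ex_derive_continuous (V := R_NormedModule)).
  eexists. apply is_derive_div; [apply is_derive_eta, Hr | apply is_derive_id | lra].
Qed.

Lemma locally_pos (x : R) : 0 < x -> locally x (fun y => 0 < y).
Proof. intros Hx. apply (open_gt 0 x Hx). Qed.

Lemma is_derive_Phi (rho : R) : 0 < rho -> is_derive Phi rho (eta S rho / rho).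
Proof.
  intros Hr. apply (is_derive_RInt (fun s => eta S s / s) Phi (rref S)).
  - generalize (locally_pos rho Hr). apply filter_imp. intros y Hy.
    apply (RInt_correct (V := R_CompleteNormedModule)), (ex_RInt_continuous (V := R_CompleteNormedModule)).
    intros z Hz. apply continuous_eta_ratio.
    assert (Hrr := adm_rref S HS).
    revert Hz. unfold Rmin. destruct (Rle_dec (rref S) y); lra.
  - now apply continuous_eta_ratio.
Qed.

Lemma dPhi_pos (rho : R) : 0 < rho -> 0 < eta S rho / rho.
Proof. intros Hr. apply Rdiv_lt_0_compat; [now apply eta_pos | exact Hr]. Qed.

Lemma Phi_inj (x y : R) : 0 < x -> 0 < y -> Phi x = Phi y -> x = y.
Proof.
  intros Hx Hy He.
  destruct (Rtotal_order x y) as [Hlt | [Heq | Hlt]]; [|exact Heq|].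
  - assert (Phi x < Phi y) by exact (derivative_pos_increasing Phi _ is_derive_Phi dPhi_pos x y Hx Hlt). lra.
  - assert (Phi y < Phi x) by exact (derivative_pos_increasing Phi _ is_derive_Phi dPhi_pos y x Hy Hlt). lra.
Qed.

Lemma state_of_image (al be : R) : RI_image S al be ->
  0 < rho_of S al be /\ Phi (rho_of S al be) = (al + be) / 2 /\
  w_of S al be = (al - be) / 2.
Proof.
  intros Him.
  assert (HH : has_invariants S al be (state_of S al be)) by exact (epsilon_spec _ _ Him).
  destruct HH as [H1 [H2 H3]].
  unfold alphaRI in H2. unfold betaRI in H3.
  fold (Phi (fst (state_of S al be))) in H2, H3.
  unfold rho_of, w_of. repeat split; [exact H1 | lra | lra].
Qed.

Lemma state_of_invariants (rho w : R) : 0 < rho ->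
  rho_of S (alphaRI S rho w) (betaRI S rho w) = rho /\
  w_of S (alphaRI S rho w) (betaRI S rho w) = w.
Proof.
  intros Hr.
  destruct (state_of_image (alphaRI S rho w) (betaRI S rho w)) as [H1 [H2 H3]].
  { exists (rho, w). now repeat split. }
  split.
  - apply Phi_inj; [assumption | assumption|]. rewrite H2.
    unfold alphaRI, betaRI. fold (Phi rho). field.
  - rewrite H3. unfold alphaRI, betaRI. field.
Qed.

Lemma is_derive_rho_of (al be : R -> R) (s la lb : R) :
  locally s (fun s' => RI_image S (al s') (be s')) ->
  is_derive al s la -> is_derive be s lb ->
  is_derive (fun s' => rho_of S (al s') (be s')) s
    (rho_of S (al s) (be s) / eta S (rho_of S (al s) (be s)) * ((la + lb) / 2)).
Proof.
  intros Him Ha Hb.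
  assert (Hpos := proj1 (state_of_image _ _ (locally_singleton _ _ Him))).
  assert (He := eta_pos _ Hpos).
  replace (rho_of S (al s) (be s) / eta S (rho_of S (al s) (be s)) * ((la + lb) / 2))
    with ((la + lb) / 2 / (eta S (rho_of S (al s) (be s)) / rho_of S (al s) (be s)))
    by (field; lra).
  apply (is_derive_increasing_inverse Phi (fun x => eta S x / x) is_derive_Phi dPhi_pos
    (fun s' => (al s' + be s') / 2) (fun s' => rho_of S (al s') (be s'))).
  - now apply continuous_eta_ratio.
  - revert Him. apply filter_imp. intros s' Hs'.
    destruct (state_of_image _ _ Hs') as [H1 [H2 _]]. now split.
  - apply is_derive_ext with (f := fun s' => (/ 2) * (al s' + be s')).
    { intros t. apply Rmult_comm. }
    replace ((la + lb) / 2) with (/ 2 * (la + lb)) by apply Rmult_comm.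
    apply (is_derive_scal (fun s' => al s' + be s')).
    apply (is_derive_plus (V := R_NormedModule)); assumption.
Qed.

Lemma lip_rho_of {I : Type} {F : (I -> Prop) -> Prop} {FF : Filter F} (m : I -> R)
    (al be : bool -> I -> R) (al0 be0 : R) :
  (forall k, F (fun z => RI_image S (al k z) (be k z))) -> RI_image S al0 be0 ->
  lip F m al al0 -> lip F m be be0 ->
  lip F m (fun k z => rho_of S (al k z) (be k z)) (rho_of S al0 be0).
Proof.
  intros Him Him0 Ha Hb.
  destruct (state_of_image _ _ Him0) as [H1 [H2 _]].
  apply (lip_increasing_inverse Phi (fun x => eta S x / x) is_derive_Phi dPhi_pos m
    (fun k z => (al k z + be k z) / 2)).
  - exact H1.
  - now apply continuous_eta_ratio.
  - intros k. generalize (Him k). apply filter_imp. intros z Hz.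
    destruct (state_of_image _ _ Hz) as [K1 [K2 _]]. now split.
  - rewrite H2. apply lip_mult; [now apply lip_plus | apply lip_const].
Qed.

Lemma locally_lipschitz_derivable2 (f df ddf : R -> R) (x0 : R) : 0 < x0 ->
  (forall x, 0 < x -> is_derive f x (df x)) -> (forall x, 0 < x -> is_derive df x (ddf x)) ->
  locally_lipschitz f x0.
Proof.
  intros Hx0 H1 H2. apply locally_lipschitz_C1 with df.
  - generalize (locally_pos x0 Hx0). apply filter_imp. exact H1.
  - apply (ex_derive_continuous (V := R_NormedModule)). eexists. now apply H2.
Qed.

Lemma locally_lipschitz_pr (x0 : R) : 0 < x0 -> locally_lipschitz (pr S) x0.
Proof.
  intros H0. exact (locally_lipschitz_derivable2 _ _ _ x0 H0 is_derive_pr is_derive_dpr).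
Qed.

Lemma locally_lipschitz_dpr (x0 : R) : 0 < x0 -> locally_lipschitz dpr x0.
Proof.
  intros H0. exact (locally_lipschitz_derivable2 _ _ _ x0 H0 is_derive_dpr is_derive_ddpr).
Qed.

Lemma locally_lipschitz_ddpr (x0 : R) : 0 < x0 -> locally_lipschitz ddpr x0.
Proof.
  intros H0. apply (locally_lipschitz_derivable2 _ _ (Derive_n (pr S) 4) x0 H0 is_derive_ddpr).
  intros x Hx. apply (Derive_correct (Derive_n (pr S) 3)). exact (adm_p_smooth S HS 4 x Hx).
Qed.

Lemma locally_lipschitz_eta (x0 : R) : 0 < x0 -> locally_lipschitz (eta S) x0.
Proof.
  intros H0. apply locally_lipschitz_C1 with (fun x => ddpr x / (2 * eta S x)).
  - generalize (locally_pos x0 H0). apply filter_imp. exact is_derive_eta.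
  - apply (ex_derive_continuous (V := R_NormedModule)). eexists.
    assert (He := eta_pos x0 H0).
    apply is_derive_div; [apply is_derive_ddpr, H0 | |lra].
    apply (is_derive_scal (eta S)), is_derive_eta, H0.
Qed.
End EquationOfState.

(** * The domain of the state ahead *)

Lemma Ck_pd (k : nat) (D : R * R -> Prop) (f : R -> R -> R) : Ck (S k) D f ->
  continuous_on D (uncurry2 f) /\ is_pd1 D f (pd1 D f) /\ is_pd2 D f (pd2 D f) /\
  Ck k D (pd1 D f) /\ Ck k D (pd2 D f).
Proof.
  intros [H1 [H2 [H3 [H4 H5]]]].
  split; [exact H1|].
  split; [exact (epsilon_spec _ _ H2)|].
  split; [exact (epsilon_spec _ _ H3)|].
  now split.
Qed.

Lemma Ck_continuous_on (k : nat) (D : R * R -> Prop) (f : R -> R -> R) :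
  Ck k D f -> continuous_on D (uncurry2 f).
Proof. destruct k; intros [HH _]; exact HH. Qed.

Lemma is_derive_on_eps (lo hi : R) (f : R -> R) (x l : R) :
  is_derive_on lo hi f x l -> lo <= x <= hi ->
  forall e, 0 < e -> exists d, 0 < d /\ forall y, lo <= y <= hi -> Rabs (y - x) < d ->
    Rabs (f y - f x - l * (y - x)) <= e * Rabs (y - x).
Proof.
  intros [_ Hf] Hx e He.
  destruct (Hf x) with (eps := mkposreal e He) as [d Hd].
  { intros P [d Hd]. exists d. intros y Hy _. now apply Hd. }
  exists d. split; [apply cond_pos|]. intros y Hy Hyd.
  specialize (Hd y Hyd Hy).
  assert (E : minus (minus (f y) (f x)) (scal (minus y x) l) = f y - f x - l * (y - x)).
  { unfold minus, plus, opp, scal; simpl. unfold mult; simpl. ring. }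
  rewrite <- E. exact Hd.
Qed.

Lemma is_derive_on_interior (lo hi : R) (f : R -> R) (x l : R) :
  is_derive_on lo hi f x l -> lo < x < hi -> is_derive f x l.
Proof.
  intros Hf Hx. apply is_derive_eps. intros e He.
  destruct (is_derive_on_eps lo hi f x l Hf ltac:(lra) e He) as [d [Hd HH]].
  assert (L1 : locally x (fun y => Rabs (y - x) < d)) by now exists (mkposreal d Hd).
  generalize (filter_and _ _ L1 (filter_and _ _ (open_gt lo x (proj1 Hx)) (open_lt hi x (proj2 Hx)))).
  apply filter_imp. intros y [H1 [H2 H3]]. apply HH; [lra | exact H1].
Qed.

Lemma is_derive_on_continuous (lo hi : R) (f : R -> R) (x l : R) :
  is_derive_on lo hi f x l -> lo <= x <= hi ->
  forall e, 0 < e -> exists d, 0 < d /\ forall y, lo <= y <= hi -> Rabs (y - x) < d ->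
    Rabs (f y - f x) < e.
Proof.
  intros Hf Hx e He.
  destruct (is_derive_on_eps lo hi f x l Hf Hx 1 Rlt_0_1) as [d [Hd HH]].
  assert (Pl := Rabs_pos l).
  assert (He' : 0 < e / (Rabs l + 2)) by (apply Rdiv_lt_0_compat; lra).
  exists (Rmin d (e / (Rabs l + 2))). split; [now apply Rmin_glb_lt|].
  intros y Hy Hyd.
  assert (M1 := Rmin_l d (e / (Rabs l + 2))). assert (M2 := Rmin_r d (e / (Rabs l + 2))).
  specialize (HH y Hy ltac:(lra)).
  replace (f y - f x) with ((f y - f x - l * (y - x)) + l * (y - x)) by ring.
  eapply Rle_lt_trans; [apply Rabs_triang|]. rewrite Rabs_mult.
  assert (Ee : e = (Rabs l + 2) * (e / (Rabs l + 2))) by (field; lra).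
  assert (PY := Rabs_pos (y - x)). nra.
Qed.

Section AheadDomain.
Context (S : setting) (HS : admissible S) (i : side).

Lemma boundary_in_Dom (t : R) : 0 <= t <= Tmax S i -> Dom S i (t, bdry S i t).
Proof.
  intros Ht. split; [exact Ht|]. destruct i; simpl; [|lra].
  split; [now apply (adm_bdry_pos S HS) | lra].
Qed.

Lemma corner_in_Dom : Dom S i (0, r0 S).
Proof.
  rewrite <- (adm_bdry_0 S HS i). apply boundary_in_Dom.
  assert (H := adm_Tmax S HS i). lra.
Qed.

Lemma rho_m0_pos : 0 < rho_m0 S i.
Proof. apply (adm_rhos_pos S HS i 0 (r0 S)), corner_in_Dom. Qed.

(** The boundary characteristic has a speed that is bounded near [t = 0], by the continuity
    of the state ahead at the corner of its domain. *)
Lemma bdry_lipschitz : exists tau L, 0 < tau <= Tmax S i /\ 0 <= L /\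
  forall t t', 0 <= t < tau -> 0 <= t' < tau ->
    Rabs (bdry S i t' - bdry S i t) <= L * Rabs (t' - t).
Proof.
  set (b := bdry S i). set (T := Tmax S i).
  set (c := fun t => char_speed S i (rhos S i t (b t)) (ws S i t (b t))).
  assert (HT : 0 < T) by apply (adm_Tmax S HS).
  assert (Hb : forall t, 0 <= t <= T -> is_derive_on 0 T b t (c t))
    by apply (adm_bdry_char S HS i).
  assert (Hb0 : b 0 = r0 S) by apply (adm_bdry_0 S HS).
  assert (Hrm := rho_m0_pos).
  assert (Hceta : continuous (eta S) (rho_m0 S i)).
  { apply (ex_derive_continuous (V := R_NormedModule)). eexists.
    now apply is_derive_eta. }
  destruct (Hceta (fun y => Rabs (y - eta S (rho_m0 S i)) < 1)) as [de Hde].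
  { now exists (mkposreal 1 Rlt_0_1). }
  destruct (continuous_on_eps _ _ 0 (r0 S) de
    (Ck_continuous_on 0%nat _ _ (adm_rhos_smooth S HS i 0%nat)) corner_in_Dom (cond_pos de))
    as [d1 [Hd1 HC1]].
  destruct (continuous_on_eps _ _ 0 (r0 S) 1
    (Ck_continuous_on 0%nat _ _ (adm_ws_smooth S HS i 0%nat)) corner_in_Dom Rlt_0_1)
    as [d2 [Hd2 HC2]].
  assert (Hd12 : 0 < Rmin d1 d2) by now apply Rmin_glb_lt.
  destruct (is_derive_on_continuous 0 T b 0 (c 0) (Hb 0 ltac:(lra)) ltac:(lra) _ Hd12)
    as [d3 [Hd3 HC3]].
  assert (M1 := Rmin_l d1 d2). assert (M2 := Rmin_r d1 d2).
  set (tau := Rmin (Rmin d1 d2) (Rmin d3 T)).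
  assert (Htau : 0 < tau) by (unfold tau; repeat apply Rmin_glb_lt; assumption).
  assert (Ht1 : tau <= Rmin d1 d2) by apply Rmin_l.
  assert (Ht2 : tau <= d3) by (unfold tau; eapply Rle_trans; [apply Rmin_r | apply Rmin_l]).
  assert (Ht3 : tau <= T) by (unfold tau; eapply Rle_trans; [apply Rmin_r | apply Rmin_r]).
  set (L := Rabs (w_m0 S i) + Rabs (eta S (rho_m0 S i)) + 2).
  assert (HL : 0 <= L) by (unfold L; generalize (Rabs_pos (w_m0 S i)) (Rabs_pos (eta S (rho_m0 S i))); lra).
  assert (Hcb : forall t, 0 <= t < tau -> Rabs (c t) <= L).
  { intros t Ht.
    assert (HD : Dom S i (t, b t)) by (apply boundary_in_Dom; fold T; lra).
    assert (K0 : Rabs (t - 0) < tau) by (apply Rabs_lt_between; lra).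
    assert (K3 := HC3 t ltac:(lra) ltac:(lra)). rewrite Hb0 in K3.
    assert (K1 := HC1 t (b t) HD ltac:(lra) ltac:(lra)).
    assert (K2 := HC2 t (b t) HD ltac:(lra) ltac:(lra)).
    assert (K4 := Hde (rhos S i t (b t)) K1). cbv beta in K4.
    apply Rabs_lt_between in K2. apply Rabs_lt_between in K4.
    unfold w_m0, rho_m0 in *.
    assert (A3 := Rle_abs (ws S i 0 (r0 S))). assert (A4 := Rle_abs (eta S (rhos S i 0 (r0 S)))).
    assert (A5 := Rle_abs (- ws S i 0 (r0 S))). assert (A6 := Rle_abs (- eta S (rhos S i 0 (r0 S)))).
    rewrite Rabs_Ropp in A5, A6.
    unfold c, char_speed, L. apply Rabs_le_between. clear - K2 K4 A3 A4 A5 A6. destruct i; lra. }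
  assert (Hpos : forall t t', 0 < t < tau -> 0 < t' < tau -> Rabs (b t' - b t) <= L * Rabs (t' - t)).
  { intros t t' Ht Ht'.
    assert (Hbt : forall x, Rmin t t' <= x <= Rmax t t' -> 0 < x < tau).
    { intros x. unfold Rmin, Rmax. destruct (Rle_dec t t'); lra. }
    apply mean_value_bound with c.
    - intros x Hx. apply (is_derive_on_interior 0 T).
      + apply Hb. specialize (Hbt x). lra.
      + specialize (Hbt x). lra.
    - intros x Hx. apply derivable_continuous_pt. exists (c x). apply is_derive_Reals.
      apply (is_derive_on_interior 0 T); [apply Hb|]; specialize (Hbt x Hx); lra.
    - intros x Hx. apply Hcb. specialize (Hbt x Hx). lra. }
  assert (H0 : forall t, 0 <= t < tau -> Rabs (b t - b 0) <= L * t).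
  { intros t Ht. destruct (Req_dec t 0) as [-> | Hne].
    { rewrite Rminus_diag, Rabs_R0. lra. }
    apply Rle_plus_epsilon. intros e He.
    destruct (is_derive_on_continuous 0 T b 0 (c 0) (Hb 0 ltac:(lra)) ltac:(lra) e He)
      as [d4 [Hd4 HC4]].
    set (s := Rmin (t / 2) (d4 / 2)).
    assert (Hs : 0 < s) by (apply Rmin_glb_lt; lra).
    assert (Hs1 : s <= t / 2) by apply Rmin_l. assert (Hs2 : s <= d4 / 2) by apply Rmin_r.
    assert (B1 := HC4 s ltac:(lra) ltac:(apply Rabs_lt_between; lra)).
    assert (B2 := Hpos s t ltac:(lra) ltac:(lra)).
    rewrite (Rabs_pos_eq (t - s)) in B2 by lra.
    replace (b t - b 0) with ((b t - b s) + (b s - b 0)) by ring.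
    eapply Rle_trans; [apply Rabs_triang|]. nra. }
  exists tau, L. split; [lra|]. split; [exact HL|].
  intros t t' Ht Ht'.
  destruct (Req_dec t 0) as [-> | Hne].
  { rewrite Rminus_0_r, (Rabs_pos_eq t') by lra. now apply H0. }
  destruct (Req_dec t' 0) as [-> | Hne'].
  { rewrite (Rabs_minus_sym (b 0)), Rminus_0_l, Rabs_Ropp, (Rabs_pos_eq t) by lra. now apply H0. }
  apply Hpos; lra.
Qed.

(** At [t = 0] and on the boundary characteristic the gradient is the continuous
    extension of that in the interior. *)
Lemma Dom_strict_diff : exists tau, 0 < tau /\ forall f, Ck 1 (Dom S i) f ->
  forall t r, Dom S i (t, r) -> t < tau -> 0 < r ->
    strict_diff_on (Dom S i) f t r (pd1 (Dom S i) f t r) (pd2 (Dom S i) f t r).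
Proof.
  destruct bdry_lipschitz as [tau [L [Htau [HL HLip]]]].
  exists tau. split; [lra|]. intros f Hf t r HD Ht Hr.
  destruct (Ck_pd 0%nat _ _ Hf) as [Hc [Hp1 [Hp2 _]]].
  set (sg := match i with Lft => -1 | Rgt => 1 end).
  apply graph_region_strict_diff with (sg := sg) (tau := tau) (L := L) (b := bdry S i);
    try assumption.
  - unfold sg. destruct i; [now right | now left].
  - intros t' r' [H1 H2]. simpl in H1, H2. unfold sg. destruct i; lra.
  - intros t' r' Ht' Hb Hr'.
    assert (Hcb : continuous (bdry S i) t').
    { apply (ex_derive_continuous (V := R_NormedModule)). eexists.
      apply (is_derive_on_interior 0 (Tmax S i)); [|lra].
      apply (adm_bdry_char S HS i). lra. }
    assert (C1 : continuous (fun z : R * R => fst z) (t', r')) by apply continuous_fst.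
    assert (C2 : continuous (fun z : R * R => snd z) (t', r')) by apply continuous_snd.
    assert (C3 : continuous (fun z : R * R => bdry S i (fst z)) (t', r')).
    { apply (continuous_comp (fun z : R * R => fst z) (bdry S i)); [exact C1 | exact Hcb]. }
    assert (C4 : continuous (fun z : R * R => sg * (snd z - bdry S i (fst z))) (t', r')).
    { apply (continuous_scal_r (K := R_AbsRing) (V := R_NormedModule) sg).
      apply (continuous_minus (V := R_NormedModule)); assumption. }
    generalize (filter_and _ _
      (filter_and _ _ (locally_lt (fun _ => 0) _ _ (continuous_const 0 _) C1 (proj1 Ht'))
                      (locally_lt _ (fun _ => tau) _ C1 (continuous_const tau _) (proj2 Ht')))
      (filter_and _ _ (locally_lt (fun _ => 0) _ _ (continuous_const 0 _) C4 Hb)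
                      (locally_lt (fun _ => 0) _ _ (continuous_const 0 _) C2 Hr'))).
    apply filter_imp. intros [t1 r1] [[K1 K2] [K3 K4]]. simpl in *.
    split; simpl; [lra|]. unfold sg in K3. destruct i; lra.
  - intros t' r' Ht' Hb Hr'. split; simpl; [lra|]. unfold sg in Hb. destruct i; lra.
Qed.
End AheadDomain.

(** * Mixed derivatives, and the coefficients of the characteristic system *)

Lemma Ck_pred (k : nat) (D : R * R -> Prop) (f : R -> R -> R) : Ck (S k) D f -> Ck k D f.
Proof.
  revert f. induction k as [|k IH]; intros f [H1 [H2 [H3 [H4 H5]]]].
  - now split.
  - split; [exact H1|]. split; [exact H2|]. split; [exact H3|].
    split; now apply IH.
Qed.

(** Symmetry of the mixed second derivatives, in the interior. *)
Lemma pd_commute (D : R * R -> Prop) (f : R -> R -> R) (x y : R) :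
  Ck 2 D f -> locally (x, y) D -> pd1 D (pd2 D f) x y = pd2 D (pd1 D f) x y.
Proof.
  intros Hf HD.
  destruct (Ck_pd _ _ _ Hf) as [_ [P1 [P2 [C1 C2]]]].
  destruct (Ck_pd _ _ _ C1) as [_ [_ [P12 [_ C12]]]].
  destruct (Ck_pd _ _ _ C2) as [_ [P21 [_ [C21 _]]]].
  assert (Hfix1 : forall u v, locally (u, v) D ->
            locally u (fun s => locally (s, v) D)).
  { intros u v Huv. apply locally_locally in Huv. destruct Huv as [d Hd].
    exists d. intros s Hs. apply Hd. split; [exact Hs | apply ball_center]. }
  assert (Hfix2 : forall u v, locally (u, v) D ->
            locally v (fun s => locally (u, s) D)).
  { intros u v Huv. apply locally_locally in Huv. destruct Huv as [d Hd].
    exists d. intros s Hs. apply Hd. split; [apply ball_center | exact Hs]. }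
  assert (E12 : forall u v, locally (u, v) D ->
     is_derive (fun z : R => Derive (fun t : R => f t z) u) v (pd2 D (pd1 D f) u v)).
  { intros u v Huv. apply is_derive_ext_loc with (f := fun z => pd1 D f u z).
    - generalize (Hfix2 u v Huv). apply filter_imp. intros z Hz.
      symmetry. apply is_derive_unique, P1, Hz.
    - now apply P12. }
  assert (E21 : forall u v, locally (u, v) D ->
     is_derive (fun z : R => Derive (fun t : R => f z t) v) u (pd1 D (pd2 D f) u v)).
  { intros u v Huv. apply is_derive_ext_loc with (f := fun z => pd2 D f z v).
    - generalize (Hfix1 u v Huv). apply filter_imp. intros z Hz.
      symmetry. apply is_derive_unique, P2, Hz.
    - now apply P21. }
  rewrite <- (is_derive_unique _ _ _ (E12 x y HD)), <- (is_derive_unique _ _ _ (E21 x y HD)).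
  assert (HD' := locally_locally _ _ HD).
  apply Schwarz.
  - apply locally_2d_locally. revert HD'. apply filter_imp. intros [u v] Huv. simpl.
    split; [|split; [|split]].
    + eexists. apply P1, Huv.
    + eexists. apply P2, Huv.
    + eexists. apply E21, Huv.
    + eexists. apply E12, Huv.
  - apply continuity_2d_pt_filterlim. cbv beta.
    rewrite (is_derive_unique _ _ _ (E21 x y HD)).
    apply filterlim_ext_loc with (f := fun z : R * R => pd1 D (pd2 D f) (fst z) (snd z)).
    + revert HD'. apply filter_imp. intros [u v] Huv. symmetry.
      apply is_derive_unique, E21, Huv.
    + apply (locally_continuous D (pd1 D (pd2 D f)) x y).
      * exact (Ck_continuous_on 0%nat _ _ C21).
      * exact HD.
  - apply continuity_2d_pt_filterlim. cbv beta.
    rewrite (is_derive_unique _ _ _ (E12 x y HD)).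
    apply filterlim_ext_loc with (f := fun z : R * R => pd2 D (pd1 D f) (fst z) (snd z)).
    + revert HD'. apply filter_imp. intros [u v] Huv. symmetry.
      apply is_derive_unique, E12, Huv.
    + apply (locally_continuous D (pd2 D (pd1 D f)) x y).
      * exact (Ck_continuous_on 0%nat _ _ C12).
      * exact HD.
Qed.

Section Coefficients.
Context (S : setting) (HS : admissible S).

(** [d eta / d x] along [x = Phi(rho)]. *)
Definition eta_slope (rho : R) : R := ddpr S rho * rho / (2 * dpr S rho).

(** The characteristic speeds and [A] with [w = (alpha - beta) / 2] substituted, which
    agrees with the definition on the image of the Riemann invariants. *)
Definition cin_at (al be : R) : R := (al - be) / 2 - eta S (rho_of S al be).
Definition cout_at (al be : R) : R := (al - be) / 2 + eta S (rho_of S al be).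
Definition A_at (al be r : R) : R :=
  - (2 * eta S (rho_of S al be) * ((al - be) / 2) / r).

Lemma coefficients_at (al be r : R) : RI_image S al be ->
  c_in S al be = cin_at al be /\ c_out S al be = cout_at al be /\
  A_coef S al be r = A_at al be r.
Proof.
  intros Him. destruct (state_of_image S al be Him) as [_ [_ Hw]].
  unfold c_in, c_out, A_coef, cin_at, cout_at, A_at. now rewrite Hw.
Qed.

(** Derivatives of the coefficients along a curve, in terms of those of the Riemann
    invariants. *)
Definition cin_slope (al be la lb : R) : R :=
  (la - lb) / 2 - eta_slope (rho_of S al be) * ((la + lb) / 2).
Definition cout_slope (al be la lb : R) : R :=
  (la - lb) / 2 + eta_slope (rho_of S al be) * ((la + lb) / 2).
Definition A_slope (al be r la lb lr : R) : R :=
  - (2 * (eta_slope (rho_of S al be) * ((la + lb) / 2) * ((al - be) / 2)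
          + eta S (rho_of S al be) * ((la - lb) / 2)) / r)
  + 2 * eta S (rho_of S al be) * ((al - be) / 2) * lr / (r * r).

Lemma is_derive_eta_of (al be : R -> R) (s la lb : R) :
  locally s (fun s' => RI_image S (al s') (be s')) ->
  is_derive al s la -> is_derive be s lb ->
  is_derive (fun s' => eta S (rho_of S (al s') (be s'))) s
    (eta_slope (rho_of S (al s) (be s)) * ((la + lb) / 2)).
Proof.
  intros Him Ha Hb.
  assert (Hpos := proj1 (state_of_image S _ _ (locally_singleton _ _ Him))).
  assert (He := eta_pos S HS _ Hpos). assert (He2 := eta_sqr S HS _ Hpos).
  assert (HH := is_derive_comp (V := R_NormedModule) (eta S)
    (fun s' => rho_of S (al s') (be s')) s _ _
    (is_derive_eta S HS _ Hpos) (is_derive_rho_of S HS al be s la lb Him Ha Hb)).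
  unfold eta_slope. rewrite <- He2.
  set (rh := rho_of S (al s) (be s)) in *.
  replace (ddpr S rh * rh / (2 * eta S rh ^ 2) * ((la + lb) / 2))
    with (rh / eta S rh * ((la + lb) / 2) * (ddpr S rh / (2 * eta S rh))) by (field; lra).
  exact HH.
Qed.

Lemma is_derive_half_diff (al be : R -> R) (s la lb : R) :
  is_derive al s la -> is_derive be s lb ->
  is_derive (fun s' => (al s' - be s') / 2) s ((la - lb) / 2).
Proof.
  intros Ha Hb.
  apply is_derive_ext with (f := fun s' => / 2 * (al s' - be s')).
  { intros t. apply Rmult_comm. }
  replace ((la - lb) / 2) with (/ 2 * (la - lb)) by apply Rmult_comm.
  apply (is_derive_scal (fun s' => al s' - be s')).
  apply (is_derive_minus (V := R_NormedModule)); assumption.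
Qed.

Lemma is_derive_cin (al be : R -> R) (s la lb : R) :
  locally s (fun s' => RI_image S (al s') (be s')) ->
  is_derive al s la -> is_derive be s lb ->
  is_derive (fun s' => cin_at (al s') (be s')) s (cin_slope (al s) (be s) la lb).
Proof.
  intros Him Ha Hb. apply (is_derive_minus (V := R_NormedModule)).
  - now apply is_derive_half_diff.
  - now apply is_derive_eta_of.
Qed.

Lemma is_derive_cout (al be : R -> R) (s la lb : R) :
  locally s (fun s' => RI_image S (al s') (be s')) ->
  is_derive al s la -> is_derive be s lb ->
  is_derive (fun s' => cout_at (al s') (be s')) s (cout_slope (al s) (be s) la lb).
Proof.
  intros Him Ha Hb. apply (is_derive_plus (V := R_NormedModule)).
  - now apply is_derive_half_diff.
  - now apply is_derive_eta_of.
Qed.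

Lemma is_derive_mult_R (f g : R -> R) (s lf lg : R) :
  is_derive f s lf -> is_derive g s lg ->
  is_derive (fun s' => f s' * g s') s (lf * g s + f s * lg).
Proof. intros Hf Hg. apply (is_derive_mult f g); try assumption. intros; apply Rmult_comm. Qed.

Lemma is_derive_A (al be r : R -> R) (s la lb lr : R) :
  r s <> 0 ->
  locally s (fun s' => RI_image S (al s') (be s')) ->
  is_derive al s la -> is_derive be s lb -> is_derive r s lr ->
  is_derive (fun s' => A_at (al s') (be s') (r s')) s
    (A_slope (al s) (be s) (r s) la lb lr).
Proof.
  intros Hr Him Ha Hb HDr.
  assert (H1 := is_derive_eta_of al be s la lb Him Ha Hb).
  assert (H2 := is_derive_half_diff al be s la lb Ha Hb).
  assert (H3 := is_derive_mult_R _ _ _ _ _ H1 H2).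
  assert (H4 := is_derive_div _ _ _ _ _ H3 HDr Hr).
  assert (H5 := is_derive_scal _ _ (-2) _ H4).
  replace (A_slope (al s) (be s) (r s) la lb lr) with
    (-2 * (((eta_slope (rho_of S (al s) (be s)) * ((la + lb) / 2) * ((al s - be s) / 2)
       + eta S (rho_of S (al s) (be s)) * ((la - lb) / 2)) * r s
       - eta S (rho_of S (al s) (be s)) * ((al s - be s) / 2) * lr) / r s ^ 2)).
  2:{ unfold A_slope. field. exact Hr. }
  apply is_derive_ext with (2 := H5). intros t.
  match goal with |- ?x = ?y => change (@eq R x y) end. unfold A_at, Rdiv. ring.
Qed.
End Coefficients.

(** * The interaction point, and the wave equations of a solution *)

Section InteractionPoint.
Context (S : setting) (HS : admissible S).

Lemma eta0_pos : 0 < eta0 S.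
Proof. apply eta_pos; [exact HS | apply (adm_rho0 S HS)]. Qed.

Lemma shock_speeds_bounds :
  - eta0 S < V0 S Lft < 0 /\ 0 < V0 S Rgt < eta0 S.
Proof.
  assert (H1 := adm_determinism_l S HS). assert (H2 := adm_determinism_r S HS). lra.
Qed.

Lemma ratio_lt_1 (x y : R) : 0 < x < y -> 0 < x / y < 1.
Proof.
  intros Hxy. split; [apply Rdiv_lt_0_compat; lra|].
  apply Rmult_lt_reg_r with y; [lra|]. unfold Rdiv. rewrite Rmult_assoc, Rinv_l by lra. lra.
Qed.

Lemma acst_bounds : 0 < acst S < 1.
Proof.
  assert (H0 := eta0_pos). assert (H1 := shock_speeds_bounds).
  assert (R1 := ratio_lt_1 (eta0 S + V0 S Lft) (eta0 S - V0 S Lft) ltac:(lra)).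
  assert (R2 := ratio_lt_1 (eta0 S - V0 S Rgt) (eta0 S + V0 S Rgt) ltac:(lra)).
  unfold acst. nra.
Qed.

Lemma invariants_at_rest : alphaRI S (rho0 S) 0 = beta0 S /\ betaRI S (rho0 S) 0 = beta0 S.
Proof. unfold beta0, alphaRI, betaRI. split; [ring | reflexivity]. Qed.

Lemma image_at_rest : RI_image S (beta0 S) (beta0 S).
Proof.
  exists (rho0 S, 0). destruct invariants_at_rest as [H1 H2].
  split; [apply (adm_rho0 S HS) | now split].
Qed.

Lemma rho_of_at_rest : rho_of S (beta0 S) (beta0 S) = rho0 S.
Proof.
  destruct invariants_at_rest as [H1 H2].
  rewrite <- H1 at 1. rewrite <- H2 at 1. apply (state_of_invariants S HS), (adm_rho0 S HS).
Qed.

(** The density jumps at the interaction point, for otherwise the states on the two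
    sides would coincide, against determinism. *)
Lemma density_jump_neq (i : side) : rho0 S - rho_m0 S i <> 0.
Proof.
  intros He. destruct (adm_jump S HS i) as [J1 _].
  assert (Hr := rho_m0_pos S HS i).
  assert (Hw : w_m0 S i = 0).
  { rewrite He in J1. apply Rmult_eq_reg_l with (rho_m0 S i); lra. }
  assert (Er : rho_m0 S i = rho0 S) by lra.
  assert (H1 := adm_determinism_l S HS). assert (H2 := adm_determinism_r S HS).
  unfold eta0 in *. destruct i; rewrite Hw, Er in *; lra.
Qed.
End InteractionPoint.

(** The edges [u = v] and [u = a v] of the sector, both parametrized by [v]. *)
Definition edge_slope (S : setting) (i : side) : R :=
  match i with Lft => 1 | Rgt => acst S end.

Section PointwiseCoefficients.
Context (S : setting).

(** [d^2 t / du dv], [d^2 alpha / du dv] and [d^2 beta / du dv] as functions of the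
    unknowns and of [dt/du], [dt/dv], [d alpha/du], [d beta/dv]. *)
Definition t_uv (al be r tu tv alu bev : R) : R :=
  (cin_slope S al be (A_at S al be r * tv) bev * tu
   - cout_slope S al be alu (A_at S al be r * tu) * tv) / (2 * eta S (rho_of S al be)).
Definition al_uv (al be r tu tv alu bev : R) : R :=
  A_slope S al be r alu (A_at S al be r * tu) (cin_at S al be * tu) * tv
  + A_at S al be r * t_uv al be r tu tv alu bev.
Definition be_uv (al be r tu tv alu bev : R) : R :=
  A_slope S al be r (A_at S al be r * tv) bev (cout_at S al be * tv) * tu
  + A_at S al be r * t_uv al be r tu tv alu bev.

(** Shock speed, and partial derivatives of
    [J = rho_+ rho_- [w]^2 - [p] [rho]] in [rho_+], [w_+] and [rho_-] (the derivative in
    [w_-] is opposite to that in [w_+]). *)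
Definition V_at (i : side) (al be t r : R) : R :=
  (rho_of S al be * ((al - be) / 2) - rhos S i t r * ws S i t r)
  / (rho_of S al be - rhos S i t r).
Definition J_rho_plus (i : side) (al be t r : R) : R :=
  rhos S i t r * ((al - be) / 2 - ws S i t r) ^ 2
  - dpr S (rho_of S al be) * (rho_of S al be - rhos S i t r)
  - (pr S (rho_of S al be) - pr S (rhos S i t r)).
Definition J_w_plus (i : side) (al be t r : R) : R :=
  2 * rho_of S al be * rhos S i t r * ((al - be) / 2 - ws S i t r).
Definition J_rho_minus (i : side) (al be t r : R) : R :=
  rho_of S al be * ((al - be) / 2 - ws S i t r) ^ 2
  + dpr S (rhos S i t r) * (rho_of S al be - rhos S i t r)
  + (pr S (rho_of S al be) - pr S (rhos S i t r)).

(** Derivatives of [J] in [alpha_+], [beta_+], and in [t], [r] through the state ahead. *)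
Definition J_al (i : side) (al be t r : R) : R :=
  (rho_of S al be / eta S (rho_of S al be) * J_rho_plus i al be t r
   + J_w_plus i al be t r) / 2.
Definition J_be (i : side) (al be t r : R) : R :=
  (rho_of S al be / eta S (rho_of S al be) * J_rho_plus i al be t r
   - J_w_plus i al be t r) / 2.
Definition J_t (i : side) (al be t r : R) : R :=
  J_rho_minus i al be t r * pd1 (Dom S i) (rhos S i) t r
  - J_w_plus i al be t r * pd1 (Dom S i) (ws S i) t r.
Definition J_r (i : side) (al be t r : R) : R :=
  J_rho_minus i al be t r * pd2 (Dom S i) (rhos S i) t r
  - J_w_plus i al be t r * pd2 (Dom S i) (ws S i) t r.
End PointwiseCoefficients.

Section Solution.
Context (S : setting) (HS : admissible S) (al0' be0' eps : R) (X : fields).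
Context (HX : shock_interaction S al0' be0' eps X).

Let a := acst S.
Let T := Teps a eps.
Let al := f_al X.
Let be := f_be X.
Let t := f_t X.
Let r := f_r X.

Lemma solution_characteristics (u v : R) : T (u, v) ->
  pd1 T r u v = cin_at S (al u v) (be u v) * pd1 T t u v /\
  pd2 T r u v = cout_at S (al u v) (be u v) * pd2 T t u v /\
  pd2 T al u v = A_at S (al u v) (be u v) (r u v) * pd2 T t u v /\
  pd1 T be u v = A_at S (al u v) (be u v) (r u v) * pd1 T t u v.
Proof.
  intros HT. assert (HC := si_char _ _ _ _ _ HX u v HT). cbv zeta in HC.
  destruct (coefficients_at S _ _ (f_r X u v) (si_image _ _ _ _ _ HX u v HT)) as [E1 [E2 E3]].
  rewrite E1, E2, E3 in HC. exact HC.
Qed.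

(** The equation for [t] is the compatibility of [dr/du = c_in dt/du] with
    [dr/dv = c_out dt/dv]; those for [alpha] and [beta] are the derivatives of
    [dalpha/dv = A dt/dv] in [u] and of [dbeta/du = A dt/du] in [v]. *)
Lemma solution_wave_equations (u v : R) : locally (u, v) T ->
  let F f := f S (al u v) (be u v) (r u v) (pd1 T t u v) (pd2 T t u v)
               (pd1 T al u v) (pd2 T be u v) in
  is_derive (fun s => pd1 T t u s) v (F t_uv) /\
  is_derive (fun s => pd2 T t s v) u (F t_uv) /\
  is_derive (fun s => pd1 T al u s) v (F al_uv) /\
  is_derive (fun s => pd2 T be s v) u (F be_uv).
Proof.
  intros HT F.
  assert (HT0 := locally_singleton _ _ HT).
  destruct (Ck_pd _ _ _ (si_C2_al _ _ _ _ _ HX)) as [_ [Pal1 [Pal2 [Cal1 Cal2]]]].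
  destruct (Ck_pd _ _ _ (si_C2_be _ _ _ _ _ HX)) as [_ [Pbe1 [Pbe2 [Cbe1 Cbe2]]]].
  destruct (Ck_pd _ _ _ (si_C2_t _ _ _ _ _ HX)) as [_ [Pt1 [Pt2 [Ct1 Ct2]]]].
  destruct (Ck_pd _ _ _ (si_C2_r _ _ _ _ _ HX)) as [_ [Pr1 [Pr2 [Cr1 Cr2]]]].
  destruct (Ck_pd _ _ _ Cal1) as [_ [_ [Pal12 _]]].
  destruct (Ck_pd _ _ _ Cal2) as [_ [Pal21 _]].
  destruct (Ck_pd _ _ _ Cbe1) as [_ [_ [Pbe12 _]]].
  destruct (Ck_pd _ _ _ Cbe2) as [_ [Pbe21 _]].
  destruct (Ck_pd _ _ _ Ct1) as [_ [_ [Pt12 _]]].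
  destruct (Ck_pd _ _ _ Ct2) as [_ [Pt21 _]].
  destruct (Ck_pd _ _ _ Cr1) as [_ [_ [Pr12 _]]].
  destruct (Ck_pd _ _ _ Cr2) as [_ [Pr21 _]].
  fold a in Pal1, Pal2, Cal1, Cal2, Pbe1, Pbe2, Cbe1, Cbe2, Pt1, Pt2, Ct1, Ct2, Pr1, Pr2, Cr1, Cr2, Pal12, Pal21, Pbe12, Pbe21, Pt12, Pt21, Pr12, Pr21.
  fold T al be t r in Pal1, Pal2, Cal1, Cal2, Pbe1, Pbe2, Cbe1, Cbe2, Pt1, Pt2, Ct1, Ct2, Pr1, Pr2, Cr1, Cr2, Pal12, Pal21, Pbe12, Pbe21, Pt12, Pt21, Pr12, Pr21.
  assert (Kal := pd_commute T al u v (si_C2_al _ _ _ _ _ HX) HT).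
  assert (Kbe := pd_commute T be u v (si_C2_be _ _ _ _ _ HX) HT).
  assert (Kt := pd_commute T t u v (si_C2_t _ _ _ _ _ HX) HT).
  assert (Kr := pd_commute T r u v (si_C2_r _ _ _ _ _ HX) HT).
  assert (Hu : locally u (fun s => T (s, v))).
  { destruct HT as [d Hd]. exists d. intros s Hs. apply Hd. split; [exact Hs | apply ball_center]. }
  assert (Hv : locally v (fun s => T (u, s))).
  { destruct HT as [d Hd]. exists d. intros s Hs. apply Hd. split; [apply ball_center | exact Hs]. }
  assert (Imu : locally u (fun s => RI_image S (al s v) (be s v))).
  { revert Hu. apply filter_imp. intros s Hs. apply (si_image _ _ _ _ _ HX _ _ Hs). }
  assert (Imv : locally v (fun s => RI_image S (al u s) (be u s))).
  { revert Hv. apply filter_imp. intros s Hs. apply (si_image _ _ _ _ _ HX _ _ Hs). }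
  assert (Hr0 : r u v <> 0) by (apply Rgt_not_eq, (si_r_pos _ _ _ _ _ HX _ _ HT0)).
  destruct (solution_characteristics u v HT0) as [Eru [Erv [Ealv Ebeu]]].
  assert (Hrho := proj1 (state_of_image S _ _ (si_image _ _ _ _ _ HX _ _ HT0))).
  assert (He := eta_pos S HS _ Hrho). fold al be in He.
  (* the mixed derivative of each unknown, from the equation differentiated across *)
  assert (D1 : pd2 T (pd1 T r) u v
     = cin_slope S (al u v) (be u v) (pd2 T al u v) (pd2 T be u v) * pd1 T t u v
       + cin_at S (al u v) (be u v) * pd2 T (pd1 T t) u v).
  { rewrite <- (is_derive_unique _ _ _ (proj2 Pr12 u v HT)). apply is_derive_unique.
    apply is_derive_ext_loc with (f := fun s => cin_at S (al u s) (be u s) * pd1 T t u s).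
    - revert Hv. apply filter_imp. intros s Hs.
      symmetry. apply (solution_characteristics u s Hs).
    - apply (is_derive_mult_R (fun s => cin_at S (al u s) (be u s)) (fun s => pd1 T t u s)).
      + apply (is_derive_cin S HS (fun s => al u s) (fun s => be u s)); [exact Imv | |].
        * now apply Pal2.
        * now apply Pbe2.
      + now apply Pt12. }
  assert (D2 : pd1 T (pd2 T r) u v
     = cout_slope S (al u v) (be u v) (pd1 T al u v) (pd1 T be u v) * pd2 T t u v
       + cout_at S (al u v) (be u v) * pd1 T (pd2 T t) u v).
  { rewrite <- (is_derive_unique _ _ _ (proj2 Pr21 u v HT)). apply is_derive_unique.
    apply is_derive_ext_loc with (f := fun s => cout_at S (al s v) (be s v) * pd2 T t s v).
    - revert Hu. apply filter_imp. intros s Hs.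
      symmetry. apply (solution_characteristics s v Hs).
    - apply (is_derive_mult_R (fun s => cout_at S (al s v) (be s v)) (fun s => pd2 T t s v)).
      + apply (is_derive_cout S HS (fun s => al s v) (fun s => be s v)); [exact Imu | |].
        * now apply Pal1.
        * now apply Pbe1.
      + now apply Pt21. }
  assert (D3 : pd1 T (pd2 T al) u v
     = A_slope S (al u v) (be u v) (r u v) (pd1 T al u v) (pd1 T be u v) (pd1 T r u v) * pd2 T t u v
       + A_at S (al u v) (be u v) (r u v) * pd1 T (pd2 T t) u v).
  { rewrite <- (is_derive_unique _ _ _ (proj2 Pal21 u v HT)). apply is_derive_unique.
    apply is_derive_ext_loc with (f := fun s => A_at S (al s v) (be s v) (r s v) * pd2 T t s v).
    - revert Hu. apply filter_imp. intros s Hs.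
      symmetry. apply (solution_characteristics s v Hs).
    - apply (is_derive_mult_R (fun s => A_at S (al s v) (be s v) (r s v)) (fun s => pd2 T t s v)).
      + apply (is_derive_A S HS (fun s => al s v) (fun s => be s v) (fun s => r s v));
          [exact Hr0 | exact Imu | | |].
        * now apply Pal1.
        * now apply Pbe1.
        * now apply Pr1.
      + now apply Pt21. }
  assert (D4 : pd2 T (pd1 T be) u v
     = A_slope S (al u v) (be u v) (r u v) (pd2 T al u v) (pd2 T be u v) (pd2 T r u v) * pd1 T t u v
       + A_at S (al u v) (be u v) (r u v) * pd2 T (pd1 T t) u v).
  { rewrite <- (is_derive_unique _ _ _ (proj2 Pbe12 u v HT)). apply is_derive_unique.
    apply is_derive_ext_loc with (f := fun s => A_at S (al u s) (be u s) (r u s) * pd1 T t u s).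
    - revert Hv. apply filter_imp. intros s Hs.
      symmetry. apply (solution_characteristics u s Hs).
    - apply (is_derive_mult_R (fun s => A_at S (al u s) (be u s) (r u s)) (fun s => pd1 T t u s)).
      + apply (is_derive_A S HS (fun s => al u s) (fun s => be u s) (fun s => r u s));
          [exact Hr0 | exact Imv | | |].
        * now apply Pal2.
        * now apply Pbe2.
        * now apply Pr2.
      + now apply Pt12. }
  assert (Wt : pd2 T (pd1 T t) u v = F t_uv).
  { unfold F, t_uv. rewrite <- Ealv, <- Ebeu.
    rewrite Kr, D1, Kt in D2.
    assert (Ec : cout_at S (al u v) (be u v) - cin_at S (al u v) (be u v)
                 = 2 * eta S (rho_of S (al u v) (be u v)))
      by (unfold cout_at, cin_at; ring).
    rewrite <- Ec. apply Rmult_eq_reg_r with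
      (cout_at S (al u v) (be u v) - cin_at S (al u v) (be u v)); [|lra].
    unfold Rdiv. rewrite Rmult_assoc, Rinv_l by lra. lra. }
  rewrite Kt, Kal in D3.
  split; [|split; [|split]].
  - rewrite <- Wt. now apply Pt12.
  - rewrite <- Wt, <- (pd_commute T t u v (si_C2_t _ _ _ _ _ HX) HT). now apply Pt21.
  - replace (F al_uv) with (pd2 T (pd1 T al) u v); [now apply Pal12|].
    rewrite D3, Wt, Ebeu, Eru. reflexivity.
  - replace (F be_uv) with (pd1 T (pd2 T be) u v); [now apply Pbe21|].
    rewrite Kbe, D4, Wt, Ealv, Erv. reflexivity.
Qed.
End Solution.

(** * The conditions on the two edges *)

Lemma trace_edge (S : setting) (i : side) (f : R -> R -> R) (s : R) :
  trace (acst S) i f s = f (edge_slope S i * s) s.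
Proof. destruct i; simpl; [now rewrite Rmult_1_l | reflexivity]. Qed.

Section Edge.
Context (S : setting) (HS : admissible S) (al0' be0' eps : R) (X : fields).
Context (HX : shock_interaction S al0' be0' eps X) (i : side).

Let a := acst S.
Let T := Teps a eps.
Let al := f_al X.
Let be := f_be X.
Let t := f_t X.
Let r := f_r X.
Let sg := edge_slope S i.

Lemma edge_slope_bounds : a <= sg <= 1.
Proof. assert (Ha := acst_bounds S HS). unfold sg, edge_slope. destruct i; fold a in Ha |- *; lra. Qed.

Lemma edge_in_sector (s : R) : 0 <= s <= a * eps -> T (sg * s, s).
Proof.
  intros Hs. assert (Ha := acst_bounds S HS). fold a in Ha. assert (Hsg := edge_slope_bounds).
  apply Teps_iff; [lra|]. split; [|split; [|split]]; nra.
Qed.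

Lemma edge_param_range (s : R) : 0 <= s <= a * eps -> 0 <= s <= trace_end a eps i.
Proof.
  intros Hs. assert (Ha := acst_bounds S HS). fold a in Ha. destruct i; simpl; nra.
Qed.

Lemma is_derive_edge (f : R -> R -> R) (s : R) : Ck 1 T f -> 0 < s < a * eps ->
  is_derive (fun s' => f (sg * s') s') s (sg * pd1 T f (sg * s) s + pd2 T f (sg * s) s).
Proof.
  intros Hf Hs. assert (Ha := acst_bounds S HS). fold a in Ha.
  assert (Hsg := edge_slope_bounds).
  destruct (Ck_pd _ _ _ Hf) as [Hc [P1 [P2 _]]].
  replace (sg * pd1 T f (sg * s) s + pd2 T f (sg * s) s)
    with (pd1 T f (sg * s) s * sg + pd2 T f (sg * s) s * 1) by ring.
  apply (is_derive_curve T f (fun s' => sg * s') (fun s' => s')).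
  - apply (Teps_strict_diff a eps); try assumption.
    + apply edge_in_sector. lra.
    + nra.
  - auto_derive; [easy | ring].
  - apply (is_derive_id (K := R_AbsRing)).
  - generalize (filter_and _ _ (open_gt 0 s (proj1 Hs)) (open_lt (a * eps) s (proj2 Hs))).
    apply filter_imp. intros s' Hs'. apply edge_in_sector. lra.
Qed.

Let rho s := rho_of S (al (sg * s) s) (be (sg * s) s).
Let w s := (al (sg * s) s - be (sg * s) s) / 2.
Let rhom s := rhos S i (t (sg * s) s) (r (sg * s) s).
Let wm s := ws S i (t (sg * s) s) (r (sg * s) s).

Lemma edge_ahead (s : R) : 0 <= s <= a * eps -> Dom S i (t (sg * s) s, r (sg * s) s).
Proof.
  intros Hs. assert (HD := si_ahead _ _ _ _ _ HX i s (edge_param_range s Hs)).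
  rewrite !trace_edge in HD. exact HD.
Qed.

Lemma edge_states (s : R) : 0 <= s <= a * eps ->
  0 < rho s /\ 0 < rhom s /\
  rho_of S (al_plus S X i s) (be_plus S X i s) = rho s /\
  w_of S (al_plus S X i s) (be_plus S X i s) = w s /\
  rho_of S (al_minus S X i s) (be_minus S X i s) = rhom s /\
  w_of S (al_minus S X i s) (be_minus S X i s) = wm s.
Proof.
  intros Hs. assert (HD := edge_ahead s Hs).
  assert (Hrm := adm_rhos_pos S HS i _ _ HD). fold (rhom s) in Hrm.
  destruct (state_of_image S _ _ (si_image _ _ _ _ _ HX _ _ (edge_in_sector s Hs)))
    as [K1 [_ K3]].
  unfold al_plus, be_plus, al_minus, be_minus. rewrite !trace_edge. fold sg.
  unfold als, bes. fold al be t r. fold (rhom s) (wm s).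
  destruct (state_of_invariants S HS (rhom s) (wm s) Hrm) as [K4 K5].
  repeat split; assumption.
Qed.

Lemma edge_speed (s : R) : 0 <= s <= a * eps ->
  V S X i s = V_at S i (al (sg * s) s) (be (sg * s) s) (t (sg * s) s) (r (sg * s) s).
Proof.
  intros Hs. destruct (edge_states s Hs) as [_ [_ [E1 [E2 [E3 E4]]]]].
  unfold V, shock_speed. cbv zeta. rewrite E1, E2, E3, E4. reflexivity.
Qed.

(** The edge is mapped to a curve of speed [V]. *)
Lemma edge_boundary_relation (s : R) : 0 < s < a * eps ->
  let f g := g (al (sg * s) s) (be (sg * s) s) in
  let V := V_at S i (al (sg * s) s) (be (sg * s) s) (t (sg * s) s) (r (sg * s) s) in
  sg * (f (cin_at S) - V) * pd1 T t (sg * s) s + (f (cout_at S) - V) * pd2 T t (sg * s) s = 0.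
Proof.
  intros Hs f V0. assert (Hs' : 0 <= s <= a * eps) by lra.
  destruct (si_boundary _ _ _ _ _ HX i s (edge_param_range s Hs')) as [dt [dr [Dt [Dr Hdr]]]].
  assert (Hend : 0 < s < trace_end a eps i).
  { assert (Ha := acst_bounds S HS). fold a in Ha. destruct i; simpl; nra. }
  fold a in Dt, Dr.
  apply is_derive_on_interior in Dt; [|exact Hend].
  apply is_derive_on_interior in Dr; [|exact Hend].
  assert (Et : dt = sg * pd1 T t (sg * s) s + pd2 T t (sg * s) s).
  { rewrite <- (is_derive_unique _ _ _ Dt). apply is_derive_unique.
    apply is_derive_ext with (f := fun s' => t (sg * s') s').
    - intros s'. symmetry. apply trace_edge.
    - apply is_derive_edge; [apply Ck_pred, (si_C2_t _ _ _ _ _ HX) | exact Hs]. }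
  assert (Er : dr = sg * pd1 T r (sg * s) s + pd2 T r (sg * s) s).
  { rewrite <- (is_derive_unique _ _ _ Dr). apply is_derive_unique.
    apply is_derive_ext with (f := fun s' => r (sg * s') s').
    - intros s'. symmetry. apply trace_edge.
    - apply is_derive_edge; [apply Ck_pred, (si_C2_r _ _ _ _ _ HX) | exact Hs]. }
  rewrite (edge_speed s Hs') in Hdr. fold V0 in Hdr.
  destruct (solution_characteristics S _ _ _ X HX _ _ (edge_in_sector s Hs')) as [C1 [C2 _]].
  fold a in C1, C2. fold T al be t r in C1, C2.
  rewrite Et, Er, C1, C2 in Hdr. unfold f. lra.
Qed.

Lemma edge_jump (s : R) : 0 <= s <= a * eps ->
  rho s * rhom s * (w s - wm s) ^ 2
  - (pr S (rho s) - pr S (rhom s)) * (rho s - rhom s) = 0.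
Proof.
  intros Hs. assert (HJ := si_jump _ _ _ _ _ HX i s (edge_param_range s Hs)).
  destruct (edge_states s Hs) as [_ [_ [E1 [E2 [E3 E4]]]]].
  unfold J in HJ. cbv zeta in HJ. rewrite E1, E2, E3, E4 in HJ. lra.
Qed.

(** The jump condition differentiated along the edge; the derivatives of the state ahead
    are those of [rhos] and [ws] along the shock, which may run on the boundary of their
    domain. *)
Lemma edge_jump_relation (tau s : R) : 0 < s < a * eps ->
  (forall f, Ck 1 (Dom S i) f -> forall t r, Dom S i (t, r) -> t < tau -> 0 < r ->
     strict_diff_on (Dom S i) f t r (pd1 (Dom S i) f t r) (pd2 (Dom S i) f t r)) ->
  t (sg * s) s < tau ->
  let g h := h S i (al (sg * s) s) (be (sg * s) s) (t (sg * s) s) (r (sg * s) s) in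
  let A := A_at S (al (sg * s) s) (be (sg * s) s) (r (sg * s) s) in
  let cin := cin_at S (al (sg * s) s) (be (sg * s) s) in
  let cout := cout_at S (al (sg * s) s) (be (sg * s) s) in
  sg * (g J_be * A + g J_t + g J_r * cin) * pd1 T t (sg * s) s
  + (g J_al * A + g J_t + g J_r * cout) * pd2 T t (sg * s) s
  + sg * g J_al * pd1 T al (sg * s) s + g J_be * pd2 T be (sg * s) s = 0.
Proof.
  intros Hs Hstrict Htau g A cin cout. assert (Hs' : 0 <= s <= a * eps) by lra.
  destruct (edge_states s Hs') as [Hrho [Hrhom _]].
  assert (He := eta_pos S HS _ Hrho).
  assert (HT := edge_in_sector s Hs').
  destruct (solution_characteristics S _ _ _ X HX _ _ HT) as [C1 [C2 [C3 C4]]].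
  fold a in C1, C2, C3, C4. fold T al be t r in C1, C2, C3, C4. fold A in C3, C4.
  fold cin in C1. fold cout in C2.
  assert (Hloc : locally s (fun s' => 0 <= s' <= a * eps)).
  { generalize (filter_and _ _ (open_gt 0 s (proj1 Hs)) (open_lt (a * eps) s (proj2 Hs))).
    apply filter_imp. intros s' Hss. lra. }
  assert (Dal := is_derive_edge al s (Ck_pred _ _ _ (si_C2_al _ _ _ _ _ HX)) Hs).
  assert (Dbe := is_derive_edge be s (Ck_pred _ _ _ (si_C2_be _ _ _ _ _ HX)) Hs).
  assert (Dt := is_derive_edge t s (Ck_pred _ _ _ (si_C2_t _ _ _ _ _ HX)) Hs).
  assert (Dr := is_derive_edge r s (Ck_pred _ _ _ (si_C2_r _ _ _ _ _ HX)) Hs).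
  assert (Drho : is_derive rho s (rho s / eta S (rho s) *
    ((sg * pd1 T al (sg * s) s + pd2 T al (sg * s) s
      + (sg * pd1 T be (sg * s) s + pd2 T be (sg * s) s)) / 2))).
  { apply (is_derive_rho_of S HS (fun s => al (sg * s) s) (fun s => be (sg * s) s)).
    - revert Hloc. apply filter_imp. intros s' Hss.
      apply (si_image _ _ _ _ _ HX), (edge_in_sector s' Hss).
    - exact Dal.
    - exact Dbe. }
  assert (Dw := is_derive_half_diff _ _ _ _ _ Dal Dbe). fold w in Dw.
  assert (HDom : locally s (fun s' => Dom S i (t (sg * s') s', r (sg * s') s'))).
  { revert Hloc. apply filter_imp. exact edge_ahead. }
  assert (Hr0 : 0 < r (sg * s) s) by apply (si_r_pos _ _ _ _ _ HX _ _ HT).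
  assert (Drhom := is_derive_curve (Dom S i) (rhos S i) (fun s => t (sg * s) s)
    (fun s => r (sg * s) s) s _ _ _ _
    (Hstrict _ (adm_rhos_smooth S HS i 1%nat) _ _ (edge_ahead s Hs') Htau Hr0) Dt Dr HDom).
  assert (Dwm := is_derive_curve (Dom S i) (ws S i) (fun s => t (sg * s) s)
    (fun s => r (sg * s) s) s _ _ _ _
    (Hstrict _ (adm_ws_smooth S HS i 1%nat) _ _ (edge_ahead s Hs') Htau Hr0) Dt Dr HDom).
  change (is_derive rhom s (pd1 (Dom S i) (rhos S i) (t (sg * s) s) (r (sg * s) s)
    * (sg * pd1 T t (sg * s) s + pd2 T t (sg * s) s)
    + pd2 (Dom S i) (rhos S i) (t (sg * s) s) (r (sg * s) s)
    * (sg * pd1 T r (sg * s) s + pd2 T r (sg * s) s))) in Drhom.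
  change (is_derive wm s (pd1 (Dom S i) (ws S i) (t (sg * s) s) (r (sg * s) s)
    * (sg * pd1 T t (sg * s) s + pd2 T t (sg * s) s)
    + pd2 (Dom S i) (ws S i) (t (sg * s) s) (r (sg * s) s)
    * (sg * pd1 T r (sg * s) s + pd2 T r (sg * s) s))) in Dwm.
  assert (Dpp := is_derive_comp (V := R_NormedModule) (pr S) rho s _ _
    (is_derive_pr S HS _ Hrho) Drho).
  assert (Dpm := is_derive_comp (V := R_NormedModule) (pr S) rhom s _ _
    (is_derive_pr S HS _ Hrhom) Drhom).
  assert (Ddw := is_derive_minus _ _ _ _ _ Dw Dwm).
  assert (D1 := is_derive_mult_R _ _ _ _ _ (is_derive_mult_R _ _ _ _ _ Drho Drhom)
                  (is_derive_mult_R _ _ _ _ _ Ddw Ddw)).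
  assert (D2 := is_derive_mult_R _ _ _ _ _ (is_derive_minus _ _ _ _ _ Dpp Dpm)
                  (is_derive_minus _ _ _ _ _ Drho Drhom)).
  assert (D := is_derive_minus _ _ _ _ _ D1 D2).
  assert (D0 := is_derive_const (V := R_NormedModule) 0 s).
  set (jump := fun s => rho s * rhom s * ((w s - wm s) * (w s - wm s))
    - (pr S (rho s) - pr S (rhom s)) * (rho s - rhom s)).
  assert (D0' : is_derive jump s 0).
  { apply is_derive_ext_loc with (2 := D0).
    revert Hloc. apply filter_imp. intros s' Hss. unfold jump.
    rewrite <- (edge_jump s' Hss).
    match goal with |- ?x = ?y => change (@eq R x y) end. ring. }
  eassert (HDu : Derive jump s = _) by exact (is_derive_unique _ _ _ D).
  rewrite (is_derive_unique _ _ _ D0') in HDu. rename HDu into HD. symmetry in HD.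
  rewrite C1, C2, C3, C4 in HD.
  unfold g, J_t, J_r, J_al, J_be, J_rho_plus, J_w_plus, J_rho_minus.
  fold (rho s) (w s) (rhom s) (wm s).
  rewrite <- HD.
  unfold minus, plus, opp, scal; simpl. unfold mult; simpl.
  match goal with |- ?x = ?y => change (@eq R x y) end.
  fold (w s). field. lra.
Qed.
End Edge.

(** * Differences of the coefficients *)

(** Decomposes an arithmetic expression, down to quantities covered by hypotheses;
    leaves the non-vanishing of those denominators that [lra] does not settle. *)
Ltac lip_arith :=
  repeat match goal with
  | |- lip _ _ (fun _ _ => ?c) _ => apply lip_const
  | |- lip _ _ (fun k z => @?q k z + @?p k z) _ => apply (lip_plus q p)
  | |- lip _ _ (fun k z => @?q k z - @?p k z) _ => apply (lip_minus q p)
  | |- lip _ _ (fun k z => - @?q k z) _ => apply (lip_opp q)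
  | |- lip _ _ (fun k z => @?q k z * @?p k z) _ => apply (lip_mult q p)
  | |- lip _ _ (fun k z => @?q k z / @?p k z) _ => apply (lip_div q p); [try lra | |]
  | |- lip _ _ (fun k z => @?q k z ^ ?n) _ => apply (lip_pow q)
  | HL : lip _ _ ?q _ |- lip _ _ ?q _ => exact HL
  | HL : lip _ _ ?q _ |- lip _ _ (fun k z => ?q k z) _ => exact HL
  end.

Section LipCoefficients.
Context (S : setting) (HS : admissible S).
Context {I : Type} {F : (I -> Prop) -> Prop} {FF : Filter F} {m : I -> R}.
Context (al be r : bool -> I -> R) (al0 be0 r0 : R).
Context (Him : forall k, F (fun z => RI_image S (al k z) (be k z))).
Context (Him0 : RI_image S al0 be0).
Context (Hal : lip F m al al0) (Hbe : lip F m be be0).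

Lemma lip_rho :
  lip F m (fun k z => rho_of S (al k z) (be k z)) (rho_of S al0 be0).
Proof. now apply lip_rho_of. Qed.

Lemma base_rho_pos : 0 < rho_of S al0 be0.
Proof. apply (state_of_image S _ _ Him0). Qed.

Lemma lip_of_rho (f : R -> R) : locally_lipschitz f (rho_of S al0 be0) ->
  lip F m (fun k z => f (rho_of S (al k z) (be k z))) (f (rho_of S al0 be0)).
Proof. intros Hf. exact (lip_comp f _ _ Hf lip_rho). Qed.

Lemma lip_eta :
  lip F m (fun k z => eta S (rho_of S (al k z) (be k z))) (eta S (rho_of S al0 be0)).
Proof. apply lip_of_rho, locally_lipschitz_eta, base_rho_pos; exact HS. Qed.

Lemma lip_eta_slope :
  lip F m (fun k z => eta_slope S (rho_of S (al k z) (be k z)))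
    (eta_slope S (rho_of S al0 be0)).
Proof.
  assert (Hr := base_rho_pos).
  assert (H1 := lip_of_rho _ (locally_lipschitz_dpr S HS _ Hr)).
  assert (H2 := lip_of_rho _ (locally_lipschitz_ddpr S HS _ Hr)).
  assert (H3 := lip_rho). assert (Hp := adm_p_incr S HS _ Hr).
  unfold eta_slope. lip_arith. unfold dpr. lra.
Qed.

Lemma lip_cin :
  lip F m (fun k z => cin_at S (al k z) (be k z)) (cin_at S al0 be0).
Proof. assert (H1 := lip_eta). unfold cin_at. lip_arith. Qed.

Lemma lip_cout :
  lip F m (fun k z => cout_at S (al k z) (be k z)) (cout_at S al0 be0).
Proof. assert (H1 := lip_eta). unfold cout_at. lip_arith. Qed.

Context (Hr0 : r0 <> 0) (Hr : lip F m r r0).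

Lemma lip_A :
  lip F m (fun k z => A_at S (al k z) (be k z) (r k z)) (A_at S al0 be0 r0).
Proof. assert (H1 := lip_eta). unfold A_at. lip_arith. Qed.

Section Slopes.
Context (la lb lr : bool -> I -> R) (la0 lb0 lr0 : R).
Context (Hla : lip F m la la0) (Hlb : lip F m lb lb0) (Hlr : lip F m lr lr0).

Lemma lip_cin_slope :
  lip F m (fun k z => cin_slope S (al k z) (be k z) (la k z) (lb k z))
    (cin_slope S al0 be0 la0 lb0).
Proof. assert (H1 := lip_eta_slope). unfold cin_slope. lip_arith. Qed.

Lemma lip_cout_slope :
  lip F m (fun k z => cout_slope S (al k z) (be k z) (la k z) (lb k z))
    (cout_slope S al0 be0 la0 lb0).
Proof. assert (H1 := lip_eta_slope). unfold cout_slope. lip_arith. Qed.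

Lemma lip_A_slope :
  lip F m (fun k z => A_slope S (al k z) (be k z) (r k z) (la k z) (lb k z) (lr k z))
    (A_slope S al0 be0 r0 la0 lb0 lr0).
Proof.
  assert (H1 := lip_eta_slope). assert (H2 := lip_eta).
  unfold A_slope. lip_arith. now apply Rmult_integral_contrapositive_currified.
Qed.
End Slopes.
End LipCoefficients.

Section LipWave.
Context (S : setting) (HS : admissible S).
Context {I : Type} {F : (I -> Prop) -> Prop} {FF : Filter F} {m : I -> R}.
Context (al be r tu tv au bv : bool -> I -> R) (al0 be0 r0 tu0 tv0 au0 bv0 : R).
Context (Him : forall k, F (fun z => RI_image S (al k z) (be k z))).
Context (Him0 : RI_image S al0 be0) (Hr0 : r0 <> 0).
Context (Hal : lip F m al al0) (Hbe : lip F m be be0) (Hr : lip F m r r0).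
Context (Htu : lip F m tu tu0) (Htv : lip F m tv tv0).
Context (Hau : lip F m au au0) (Hbv : lip F m bv bv0).

Lemma lip_t_uv :
  lip F m (fun k z => t_uv S (al k z) (be k z) (r k z) (tu k z) (tv k z) (au k z) (bv k z))
    (t_uv S al0 be0 r0 tu0 tv0 au0 bv0).
Proof.
  assert (HA := lip_A S HS al be r _ _ _ Him Him0 Hal Hbe Hr0 Hr).
  assert (He := lip_eta S HS al be _ _ Him Him0 Hal Hbe).
  assert (H1 := lip_cin_slope S HS al be _ _ Him Him0 Hal Hbe _ _ _ _
    (lip_mult _ _ _ _ HA Htv) Hbv).
  assert (H2 := lip_cout_slope S HS al be _ _ Him Him0 Hal Hbe _ _ _ _
    Hau (lip_mult _ _ _ _ HA Htu)).
  unfold t_uv. lip_arith.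
  assert (Hp := eta_pos S HS _ (proj1 (state_of_image S _ _ Him0))). lra.
Qed.

Lemma lip_al_uv :
  lip F m (fun k z => al_uv S (al k z) (be k z) (r k z) (tu k z) (tv k z) (au k z) (bv k z))
    (al_uv S al0 be0 r0 tu0 tv0 au0 bv0).
Proof.
  assert (HA := lip_A S HS al be r _ _ _ Him Him0 Hal Hbe Hr0 Hr).
  assert (Hc := lip_cin S HS al be _ _ Him Him0 Hal Hbe).
  assert (H1 := lip_t_uv).
  assert (H2 := lip_A_slope S HS al be r _ _ _ Him Him0 Hal Hbe Hr0 Hr _ _ _ _ _ _
    Hau (lip_mult _ _ _ _ HA Htu) (lip_mult _ _ _ _ Hc Htu)).
  unfold al_uv. lip_arith.
Qed.

Lemma lip_be_uv :
  lip F m (fun k z => be_uv S (al k z) (be k z) (r k z) (tu k z) (tv k z) (au k z) (bv k z))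
    (be_uv S al0 be0 r0 tu0 tv0 au0 bv0).
Proof.
  assert (HA := lip_A S HS al be r _ _ _ Him Him0 Hal Hbe Hr0 Hr).
  assert (Hc := lip_cout S HS al be _ _ Him Him0 Hal Hbe).
  assert (H1 := lip_t_uv).
  assert (H2 := lip_A_slope S HS al be r _ _ _ Him Him0 Hal Hbe Hr0 Hr _ _ _ _ _ _
    (lip_mult _ _ _ _ HA Htv) Hbv (lip_mult _ _ _ _ Hc Htv)).
  unfold be_uv. lip_arith.
Qed.
End LipWave.

Section LipJump.
Context (S : setting) (HS : admissible S) (i : side).
Context {I : Type} {F : (I -> Prop) -> Prop} {FF : Filter F} {m : I -> R}.
Context (al be t r : bool -> I -> R) (al0 be0 : R).
Context (Him : forall k, F (fun z => RI_image S (al k z) (be k z))).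
Context (Him0 : RI_image S al0 be0).
Context (HD : forall k, F (fun z => Dom S i (t k z, r k z))).
Context (Hal : lip F m al al0) (Hbe : lip F m be be0).
Context (Ht : lip F m t 0) (Hr : lip F m r (r0 S)).

Lemma lip_ahead (f : R -> R -> R) : Ck 1 (Dom S i) f ->
  lip F m (fun k z => f (t k z) (r k z)) (f 0 (r0 S)).
Proof.
  intros Hf. destruct (Dom_strict_diff S HS i) as [tau [Htau Hstrict]].
  refine (lip_comp2 (Dom S i) f t r 0 (r0 S) _ _
    (Hstrict f Hf 0 (r0 S) (corner_in_Dom S HS i) Htau (adm_r0 S HS))
    (corner_in_Dom S HS i) HD Ht Hr).
Qed.

Lemma lip_V : rho_of S al0 be0 <> rho_m0 S i ->
  lip F m (fun k z => V_at S i (al k z) (be k z) (t k z) (r k z))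
    (V_at S i al0 be0 0 (r0 S)).
Proof.
  intros Hne.
  assert (H1 := lip_ahead _ (adm_rhos_smooth S HS i 1%nat)).
  assert (H2 := lip_ahead _ (adm_ws_smooth S HS i 1%nat)).
  assert (H3 := lip_rho S HS al be _ _ Him Him0 Hal Hbe).
  unfold V_at. lip_arith. unfold rho_m0 in Hne. lra.
Qed.

Lemma lip_J_w_plus :
  lip F m (fun k z => J_w_plus S i (al k z) (be k z) (t k z) (r k z))
    (J_w_plus S i al0 be0 0 (r0 S)).
Proof.
  assert (H1 := lip_ahead _ (adm_rhos_smooth S HS i 1%nat)).
  assert (H2 := lip_ahead _ (adm_ws_smooth S HS i 1%nat)).
  assert (H3 := lip_rho S HS al be _ _ Him Him0 Hal Hbe).
  unfold J_w_plus. lip_arith.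
Qed.

Lemma lip_J_rho_plus :
  lip F m (fun k z => J_rho_plus S i (al k z) (be k z) (t k z) (r k z))
    (J_rho_plus S i al0 be0 0 (r0 S)).
Proof.
  assert (H1 := lip_ahead _ (adm_rhos_smooth S HS i 1%nat)).
  assert (H2 := lip_ahead _ (adm_ws_smooth S HS i 1%nat)).
  assert (H3 := lip_rho S HS al be _ _ Him Him0 Hal Hbe).
  assert (H4 := lip_comp _ _ _ (locally_lipschitz_pr S HS _ (rho_m0_pos S HS i)) H1).
  assert (Hp := proj1 (state_of_image S _ _ Him0)).
  assert (H5 := lip_comp _ _ _ (locally_lipschitz_pr S HS _ Hp) H3).
  assert (H6 := lip_comp _ _ _ (locally_lipschitz_dpr S HS _ Hp) H3).
  unfold J_rho_plus. lip_arith.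
Qed.

Lemma lip_J_rho_minus :
  lip F m (fun k z => J_rho_minus S i (al k z) (be k z) (t k z) (r k z))
    (J_rho_minus S i al0 be0 0 (r0 S)).
Proof.
  assert (H1 := lip_ahead _ (adm_rhos_smooth S HS i 1%nat)).
  assert (H2 := lip_ahead _ (adm_ws_smooth S HS i 1%nat)).
  assert (H3 := lip_rho S HS al be _ _ Him Him0 Hal Hbe).
  assert (H4 := lip_comp _ _ _ (locally_lipschitz_pr S HS _ (rho_m0_pos S HS i)) H1).
  assert (H6 := lip_comp _ _ _ (locally_lipschitz_dpr S HS _ (rho_m0_pos S HS i)) H1).
  assert (Hp := proj1 (state_of_image S _ _ Him0)).
  assert (H5 := lip_comp _ _ _ (locally_lipschitz_pr S HS _ Hp) H3).
  unfold J_rho_minus. lip_arith.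
Qed.

Lemma lip_J_al :
  lip F m (fun k z => J_al S i (al k z) (be k z) (t k z) (r k z))
    (J_al S i al0 be0 0 (r0 S)).
Proof.
  assert (H1 := lip_J_rho_plus). assert (H2 := lip_J_w_plus).
  assert (H3 := lip_rho S HS al be _ _ Him Him0 Hal Hbe).
  assert (H4 := lip_eta S HS al be _ _ Him Him0 Hal Hbe).
  assert (Hp := eta_pos S HS _ (proj1 (state_of_image S _ _ Him0))).
  unfold J_al. lip_arith.
Qed.

Lemma lip_J_be :
  lip F m (fun k z => J_be S i (al k z) (be k z) (t k z) (r k z))
    (J_be S i al0 be0 0 (r0 S)).
Proof.
  assert (H1 := lip_J_rho_plus). assert (H2 := lip_J_w_plus).
  assert (H3 := lip_rho S HS al be _ _ Him Him0 Hal Hbe).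
  assert (H4 := lip_eta S HS al be _ _ Him Him0 Hal Hbe).
  assert (Hp := eta_pos S HS _ (proj1 (state_of_image S _ _ Him0))).
  unfold J_be. lip_arith.
Qed.

Lemma lip_J_t :
  lip F m (fun k z => J_t S i (al k z) (be k z) (t k z) (r k z))
    (J_t S i al0 be0 0 (r0 S)).
Proof.
  assert (H1 := lip_J_rho_minus). assert (H2 := lip_J_w_plus).
  destruct (Ck_pd _ _ _ (adm_rhos_smooth S HS i 2%nat)) as [_ [_ [_ [C1 _]]]].
  destruct (Ck_pd _ _ _ (adm_ws_smooth S HS i 2%nat)) as [_ [_ [_ [C2 _]]]].
  assert (H3 := lip_ahead _ C1). assert (H4 := lip_ahead _ C2).
  unfold J_t. lip_arith.
Qed.

Lemma lip_J_r :
  lip F m (fun k z => J_r S i (al k z) (be k z) (t k z) (r k z))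
    (J_r S i al0 be0 0 (r0 S)).
Proof.
  assert (H1 := lip_J_rho_minus). assert (H2 := lip_J_w_plus).
  destruct (Ck_pd _ _ _ (adm_rhos_smooth S HS i 2%nat)) as [_ [_ [_ [_ C1]]]].
  destruct (Ck_pd _ _ _ (adm_ws_smooth S HS i 2%nat)) as [_ [_ [_ [_ C2]]]].
  assert (H3 := lip_ahead _ C1). assert (H4 := lip_ahead _ C2).
  unfold J_r. lip_arith.
Qed.
End LipJump.

Section BaseValues.
Context (S : setting) (HS : admissible S).

Lemma speeds_at_rest : cin_at S (beta0 S) (beta0 S) = - eta0 S /\
  cout_at S (beta0 S) (beta0 S) = eta0 S /\
  forall r, A_at S (beta0 S) (beta0 S) r = 0.
Proof.
  unfold cin_at, cout_at, A_at. rewrite (rho_of_at_rest S HS). fold (eta0 S).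
  split; [lra | split; [lra|]]. intros r.
  replace ((beta0 S - beta0 S) / 2) with 0 by lra. unfold Rdiv. ring.
Qed.

Lemma V_at_rest (i : side) : V_at S i (beta0 S) (beta0 S) 0 (r0 S) = V0 S i.
Proof.
  destruct (adm_jump S HS i) as [J1 _]. assert (Hne := density_jump_neq S HS i).
  unfold V_at. rewrite (rho_of_at_rest S HS). fold (rho_m0 S i) (w_m0 S i).
  apply Rmult_eq_reg_l with (rho0 S - rho_m0 S i); [|exact Hne].
  rewrite J1. field. exact Hne.
Qed.

(** The derivatives of [J] in the invariants behind the shock, at the interaction point. *)
Lemma J_derivatives_at_rest (i : side) :
  J_al S i (beta0 S) (beta0 S) 0 (r0 S)
  = - ((rho0 S - rho_m0 S i) * rho0 S / (2 * eta0 S)) * (eta0 S - V0 S i) ^ 2 /\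
  J_be S i (beta0 S) (beta0 S) 0 (r0 S)
  = - ((rho0 S - rho_m0 S i) * rho0 S / (2 * eta0 S)) * (eta0 S + V0 S i) ^ 2.
Proof.
  destruct (adm_jump S HS i) as [J1 J2]. assert (Hne := density_jump_neq S HS i).
  assert (Hrm := rho_m0_pos S HS i). assert (He := eta0_pos S HS).
  assert (He2 := eta_sqr S HS _ (adm_rho0 S HS)). fold (eta0 S) in He2.
  unfold J_al, J_be, J_rho_plus, J_w_plus. rewrite (rho_of_at_rest S HS).
  fold (rho_m0 S i) (w_m0 S i) (eta0 S). rewrite <- He2.
  set (rm := rho_m0 S i) in *. set (wm := w_m0 S i) in *. set (rh := rho0 S) in *.
  set (e := eta0 S) in *. set (Vi := V0 S i) in *.
  assert (Ew : wm = - ((rh - rm) * Vi / rm)).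
  { apply Rmult_eq_reg_l with rm; [|lra].
    replace (rm * - ((rh - rm) * Vi / rm)) with (- ((rh - rm) * Vi)) by (field; lra). lra. }
  assert (Ep : pr S rh - pr S rm = (rh - rm) * Vi ^ 2 + rm * wm ^ 2).
  { rewrite <- J1 in J2. simpl in J2 |- *. lra. }
  rewrite Ep, Ew. split; field; lra.
Qed.
End BaseValues.

(** * The contraction *)

(** [dal], ..., [dbv] stand for the differences of [alpha], [beta], [t], [r], [dt/du],
    [dt/dv], [dalpha/du], [dbeta/dv]. *)
Section Contraction.
Context (a gam e0 C Q0 : R).
Context (Ha : 0 < a < 1) (Hgam : 0 < gam < 1) (He0 : 0 < e0) (HC : 0 <= C) (HQ0 : 0 <= Q0).
Context (dal dbe dt dr dtu dtv dau dbv : R -> R -> R).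

Let m u v := Rabs (dal u v) + Rabs (dbe u v) + Rabs (dt u v) + Rabs (dr u v).
Let n u v := m u v + Rabs (dtu u v) + Rabs (dtv u v) + Rabs (dau u v) + Rabs (dbv u v).

(** Transport along the two families of characteristics, from the left and from the
    right edge. *)
Context (Hvert : forall u v M, Teps a e0 (u, v) -> 0 < u ->
  (forall s, u <= s <= v -> n u s <= M) ->
  Rabs (dtu u v - dtu u u) <= C * M * (v - u) /\
  Rabs (dau u v - dau u u) <= C * M * (v - u)).
Context (Hhor : forall u v M, Teps a e0 (u, v) -> 0 < u ->
  (forall s, a * v <= s <= u -> n s v <= M) ->
  Rabs (dtv u v - dtv (a * v) v) <= C * M * (u - a * v) /\
  Rabs (dbv u v - dbv (a * v) v) <= C * M * (u - a * v)).
(** Integration of the gradients of the unknowns, from the corner. *)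
Context (Hzero : forall u v M, Teps a e0 (u, v) -> 0 < u ->
  (forall u' v', Teps a e0 (u', v') -> u' <= u -> v' <= v -> n u' v' <= M) ->
  Rabs (dal u v) <= C * M * v /\ Rabs (dbe u v) <= C * M * v /\
  Rabs (dt u v) <= C * M * v /\ Rabs (dr u v) <= C * M * v).
(** The boundary conditions on the two edges. *)
Context (Hleft : forall e, 0 < e -> exists e1, 0 < e1 /\ forall s, 0 < s < e1 ->
  Rabs (dtu s s) <= / gam * Rabs (dtv s s) + C * m s s + e * n s s /\
  Rabs (dau s s) <= gam ^ 2 * Rabs (dbv s s) + C * (Rabs (dtu s s) + Rabs (dtv s s))
                    + C * m s s + e * n s s).
Context (Hright : forall e, 0 < e -> exists e1, 0 < e1 /\ forall s, 0 < s < e1 ->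
  Rabs (dtv (a * s) s) <= gam * Rabs (dtu (a * s) s) + C * m (a * s) s + e * n (a * s) s /\
  Rabs (dbv (a * s) s) <= a * Rabs (dau (a * s) s)
                    + C * (Rabs (dtu (a * s) s) + Rabs (dtv (a * s) s))
                    + C * m (a * s) s + e * n (a * s) s).
(** Agreement of the first derivatives at the corner. *)
Context (Hinit : forall u v, Teps a e0 (u, v) ->
  Rabs (dtu u v) <= Q0 * u /\ Rabs (dtv u v) <= Q0 * v /\
  Rabs (dau u v) <= Q0 * u /\ Rabs (dbv u v) <= Q0 * v /\
  Rabs (dal u v) <= Q0 * v /\ Rabs (dbe u v) <= Q0 * v /\
  Rabs (dt u v) <= Q0 * v /\ Rabs (dr u v) <= Q0 * v).

(* The reflections on the two edges have the factors 1/gam and gam, with product one; the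
   gain is that u = a v on the right edge.  As gam a < lam < gam, the weight lam shares
   this gain between both reflections.  K dominates the coupling of the gradients of
   alpha and beta to those of t. *)
Let lam := gam * (1 + a) / 2.
Let kap := Rmin ((1 - a) / 4) ((1 - gam ^ 2) / 4).
Let K := (2 * C + 1) / kap.
Let N0 := 6 + 2 * K.

(** The size [Q] of the differences on the sector: those of [dt/du] and [dalpha/du] are
    compared with [u], all the others with [v]. *)
Definition weighted_bound (e Q : R) : Prop := forall u v, Teps a e (u, v) ->
  Rabs (dtu u v) <= Q * u /\ Rabs (dtv u v) <= lam * Q * v /\
  Rabs (dau u v) <= K * Q * u /\ Rabs (dbv u v) <= K * Q * v /\
  Rabs (dal u v) <= Q * v /\ Rabs (dbe u v) <= Q * v /\
  Rabs (dt u v) <= Q * v /\ Rabs (dr u v) <= Q * v.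

Lemma contraction_constants :
  0 < kap /\ kap <= (1 - a) / 4 /\ kap <= (1 - gam ^ 2) / 4 /\
  0 < lam < 1 /\ 4 < K /\ K * kap = 2 * C + 1 /\ 14 < N0.
Proof.
  assert (K1 : kap <= (1 - a) / 4) by apply Rmin_l.
  assert (K2 : kap <= (1 - gam ^ 2) / 4) by apply Rmin_r.
  assert (K3 : 0 < kap) by (apply Rmin_glb_lt; nra).
  assert (K4 : K * kap = 2 * C + 1) by (unfold K; field; lra).
  assert (K5 : 4 < K) by nra.
  assert (K6 : 0 < lam < 1) by (unfold lam; nra).
  assert (K7 : 14 < N0) by (unfold N0; lra). tauto.
Qed.

Lemma weighted_bound_n (e Q u v : R) : 0 <= Q -> weighted_bound e Q ->
  Teps a e (u, v) -> n u v <= N0 * Q * v.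
Proof.
  intros HQ HB HT. destruct contraction_constants as (K1 & K2 & K3 & K4 & K5 & K6 & K7).
  destruct (HB u v HT) as (B1 & B2 & B3 & B4 & B5 & B6 & B7 & B8).
  apply Teps_iff in HT; [|lra].
  assert (Q * u <= Q * v) by (apply Rmult_le_compat_l; lra).
  assert (K * (Q * u) <= K * (Q * v)) by (apply Rmult_le_compat_l; lra).
  assert (lam * (Q * v) <= 1 * (Q * v))
    by (apply Rmult_le_compat_r; [apply Rmult_le_pos|]; lra).
  unfold n, m, N0. lra.
Qed.

Lemma weighted_bound_contracts : exists e1, 0 < e1 <= e0 /\
  forall e Q, 0 < e <= e1 -> 0 <= Q -> weighted_bound e Q ->
    weighted_bound e ((1 - kap) * Q).
Proof.
  destruct contraction_constants as (K1 & K2 & K3 & K4 & K5 & K6 & K7).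
  set (om := gam * (1 - a) / 12).
  assert (Hom : 0 < om) by (unfold om; nra).
  assert (Hom1 : om <= 1 / 12 /\ om <= (1 - a) / 12) by (unfold om; split; nra).
  set (ep := om / N0).
  assert (Hep : 0 < ep) by (apply Rdiv_lt_0_compat; lra).
  assert (EepN : ep * N0 = om) by (unfold ep; field; lra).
  destruct (Hleft ep Hep) as [el [Hel HL]].
  destruct (Hright ep Hep) as [er [Her HR]].
  assert (HCN : 0 <= C * N0) by (apply Rmult_le_pos; lra).
  set (big := (C * N0 + 1) * (4 * C + 1) / a).
  assert (Hbig0 : 0 < (C * N0 + 1) * (4 * C + 1)) by nra.
  assert (Hbig : 0 < big) by (apply Rdiv_lt_0_compat; lra).
  assert (Ebig : a * big = (C * N0 + 1) * (4 * C + 1)) by (unfold big; field; lra).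
  set (e1 := Rmin (Rmin e0 (om / big)) (Rmin (el / 2) (er / 2))).
  assert (He1 : 0 < e1).
  { unfold e1. repeat apply Rmin_glb_lt; try lra. now apply Rdiv_lt_0_compat. }
  assert (L1 : e1 <= e0) by (unfold e1; eapply Rle_trans; apply Rmin_l).
  assert (L2 : e1 <= om / big) by (unfold e1; eapply Rle_trans; [apply Rmin_l | apply Rmin_r]).
  assert (L3 : e1 <= el / 2) by (unfold e1; eapply Rle_trans; [apply Rmin_r | apply Rmin_l]).
  assert (L4 : e1 <= er / 2) by (unfold e1; eapply Rle_trans; [apply Rmin_r | apply Rmin_r]).
  assert (L5 : big * e1 <= om).
  { apply (Rmult_le_compat_l big) in L2; [|lra].
    replace (big * (om / big)) with om in L2 by (field; lra). exact L2. }
  exists e1. split; [lra|]. intros e Q He HQ HB u v HT.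
  assert (HTe0 : forall u v, Teps a e (u, v) -> Teps a e0 (u, v)).
  { intros u' v' HT'. apply Teps_iff in HT'; [|lra]. apply Teps_iff; [lra|].
    assert (a * e <= a * e0) by (apply Rmult_le_compat_l; lra). lra. }
  assert (HT0 := HT). apply Teps_iff in HT0; [|lra]. destruct HT0 as (P1 & P2 & P3 & P4).
  assert (P5 : v <= e) by (apply Rmult_le_reg_l with a; lra).
  destruct (Req_dec u 0) as [Hu0 | Hu0].
  { assert (v = 0) by nra. subst u v.
    destruct (Hinit 0 0 (HTe0 _ _ HT)) as (I1 & I2 & I3 & I4 & I5 & I6 & I7 & I8).
    rewrite !Rmult_0_r in *. tauto. }
  assert (Hu : 0 < u) by lra. assert (Hv : 0 < v) by lra.
  assert (S1 : C * N0 * v <= a * om /\ 4 * C * (C * N0 * v) <= om).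
  { assert (Hbv : big * v <= om) by (apply Rle_trans with (big * e1); [apply Rmult_le_compat_l; lra | exact L5]).
    assert (Habv : (C * N0 + 1) * (4 * C + 1) * v <= a * om).
    { rewrite <- Ebig. rewrite Rmult_assoc. apply Rmult_le_compat_l; lra. }
    assert (0 <= C * N0 * v) by (apply Rmult_le_pos; lra).
    assert (0 <= C * (C * N0 * v)) by (apply Rmult_le_pos; lra).
    assert (0 <= C * v) by (apply Rmult_le_pos; lra).
    assert (a * om <= 1 * om) by (apply Rmult_le_compat_r; lra). split; lra. }
  destruct S1 as [S1 S2].
  assert (Hsub : forall u' v', Teps a e0 (u', v') -> u' <= u -> Teps a e (u', v')).
  { intros u' v' HT' Hu'. apply Teps_iff in HT'; [|lra]. apply Teps_iff; [lra|]. lra. }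
  assert (Nb : forall u' v', Teps a e (u', v') -> v' <= v -> n u' v' <= N0 * Q * v).
  { intros u' v' HT' Hv'. eapply Rle_trans; [apply (weighted_bound_n e Q); assumption|].
    apply Rmult_le_compat_l; [apply Rmult_le_pos; lra | exact Hv']. }
  assert (Zb : forall u' v', Teps a e (u', v') -> 0 < u' -> v' <= v ->
     Rabs (dal u' v') <= C * (N0 * Q * v') * v' /\ Rabs (dbe u' v') <= C * (N0 * Q * v') * v' /\
     Rabs (dt u' v') <= C * (N0 * Q * v') * v' /\ Rabs (dr u' v') <= C * (N0 * Q * v') * v').
  { intros u' v' HT' Hu' Hv'. apply Hzero; [now apply HTe0 | exact Hu'|].
    intros u2 v2 HT2 Hu2 Hv2.
    assert (HT2' : Teps a e (u2, v2)).
    { apply Teps_iff in HT2; [|lra]. apply Teps_iff in HT'; [|lra]. apply Teps_iff; lra. }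
    eapply Rle_trans; [apply (weighted_bound_n e Q); assumption|].
    apply Rmult_le_compat_l; [apply Rmult_le_pos; lra | exact Hv2]. }
  assert (Zs : forall x, 0 < x <= v -> C * (N0 * Q * x) * x <= a * om * Q * x).
  { intros x Hx.
    assert (Hx1 : C * N0 * x <= a * om).
    { eapply Rle_trans; [|exact S1]. apply Rmult_le_compat_l; lra. }
    assert (HQx : 0 <= Q * x) by (apply Rmult_le_pos; lra).
    apply (Rmult_le_compat_r _ _ _ HQx) in Hx1. lra. }
  assert (Ms : forall u' v', Teps a e (u', v') -> 0 < u' -> 0 < v' <= v ->
     C * m u' v' <= om * Q * v').
  { intros u' v' HT' Hu' Hv'.
    destruct (Zb u' v' HT' Hu' (proj2 Hv')) as (Z1 & Z2 & Z3 & Z4).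
    assert (Hx1 : 4 * C * (C * N0 * v') <= om).
    { eapply Rle_trans; [|exact S2]. apply Rmult_le_compat_l; [lra|].
      apply Rmult_le_compat_l; lra. }
    assert (HQx : 0 <= Q * v') by (apply Rmult_le_pos; lra).
    apply (Rmult_le_compat_r _ _ _ HQx) in Hx1.
    assert (Hm : m u' v' <= 4 * (C * (N0 * Q * v') * v')) by (unfold m; lra).
    apply (Rmult_le_compat_l C) in Hm; [|exact HC]. lra. }
  assert (Es : forall u' v', Teps a e (u', v') -> 0 < u' -> 0 < v' <= v ->
     C * m u' v' + ep * n u' v' <= 2 * om * Q * v').
  { intros u' v' HT' Hu' Hv'.
    assert (E1 := Ms u' v' HT' Hu' Hv').
    assert (E2 := weighted_bound_n e Q u' v' HQ HB HT').
    apply (Rmult_le_compat_l ep) in E2; [|lra].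
    replace (ep * (N0 * Q * v')) with (ep * N0 * Q * v') in E2 by ring.
    rewrite EepN in E2. lra. }
  (* the feet of the two characteristics through (u, v) *)
  assert (TL : Teps a e (u, u)).
  { apply Teps_iff; [lra|]. assert (a * u <= 1 * u) by (apply Rmult_le_compat_r; lra). lra. }
  assert (TR : Teps a e (a * v, v)).
  { apply Teps_iff; [lra|]. assert (0 <= a * v) by (apply Rmult_le_pos; lra). lra. }
  assert (Hav : 0 < a * v) by (apply Rmult_lt_0_compat; lra).
  destruct (HL u ltac:(lra)) as [EL1 EL2]. destruct (HR v ltac:(lra)) as [ER1 ER2].
  assert (EsL := Es u u TL Hu ltac:(lra)). assert (EsR := Es (a * v) v TR Hav ltac:(lra)).
  destruct (HB _ _ TL) as (BL1 & BL2 & BL3 & BL4 & _).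
  destruct (HB _ _ TR) as (BR1 & BR2 & BR3 & BR4 & _).
  assert (HQu : 0 <= Q * u) by (apply Rmult_le_pos; lra).
  assert (HQv : 0 <= Q * v) by (apply Rmult_le_pos; lra).
  assert (Hom_u : 0 <= om * (Q * u)) by (apply Rmult_le_pos; lra).
  assert (Hom_v : 0 <= om * (Q * v)) by (apply Rmult_le_pos; lra).
  assert (TV : C * (N0 * Q * v) * (v - u) <= om * (Q * u)).
  { apply Rle_trans with (C * (N0 * Q * v) * v).
    { apply Rmult_le_compat_l; [|lra].
      replace (C * (N0 * Q * v)) with (C * N0 * (Q * v)) by ring. now apply Rmult_le_pos. }
    eapply Rle_trans; [apply Zs; lra|].
    replace (a * om * Q * v) with (om * Q * (a * v)) by ring.
    replace (om * (Q * u)) with (om * Q * u) by ring.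
    apply Rmult_le_compat_l; [apply Rmult_le_pos; lra | lra]. }
  assert (TH : C * (N0 * Q * v) * (u - a * v) <= om * (Q * v)).
  { apply Rle_trans with (C * (N0 * Q * v) * v).
    { apply Rmult_le_compat_l; [|lra].
      replace (C * (N0 * Q * v)) with (C * N0 * (Q * v)) by ring. now apply Rmult_le_pos. }
    eapply Rle_trans; [apply Zs; lra|].
    replace (a * om * Q * v) with (a * (om * (Q * v))) by ring.
    rewrite <- (Rmult_1_l (om * (Q * v))) at 2. apply Rmult_le_compat_r; lra. }
  destruct (Hvert u v (N0 * Q * v) (HTe0 _ _ HT) Hu) as [V1 V2].
  { intros s Hs. apply Nb; [|lra]. apply Teps_iff; [lra|].
    assert (a * s <= a * v) by (apply Rmult_le_compat_l; lra). lra. }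
  destruct (Hhor u v (N0 * Q * v) (HTe0 _ _ HT) Hu) as [W1 W2].
  { intros s Hs. apply Nb; [|lra]. apply Teps_iff; lra. }
  destruct (Zb u v HT Hu (Rle_refl v)) as (Z1 & Z2 & Z3 & Z4).
  assert (Zv := Zs v ltac:(lra)).
  assert (Tri : forall x y, Rabs x <= Rabs y + Rabs (x - y)).
  { intros x y. replace x with (y + (x - y)) at 1 by ring. apply Rabs_triang. }
  assert (G1 := Tri (dtu u v) (dtu u u)). assert (G2 := Tri (dau u v) (dau u u)).
  assert (G3 := Tri (dtv u v) (dtv (a * v) v)). assert (G4 := Tri (dbv u v) (dbv (a * v) v)).
  assert (Hk : 3 / 4 <= 1 - kap) by lra.
  assert (HkQ : a * om * Q * v <= (1 - kap) * Q * v).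
  { replace (a * om * Q * v) with (a * om * (Q * v)) by ring.
    replace ((1 - kap) * Q * v) with ((1 - kap) * (Q * v)) by ring.
    apply Rmult_le_compat_r; [exact HQv|].
    assert (a * om <= 1 * om) by (apply Rmult_le_compat_r; lra). lra. }
  assert (HKQu : 0 <= K * (Q * u)) by (apply Rmult_le_pos; lra).
  assert (HKQv : 0 <= K * (Q * v)) by (apply Rmult_le_pos; lra).
  assert (HCQu : 0 <= C * (Q * u)) by (apply Rmult_le_pos; lra).
  assert (HCQv : 0 <= C * (Q * v)) by (apply Rmult_le_pos; lra).
  split; [|split; [|split; [|split; [|split; [|split; [|split]]]]]]; try lra.
  - assert (F1 : / gam * Rabs (dtv u u) <= (1 + a) / 2 * (Q * u)).
    { apply (Rmult_le_compat_l (/ gam)) in BL2; [|apply Rlt_le, Rinv_0_lt_compat; lra].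
      replace (/ gam * (lam * Q * u)) with ((1 + a) / 2 * (Q * u)) in BL2
        by (unfold lam; field; lra). exact BL2. }
    assert (F2 : ((1 + a) / 2 + 3 * om) * (Q * u) <= (1 - kap) * (Q * u))
      by (apply Rmult_le_compat_r; lra).
    lra.
  - assert (F1 : gam * Rabs (dtu (a * v) v) <= gam * a * (Q * v)).
    { apply (Rmult_le_compat_l gam) in BR1; lra. }
    assert (F2 : gam * a + 3 * om <= lam * (1 - kap)).
    { apply Rle_trans with (lam * ((3 + a) / 4)).
      - unfold lam, om. assert (0 <= gam * ((1 - a) * (1 - a))) by (apply Rmult_le_pos; [lra | apply Rmult_le_pos; lra]). lra.
      - apply Rmult_le_compat_l; lra. }
    apply (Rmult_le_compat_r _ _ _ HQv) in F2. lra.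
  - assert (F1 : gam ^ 2 * Rabs (dbv u u) <= gam ^ 2 * K * (Q * u)).
    { apply (Rmult_le_compat_l (gam ^ 2)) in BL4; [lra | apply pow2_ge_0]. }
    assert (F2 : C * (Rabs (dtu u u) + Rabs (dtv u u)) <= 2 * (C * (Q * u))).
    { assert (lam * (Q * u) <= 1 * (Q * u)) by (apply Rmult_le_compat_r; lra).
      replace (2 * (C * (Q * u))) with (C * (2 * (Q * u))) by ring.
      apply Rmult_le_compat_l; lra. }
    assert (F3 : gam ^ 2 * K + 2 * C + 3 * om <= K * (1 - kap)).
    { assert (0 <= K * (1 - gam ^ 2 - 4 * kap)) by (apply Rmult_le_pos; lra). lra. }
    apply (Rmult_le_compat_r _ _ _ HQu) in F3. lra.
  - assert (F1 : a * Rabs (dau (a * v) v) <= a * K * (Q * v)).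
    { apply (Rmult_le_compat_l a) in BR3; [|lra].
      assert (a * (K * (Q * v)) <= 1 * (K * (Q * v))) by (apply Rmult_le_compat_r; lra).
      apply (Rmult_le_compat_l a) in H; lra. }
    assert (F2 : C * (Rabs (dtu (a * v) v) + Rabs (dtv (a * v) v)) <= 2 * (C * (Q * v))).
    { assert (lam * (Q * v) <= 1 * (Q * v)) by (apply Rmult_le_compat_r; lra).
      assert (a * (Q * v) <= 1 * (Q * v)) by (apply Rmult_le_compat_r; lra).
      replace (2 * (C * (Q * v))) with (C * (2 * (Q * v))) by ring.
      apply Rmult_le_compat_l; lra. }
    assert (F3 : a * K + 2 * C + 3 * om <= K * (1 - kap)).
    { assert (0 <= K * (1 - a - 4 * kap)) by (apply Rmult_le_pos; lra). lra. }
    apply (Rmult_le_compat_r _ _ _ HQv) in F3. lra.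
Qed.

(** The bound with constant [(1 - kap)^k Q1] holds for every [k]. *)
Lemma contraction_vanishing : exists e1, 0 < e1 <= e0 /\
  forall u v, Teps a e1 (u, v) -> dal u v = 0 /\ dbe u v = 0 /\ dt u v = 0 /\ dr u v = 0.
Proof.
  destruct contraction_constants as (K1 & K2 & K3 & K4 & K5 & K6 & K7).
  destruct weighted_bound_contracts as [e1 [He1 Hcon]].
  exists e1. split; [exact He1|].
  set (Q1 := Q0 / lam).
  assert (HQ1 : 0 <= Q1) by (unfold Q1; apply Rmult_le_pos; [exact HQ0 | apply Rlt_le, Rinv_0_lt_compat; lra]).
  assert (EQ1 : lam * Q1 = Q0) by (unfold Q1; field; lra).
  assert (HQ01 : Q0 <= Q1).
  { rewrite <- EQ1. rewrite <- (Rmult_1_l Q1) at 2. apply Rmult_le_compat_r; lra. }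
  assert (HKQ : Q0 <= K * Q1).
  { apply Rle_trans with (1 * Q1); [lra|]. apply Rmult_le_compat_r; lra. }
  assert (Hinit' : weighted_bound e1 Q1).
  { intros u v HT.
    assert (HT' : Teps a e0 (u, v)).
    { apply Teps_iff in HT; [|lra]. apply Teps_iff; [lra|].
      assert (a * e1 <= a * e0) by (apply Rmult_le_compat_l; lra). lra. }
    destruct (Hinit u v HT') as (I1 & I2 & I3 & I4 & I5 & I6 & I7 & I8).
    apply Teps_iff in HT; [|lra].
    assert (Q0 * u <= Q1 * u) by (apply Rmult_le_compat_r; lra).
    assert (Q0 * v <= Q1 * v) by (apply Rmult_le_compat_r; lra).
    assert (Q0 * u <= K * Q1 * u) by (apply Rmult_le_compat_r; lra).
    assert (Q0 * v <= K * Q1 * v) by (apply Rmult_le_compat_r; lra).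
    rewrite EQ1. lra. }
  assert (Hall : forall k, weighted_bound e1 ((1 - kap) ^ k * Q1)).
  { induction k as [|k IH]; simpl.
    - now rewrite Rmult_1_l.
    - rewrite Rmult_assoc. apply Hcon; [lra | | exact IH].
      apply Rmult_le_pos; [apply pow_le; lra | exact HQ1]. }
  intros u v HT.
  assert (Hv : 0 <= v) by (apply Teps_iff in HT; lra).
  assert (Hz : forall x, (forall k, Rabs x <= (1 - kap) ^ k * Q1 * v) -> x = 0).
  { intros x Hx. destruct (Req_dec x 0) as [E | E]; [exact E|].
    assert (Hax := Rabs_pos_lt x E).
    assert (Hy : 0 < Rabs x / (Q1 * v + 1)).
    { apply Rdiv_lt_0_compat; [exact Hax|]. assert (0 <= Q1 * v) by now apply Rmult_le_pos. lra. }
    destruct (pow_lt_1_zero (1 - kap) ltac:(rewrite Rabs_pos_eq; lra) _ Hy) as [k Hk].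
    specialize (Hk k (le_n k)). rewrite Rabs_pos_eq in Hk by (apply pow_le; lra).
    specialize (Hx k). assert (H0 : 0 <= Q1 * v) by now apply Rmult_le_pos.
    apply (Rmult_lt_compat_r (Q1 * v + 1)) in Hk; [|lra].
    replace (Rabs x / (Q1 * v + 1) * (Q1 * v + 1)) with (Rabs x) in Hk by (field; lra).
    assert (0 <= (1 - kap) ^ k) by (apply pow_le; lra). lra. }
  repeat split; apply Hz; intros k; apply (Hall k u v HT).
Qed.
End Contraction.

(** * The corner of the sector *)

Lemma mean_value_bound_on (f df : R -> R) (M x y : R) : x <= y ->
  (forall s, x < s < y -> is_derive f s (df s)) ->
  (forall s e, x <= s <= y -> 0 < e -> exists d, 0 < d /\
     forall s', x <= s' <= y -> Rabs (s' - s) < d -> Rabs (f s' - f s) < e) ->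
  (forall s, x < s < y -> Rabs (df s) <= M) ->
  Rabs (f y - f x) <= M * (y - x).
Proof.
  intros Hxy Hd Hc HM. destruct Hxy as [Hxy | ->].
  2:{ rewrite !Rminus_diag, Rabs_R0. lra. }
  assert (HM0 : 0 <= M) by (eapply Rle_trans; [apply Rabs_pos | apply (HM ((x + y) / 2)); lra]).
  apply Rle_plus_epsilon. intros e He.
  destruct (Hc x (e / 2) ltac:(lra) ltac:(lra)) as [dx [Hdx Cx]].
  destruct (Hc y (e / 2) ltac:(lra) ltac:(lra)) as [dy [Hdy Cy]].
  set (h := Rmin (Rmin dx dy) (y - x) / 3).
  assert (Hh : 0 < Rmin (Rmin dx dy) (y - x)) by (repeat apply Rmin_glb_lt; lra).
  assert (M1 := Rmin_l (Rmin dx dy) (y - x)). assert (M2 := Rmin_r (Rmin dx dy) (y - x)).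
  assert (M3 := Rmin_l dx dy). assert (M4 := Rmin_r dx dy).
  assert (Hh' : 0 < h /\ h < dx /\ h < dy /\ 3 * h <= y - x) by (unfold h; lra).
  destruct Hh' as (H1 & H2 & H3 & H4).
  assert (B1 := Cx (x + h) ltac:(lra) ltac:(apply Rabs_lt_between; lra)).
  assert (B2 := Cy (y - h) ltac:(lra) ltac:(apply Rabs_lt_between; lra)).
  assert (B3 : Rabs (f (y - h) - f (x + h)) <= M * Rabs (y - h - (x + h))).
  { apply mean_value_bound with df; rewrite Rmin_left, Rmax_right by lra; intros s Hs.
    - apply Hd. lra.
    - apply derivable_continuous_pt. eexists. apply is_derive_Reals, Hd. lra.
    - apply HM. lra. }
  rewrite (Rabs_pos_eq (y - h - (x + h))) in B3 by lra.
  assert (M * (y - h - (x + h)) <= M * (y - x)) by (apply Rmult_le_compat_l; lra).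
  apply Rabs_lt_between in B1. apply Rabs_lt_between in B2. apply Rabs_le_between in B3.
  apply Rabs_le_between. lra.
Qed.

(** A linear inequality solved for its first unknown. *)
Lemma solve_linear_bound (c1 c2 x y rem E : R) : c1 <> 0 ->
  Rabs (c1 * x + c2 * y + rem) <= E ->
  Rabs x <= Rabs (c2 / c1) * Rabs y + / Rabs c1 * Rabs rem + / Rabs c1 * E.
Proof.
  intros Hc HE. assert (Hp := Rabs_pos_lt c1 Hc).
  assert (Hi : 0 < / Rabs c1) by now apply Rinv_0_lt_compat.
  replace x with (/ c1 * (c1 * x + c2 * y + rem) + (- (c2 / c1) * y + - (/ c1 * rem)))
    at 1 by (field; exact Hc).
  eapply Rle_trans; [apply Rabs_triang|].
  eapply Rle_trans; [apply Rplus_le_compat_l, Rabs_triang|].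
  rewrite !Rabs_Ropp, !Rabs_mult, Rabs_Ropp, (Rabs_inv c1).
  apply (Rmult_le_compat_l (/ Rabs c1)) in HE; lra.
Qed.

Section Corner.
Context (S : setting) (HS : admissible S).
Let a := acst S.

(** Properties of the points of the sector sufficiently close to its corner, and of
    those on one of its edges. *)
Definition near_corner (P : R * R -> Prop) : Prop :=
  exists e, 0 < e /\ forall u v, Teps (acst S) e (u, v) -> P (u, v).
Definition near_edge (i : side) (P : R * R -> Prop) : Prop :=
  exists e, 0 < e /\ forall s, 0 < s < e -> P (edge_slope S i * s, s).

Lemma Teps_mono (e e' u v : R) : e <= e' -> Teps a e (u, v) -> Teps a e' (u, v).
Proof.
  intros He HT. assert (Ha := acst_bounds S HS). fold a in Ha.
  apply Teps_iff in HT; [|lra]. apply Teps_iff; [lra|].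
  assert (a * e <= a * e') by (apply Rmult_le_compat_l; lra). lra.
Qed.

Lemma Teps_range (e u v : R) : Teps a e (u, v) -> 0 <= u <= v /\ a * v <= u <= a * e /\ v <= e.
Proof.
  intros HT. assert (Ha := acst_bounds S HS). fold a in Ha.
  apply Teps_iff in HT; [|lra].
  repeat split; try lra. apply Rmult_le_reg_l with a; lra.
Qed.

Lemma near_corner_filter : Filter near_corner.
Proof.
  constructor.
  - exists 1. split; [lra | trivial].
  - intros P Q [e [He HP]] [e' [He' HQ]]. exists (Rmin e e').
    split; [now apply Rmin_glb_lt|]. intros u v HT. split.
    + apply HP. revert HT. apply Teps_mono, Rmin_l.
    + apply HQ. revert HT. apply Teps_mono, Rmin_r.
  - intros P Q HPQ [e [He HP]]. exists e. split; [exact He|]. intros u v HT. now apply HPQ, HP.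
Qed.

Lemma near_edge_filter (i : side) : ProperFilter' (near_edge i).
Proof.
  constructor.
  - intros [e [He HF]]. apply (HF (e / 2)). lra.
  - constructor.
    + exists 1. split; [lra | trivial].
    + intros P Q [e [He HP]] [e' [He' HQ]]. exists (Rmin e e').
      split; [now apply Rmin_glb_lt|]. intros s Hs.
      assert (M1 := Rmin_l e e'). assert (M2 := Rmin_r e e').
      split; [apply HP | apply HQ]; lra.
    + intros P Q HPQ [e [He HP]]. exists e. split; [exact He|]. intros s Hs. now apply HPQ, HP.
Qed.

Lemma near_edge_le (i : side) : filter_le (near_edge i) near_corner.
Proof.
  intros P [e [He HP]]. assert (Ha := acst_bounds S HS). fold a in Ha.
  exists (a * e). split; [apply Rmult_lt_0_compat; lra|]. intros s Hs. apply HP.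
  apply (edge_in_sector S HS e i). fold a. lra.
Qed.

Lemma corner_limit (eps : R) (f : R -> R -> R) : 0 < eps ->
  continuous_on (Teps a eps) (uncurry2 f) ->
  filterlim (uncurry2 f) near_corner (locally (f 0 0)).
Proof.
  intros Heps Hc. assert (Ha := acst_bounds S HS). fold a in Ha.
  apply (@filterlim_locally_eps _ near_corner near_corner_filter). intros e He.
  assert (H0 : Teps a eps (0, 0)).
  { apply Teps_iff; [lra|]. assert (0 <= a * eps) by (apply Rmult_le_pos; lra). lra. }
  destruct (continuous_on_eps _ _ _ _ e Hc H0 He) as [d [Hd HC]].
  exists (Rmin eps (d / 2)). split; [apply Rmin_glb_lt; lra|].
  intros u v HT.
  assert (M1 := Rmin_l eps (d / 2)). assert (M2 := Rmin_r eps (d / 2)).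
  destruct (Teps_range _ _ _ HT) as (R1 & R2 & R3).
  change (Rabs (f u v - f 0 0) < e).
  apply HC; [revert HT; now apply Teps_mono | |]; apply Rabs_lt_between; lra.
Qed.

Lemma corner_lipschitz (eps : R) (f : R -> R -> R) : 0 < eps -> Ck 1 (Teps a eps) f ->
  exists L e, 0 <= L /\ 0 < e /\ forall u v, Teps a e (u, v) ->
    Rabs (f u v - f 0 0) <= L * u.
Proof.
  intros Heps Hf. assert (Ha := acst_bounds S HS). fold a in Ha.
  assert (Hae : 0 < a * eps) by (apply Rmult_lt_0_compat; lra).
  assert (H0 : Teps a eps (0, 0)) by (apply Teps_iff; lra).
  destruct (Ck_pd _ _ _ Hf) as [Hc [P1 [P2 _]]].
  destruct (Teps_strict_diff a eps f _ _ 0 0 Ha Hc P1 P2 H0 Hae 1 Rlt_0_1) as [d [Hd HD]].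
  set (c1 := pd1 (Teps a eps) f 0 0) in *. set (c2 := pd2 (Teps a eps) f 0 0) in *.
  assert (Q1 := Rabs_pos c1). assert (Q2 := Rabs_pos c2).
  assert (Hia : 0 < / a) by (apply Rinv_0_lt_compat; lra).
  exists ((Rabs c1 + 1) + (Rabs c2 + 1) * / a), (Rmin eps (d / 2)).
  split; [assert (0 <= (Rabs c2 + 1) * / a) by (apply Rmult_le_pos; lra); lra|].
  split; [apply Rmin_glb_lt; lra|].
  intros u v HT.
  assert (M1 := Rmin_l eps (d / 2)). assert (M2 := Rmin_r eps (d / 2)).
  destruct (Teps_range _ _ _ HT) as (R1 & R2 & R3).
  assert (HB := HD 0 0 u v H0 (Teps_mono _ _ _ _ M1 HT)).
  rewrite !Rminus_0_r, Rabs_R0 in HB.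
  rewrite (Rabs_pos_eq u), (Rabs_pos_eq v) in HB by lra.
  specialize (HB Hd Hd ltac:(lra) ltac:(lra)).
  replace (f u v - f 0 0) with ((f u v - f 0 0 - c1 * u - c2 * v) + (c1 * u + c2 * v)) by ring.
  eapply Rle_trans; [apply Rabs_triang|].
  eapply Rle_trans; [apply Rplus_le_compat; [exact HB | apply Rabs_triang]|].
  rewrite !Rabs_mult, (Rabs_pos_eq u), (Rabs_pos_eq v) by lra.
  assert (Hv : v <= / a * u).
  { apply Rmult_le_reg_l with a; [lra|]. rewrite <- Rmult_assoc, Rinv_r by lra. lra. }
  apply (Rmult_le_compat_l (Rabs c2 + 1)) in Hv; [|lra]. lra.
Qed.

Lemma lip_of_limit {I : Type} (F : (I -> Prop) -> Prop) {FF : Filter F} (m : I -> R)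
    (q : I -> R) (q0 : R) : filterlim q F (locally q0) -> lip F m (fun _ => q) q0.
Proof.
  intros Hq. split; [now intros _|]. exists 0. split; [lra|].
  apply filter_forall. intros z. rewrite Rminus_diag, Rabs_R0. lra.
Qed.

Section OneSolution.
Context (al0' be0' eps : R) (Heps : 0 < eps) (X : fields).
Context (HX : shock_interaction S al0' be0' eps X).
Let T := Teps a eps.

Lemma corner_in_sector : T (0, 0).
Proof.
  assert (Ha := acst_bounds S HS). fold a in Ha.
  apply Teps_iff; [lra|]. assert (0 <= a * eps) by (apply Rmult_le_pos; lra). lra.
Qed.

Lemma near_corner_sector (P : R * R -> Prop) :
  (forall u v, T (u, v) -> P (u, v)) -> near_corner P.
Proof. intros HP. exists eps. split; [exact Heps | exact HP]. Qed.

Lemma near_edge_param (i : side) (P : R * R -> Prop) :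
  (forall s, 0 < s < a * eps -> P (edge_slope S i * s, s)) -> near_edge i P.
Proof.
  intros HP. assert (Ha := acst_bounds S HS). fold a in Ha.
  exists (a * eps). split; [apply Rmult_lt_0_compat; lra | exact HP].
Qed.

Lemma corner_limits :
  filterlim (uncurry2 (f_al X)) near_corner (locally (beta0 S)) /\
  filterlim (uncurry2 (f_be X)) near_corner (locally (beta0 S)) /\
  filterlim (uncurry2 (f_t X)) near_corner (locally 0) /\
  filterlim (uncurry2 (f_r X)) near_corner (locally (r0 S)).
Proof.
  repeat split.
  - rewrite <- (si_al0 _ _ _ _ _ HX). apply (corner_limit eps); [exact Heps|].
    apply (si_C2_al _ _ _ _ _ HX).
  - rewrite <- (si_be0 _ _ _ _ _ HX). apply (corner_limit eps); [exact Heps|].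
    apply (si_C2_be _ _ _ _ _ HX).
  - rewrite <- (si_t0 _ _ _ _ _ HX). apply (corner_limit eps); [exact Heps|].
    apply (si_C2_t _ _ _ _ _ HX).
  - rewrite <- (si_r0 _ _ _ _ _ HX). apply (corner_limit eps); [exact Heps|].
    apply (si_C2_r _ _ _ _ _ HX).
Qed.

(** From [dr/dv = 1] and [dr/dv = c_out dt/dv]. *)
Lemma corner_dtdv : pd2 T (f_t X) 0 0 = / eta0 S.
Proof.
  destruct (solution_characteristics S _ _ _ X HX 0 0 corner_in_sector) as [_ [E _]].
  fold a T in E.
  assert (E1 := si_drdv0 _ _ _ _ _ HX). fold a T in E1. rewrite E1 in E.
  rewrite (si_al0 _ _ _ _ _ HX), (si_be0 _ _ _ _ _ HX) in E.
  destruct (speeds_at_rest S HS) as [_ [E2 _]]. rewrite E2 in E.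
  assert (He := eta0_pos S HS).
  apply Rmult_eq_reg_l with (eta0 S); [|lra]. rewrite Rinv_r; lra.
Qed.

(** The limit at the corner of the boundary condition on the edge [u = v]. *)
Lemma corner_dtdu : pd1 T (f_t X) 0 0
  = (eta0 S - V0 S Lft) / (eta0 S + V0 S Lft) * / eta0 S.
Proof.
  assert (He := eta0_pos S HS). assert (HV := shock_speeds_bounds S HS).
  destruct corner_limits as (L1 & L2 & L3 & L4).
  destruct (Ck_pd _ _ _ (si_C2_t _ _ _ _ _ HX)) as [_ [_ [_ [C1 C2]]]].
  fold a T in C1, C2.
  assert (L5 := corner_limit eps _ Heps (Ck_continuous_on _ _ _ C1)).
  assert (L6 := corner_limit eps _ Heps (Ck_continuous_on _ _ _ C2)).
  assert (FE := filter_filter' (ProperFilter' := near_edge_filter Lft)).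
  set (F := near_edge Lft) in *.
  set (z0 := fun _ : R * R => 0).
  assert (Q : forall q q0, filterlim q near_corner (locally q0) -> lip F z0 (fun _ => q) q0).
  { intros q q0 Hq. apply (@lip_of_limit _ F FE).
    exact (filterlim_filter_le_1 _ (near_edge_le Lft) Hq). }
  assert (Him : forall k : bool, F (fun z => RI_image S (uncurry2 (f_al X) z) (uncurry2 (f_be X) z))).
  { intros _. apply near_edge_le, near_corner_sector. intros u v HT.
    apply (si_image _ _ _ _ _ HX _ _ HT). }
  assert (HD : forall k : bool, F (fun z => Dom S Lft (uncurry2 (f_t X) z, uncurry2 (f_r X) z))).
  { intros _. apply near_edge_param. intros s Hs.
    apply (edge_ahead S HS _ _ _ X HX Lft). fold a. simpl. lra. }
  assert (Him0 := image_at_rest S HS).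
  assert (Lcin := lip_cin S HS _ _ _ _ Him Him0 (Q _ _ L1) (Q _ _ L2)).
  assert (Lcout := lip_cout S HS _ _ _ _ Him Him0 (Q _ _ L1) (Q _ _ L2)).
  assert (Hne : rho_of S (beta0 S) (beta0 S) <> rho_m0 S Lft).
  { rewrite (rho_of_at_rest S HS). assert (HH := density_jump_neq S HS Lft). lra. }
  assert (LV := lip_V S HS Lft _ _ _ _ _ _ Him Him0 HD (Q _ _ L1) (Q _ _ L2) (Q _ _ L3) (Q _ _ L4) Hne).
  destruct (speeds_at_rest S HS) as [E1 [E2 _]].
  rewrite E1 in Lcin. rewrite E2 in Lcout. rewrite (V_at_rest S HS) in LV.
  assert (Lrel := lip_plus _ _ _ _
    (lip_mult _ _ _ _ (lip_minus _ _ _ _ Lcin LV) (Q _ _ L5))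
    (lip_mult _ _ _ _ (lip_minus _ _ _ _ Lcout LV) (Q _ _ L6))).
  assert (Lz := filterlim_const (F := F) (0 : R_UniformSpace)).
  rewrite corner_dtdv in Lrel.
  assert (Hz : (- eta0 S - V0 S Lft) * pd1 T (f_t X) 0 0 + (eta0 S - V0 S Lft) * / eta0 S = 0).
  { refine (filterlim_locally_unique (FF := near_edge_filter Lft) (K := R_AbsRing)
      (V := R_NormedModule) _ _ _ (proj1 Lrel true) _).
    apply filterlim_ext_loc with (2 := Lz).
    apply near_edge_param. intros s Hs.
    rewrite <- (edge_boundary_relation S HS _ _ _ X HX Lft s Hs) at 1.
    unfold uncurry2, edge_slope; simpl. fold a T. rewrite !Rmult_1_l. reflexivity. }
  apply Rmult_eq_reg_l with (eta0 S + V0 S Lft); [|lra].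
  replace ((eta0 S + V0 S Lft) * ((eta0 S - V0 S Lft) / (eta0 S + V0 S Lft) * / eta0 S))
    with ((eta0 S - V0 S Lft) * / eta0 S) by (field; lra). lra.
Qed.
End OneSolution.
End Corner.

(** * Two solutions *)

Section TwoSolutions.
Context (S : setting) (HS : admissible S) (al0' be0' eps : R) (Heps : 0 < eps).
Context (X : bool -> fields) (HX : forall k, shock_interaction S al0' be0' eps (X k)).

Let a := acst S.
Let T := Teps a eps.
Let NC := near_corner S.
Let NE := near_edge S.

Let al k := uncurry2 (f_al (X k)).
Let be k := uncurry2 (f_be (X k)).
Let t k := uncurry2 (f_t (X k)).
Let r k := uncurry2 (f_r (X k)).
Let tu k := uncurry2 (pd1 T (f_t (X k))).
Let tv k := uncurry2 (pd2 T (f_t (X k))).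
Let au k := uncurry2 (pd1 T (f_al (X k))).
Let bv k := uncurry2 (pd2 T (f_be (X k))).

(** The difference of the two solutions; its size [m] for the unknowns themselves, and [n]
    with the gradients included. *)
Let d (q : bool -> R * R -> R) (z : R * R) := q true z - q false z.
Let m z := Rabs (d al z) + Rabs (d be z) + Rabs (d t z) + Rabs (d r z).
Let n z := m z + Rabs (d tu z) + Rabs (d tv z) + Rabs (d au z) + Rabs (d bv z).

Let FC : Filter NC := near_corner_filter S HS.
Let FE i : Filter (NE i) := filter_filter' (ProperFilter' := near_edge_filter S i).
Local Existing Instance FC.
Local Existing Instance FE.

Lemma m_nonneg (z : R * R) : 0 <= m z.
Proof. unfold m. repeat apply Rplus_le_le_0_compat; apply Rabs_pos. Qed.

Lemma m_le_n (z : R * R) : m z <= n z.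
Proof.
  unfold n.
  generalize (Rabs_pos (d tu z)) (Rabs_pos (d tv z)) (Rabs_pos (d au z)) (Rabs_pos (d bv z)). lra.
Qed.

Lemma n_nonneg (z : R * R) : 0 <= n z.
Proof. eapply Rle_trans; [apply m_nonneg | apply m_le_n]. Qed.

Lemma pair_lip_zeroth :
  lip NC m al (beta0 S) /\ lip NC m be (beta0 S) /\ lip NC m t 0 /\ lip NC m r (r0 S).
Proof.
  assert (HL := fun k => corner_limits S HS _ _ _ Heps (X k) (HX k)).
  assert (P1 := fun z => Rabs_pos (d al z)). assert (P2 := fun z => Rabs_pos (d be z)).
  assert (P3 := fun z => Rabs_pos (d t z)). assert (P4 := fun z => Rabs_pos (d r z)).
  repeat split; try (intros k; apply (HL k)); exists 1;
    (split; [lra|]; apply filter_forall; intros z;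
     specialize (P1 z); specialize (P2 z); specialize (P3 z); specialize (P4 z);
     unfold m; unfold d in *; lra).
Qed.

Lemma Ck_tu (k : bool) : Ck 1 T (pd1 T (f_t (X k))).
Proof. apply (Ck_pd _ _ _ (si_C2_t _ _ _ _ _ (HX k))). Qed.

Lemma Ck_tv (k : bool) : Ck 1 T (pd2 T (f_t (X k))).
Proof. apply (Ck_pd _ _ _ (si_C2_t _ _ _ _ _ (HX k))). Qed.

Lemma Ck_au (k : bool) : Ck 1 T (pd1 T (f_al (X k))).
Proof. apply (Ck_pd _ _ _ (si_C2_al _ _ _ _ _ (HX k))). Qed.

Lemma Ck_bv (k : bool) : Ck 1 T (pd2 T (f_be (X k))).
Proof. apply (Ck_pd _ _ _ (si_C2_be _ _ _ _ _ (HX k))). Qed.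

Let tu0 := (eta0 S - V0 S Lft) / (eta0 S + V0 S Lft) * / eta0 S.

Lemma pair_corner_values (k : bool) :
  pd1 T (f_t (X k)) 0 0 = tu0 /\ pd2 T (f_t (X k)) 0 0 = / eta0 S /\
  pd1 T (f_al (X k)) 0 0 = al0' /\ pd2 T (f_be (X k)) 0 0 = be0'.
Proof.
  split; [exact (corner_dtdu S HS _ _ _ Heps (X k) (HX k))|].
  split; [exact (corner_dtdv S HS _ _ _ Heps (X k) (HX k))|].
  split; [apply (si_daldu0 _ _ _ _ _ (HX k)) | apply (si_dbedv0 _ _ _ _ _ (HX k))].
Qed.

Lemma pair_lip_first :
  lip NC n tu tu0 /\ lip NC n tv (/ eta0 S) /\ lip NC n au al0' /\ lip NC n bv be0'.
Proof.
  assert (P0 := m_nonneg).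
  assert (P1 := fun z => Rabs_pos (d tu z)). assert (P2 := fun z => Rabs_pos (d tv z)).
  assert (P3 := fun z => Rabs_pos (d au z)). assert (P4 := fun z => Rabs_pos (d bv z)).
  assert (HL : forall f : bool -> R -> R -> R, (forall k, Ck 1 T (f k)) -> forall k,
            filterlim (uncurry2 (f k)) NC (locally (f k 0 0))).
  { intros f Hf k. apply (corner_limit S HS eps _ Heps), (Ck_continuous_on 1%nat), Hf. }
  repeat split; try (exists 1;
    (split; [lra|]; apply filter_forall; intros z;
     specialize (P0 z); specialize (P1 z); specialize (P2 z); specialize (P3 z); specialize (P4 z);
     unfold n; unfold d in *; lra));
  intros k; destruct (pair_corner_values k) as (E1 & E2 & E3 & E4).
  - rewrite <- E1. apply (HL (fun k => pd1 T (f_t (X k)))), Ck_tu.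
  - rewrite <- E2. apply (HL (fun k => pd2 T (f_t (X k)))), Ck_tv.
  - rewrite <- E3. apply (HL (fun k => pd1 T (f_al (X k)))), Ck_au.
  - rewrite <- E4. apply (HL (fun k => pd2 T (f_be (X k)))), Ck_bv.
Qed.

Lemma pair_image (k : bool) : NC (fun z => RI_image S (al k z) (be k z)).
Proof.
  apply (near_corner_sector S _ Heps). intros u v HT. apply (si_image _ _ _ _ _ (HX k) _ _ HT).
Qed.

(** A quantity whose difference is [O(n)] near the corner. *)
Definition difference_bound (q : bool -> R * R -> R) : Prop :=
  exists C, 0 <= C /\ NC (fun z => Rabs (d q z) <= C * n z).

Lemma lip_difference_bound (q : bool -> R * R -> R) (q0 : R) :
  lip NC n q q0 -> difference_bound q.
Proof. intros [_ Hq]. exact Hq. Qed.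

Lemma difference_bound_and (l : list (bool -> R * R -> R)) :
  List.Forall difference_bound l ->
  exists C e, 0 <= C /\ 0 < e /\ forall q, List.In q l ->
    forall u v, Teps a e (u, v) -> Rabs (d q (u, v)) <= C * n (u, v).
Proof.
  induction 1 as [|q l [C [HC [e [He HB]]]] _ [C' [e' [HC' [He' IH]]]]].
  - exists 0, 1. split; [lra|]. split; [lra|]. intros q [].
  - exists (C + C'), (Rmin e e'). split; [lra|]. split; [now apply Rmin_glb_lt|].
    assert (N0 := n_nonneg).
    intros q' [<- | Hin] u v HT.
    + eapply Rle_trans; [apply HB; revert HT; apply (Teps_mono S HS), Rmin_l|].
      apply Rmult_le_compat_r; [apply N0 | lra].
    + eapply Rle_trans; [apply IH; [exact Hin|]; revert HT; apply (Teps_mono S HS), Rmin_r|].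
      apply Rmult_le_compat_r; [apply N0 | lra].
Qed.

(** A right hand side of the wave equations, evaluated on the solutions. *)
Let second (f : R -> R -> R -> R -> R -> R -> R -> R) (k : bool) (z : R * R) :=
  f (al k z) (be k z) (r k z) (tu k z) (tv k z) (au k z) (bv k z).

Let fal_v k := uncurry2 (pd2 T (f_al (X k))).
Let fbe_u k := uncurry2 (pd1 T (f_be (X k))).
Let fr_u k := uncurry2 (pd1 T (f_r (X k))).
Let fr_v k := uncurry2 (pd2 T (f_r (X k))).

(** All first derivatives of the unknowns, and the three mixed derivatives. *)
Let gradients_and_sources : list (bool -> R * R -> R) :=
  (tu :: tv :: au :: bv :: fal_v :: fbe_u :: fr_u :: fr_v ::
   second (t_uv S) :: second (al_uv S) :: second (be_uv S) :: nil)%list.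

Lemma pair_difference_bounds : List.Forall difference_bound gradients_and_sources.
Proof.
  destruct pair_lip_zeroth as (L1 & L2 & L3 & L4).
  destruct pair_lip_first as (L5 & L6 & L7 & L8).
  apply (lip_weight m n _ _ m_le_n) in L1. apply (lip_weight m n _ _ m_le_n) in L2.
  apply (lip_weight m n _ _ m_le_n) in L3. apply (lip_weight m n _ _ m_le_n) in L4.
  assert (Him0 := image_at_rest S HS). assert (Him := pair_image).
  assert (Hr0 : r0 S <> 0) by (apply Rgt_not_eq, (adm_r0 S HS)).
  assert (LA := lip_A S HS al be r _ _ _ Him Him0 L1 L2 Hr0 L4).
  assert (Lcin := lip_cin S HS al be _ _ Him Him0 L1 L2).
  assert (Lcout := lip_cout S HS al be _ _ Him Him0 L1 L2).
  assert (Hch : forall k, NC (fun z =>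
     cin_at S (al k z) (be k z) * tu k z = fr_u k z /\
     cout_at S (al k z) (be k z) * tv k z = fr_v k z /\
     A_at S (al k z) (be k z) (r k z) * tv k z = fal_v k z /\
     A_at S (al k z) (be k z) (r k z) * tu k z = fbe_u k z)).
  { intros k. apply (near_corner_sector S _ Heps). intros u v HT.
    destruct (solution_characteristics S _ _ _ (X k) (HX k) u v HT) as (E1 & E2 & E3 & E4).
    now repeat split; symmetry. }
  repeat apply List.Forall_cons; [.. | apply List.Forall_nil].
  - exact (lip_difference_bound _ _ L5).
  - exact (lip_difference_bound _ _ L6).
  - exact (lip_difference_bound _ _ L7).
  - exact (lip_difference_bound _ _ L8).
  - refine (lip_difference_bound _ _ (lip_ext _ _ _ _ (lip_mult _ _ _ _ LA L6))).
    intros k. generalize (Hch k). apply filter_imp. tauto.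
  - refine (lip_difference_bound _ _ (lip_ext _ _ _ _ (lip_mult _ _ _ _ LA L5))).
    intros k. generalize (Hch k). apply filter_imp. tauto.
  - refine (lip_difference_bound _ _ (lip_ext _ _ _ _ (lip_mult _ _ _ _ Lcin L5))).
    intros k. generalize (Hch k). apply filter_imp. tauto.
  - refine (lip_difference_bound _ _ (lip_ext _ _ _ _ (lip_mult _ _ _ _ Lcout L6))).
    intros k. generalize (Hch k). apply filter_imp. tauto.
  - exact (lip_difference_bound _ _ (lip_t_uv S HS al be r tu tv au bv _ _ _ _ _ _ _
      Him Him0 Hr0 L1 L2 L4 L5 L6 L7 L8)).
  - exact (lip_difference_bound _ _ (lip_al_uv S HS al be r tu tv au bv _ _ _ _ _ _ _
      Him Him0 Hr0 L1 L2 L4 L5 L6 L7 L8)).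
  - exact (lip_difference_bound _ _ (lip_be_uv S HS al be r tu tv au bv _ _ _ _ _ _ _
      Him Him0 Hr0 L1 L2 L4 L5 L6 L7 L8)).
Qed.

(** The two edge conditions, for the differences. *)
Lemma pair_edge_relations (i : side) :
  let sg := edge_slope S i in
  exists C, 0 <= C /\ forall e, 0 < e -> NE i (fun z =>
    Rabs (sg * (- eta0 S - V0 S i) * d tu z + (eta0 S - V0 S i) * d tv z)
      <= C * m z + e * n z /\
    Rabs (sg * J_al S i (beta0 S) (beta0 S) 0 (r0 S) * d au z
          + J_be S i (beta0 S) (beta0 S) 0 (r0 S) * d bv z)
      <= C * (Rabs (d tu z) + Rabs (d tv z)) + C * m z + e * n z).
Proof.
  intros sg.
  destruct pair_lip_zeroth as (L1 & L2 & L3 & L4).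
  destruct pair_lip_first as (L5 & L6 & L7 & L8).
  assert (HLE := near_edge_le S HS i). fold NC in HLE. fold (NE i) in HLE.
  apply (lip_filter_le _ _ _ _ HLE) in L1. apply (lip_filter_le _ _ _ _ HLE) in L2.
  apply (lip_filter_le _ _ _ _ HLE) in L3. apply (lip_filter_le _ _ _ _ HLE) in L4.
  apply (lip_filter_le _ _ _ _ HLE) in L5. apply (lip_filter_le _ _ _ _ HLE) in L6.
  apply (lip_filter_le _ _ _ _ HLE) in L7. apply (lip_filter_le _ _ _ _ HLE) in L8.
  assert (Him0 := image_at_rest S HS).
  assert (Him : forall k, NE i (fun z => RI_image S (al k z) (be k z)))
    by (intros k; apply HLE, pair_image).
  assert (Hr0 : r0 S <> 0) by (apply Rgt_not_eq, (adm_r0 S HS)).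
  assert (HD : forall k, NE i (fun z => Dom S i (t k z, r k z))).
  { intros k. apply (near_edge_param S HS _ Heps). intros s Hs.
    apply (edge_ahead S HS _ _ _ (X k) (HX k) i). simpl. lra. }
  assert (Hne : rho_of S (beta0 S) (beta0 S) <> rho_m0 S i).
  { rewrite (rho_of_at_rest S HS). assert (HH := density_jump_neq S HS i). lra. }
  assert (LA := lip_A S HS al be r _ _ _ Him Him0 L1 L2 Hr0 L4).
  assert (Lcin := lip_cin S HS al be _ _ Him Him0 L1 L2).
  assert (Lcout := lip_cout S HS al be _ _ Him Him0 L1 L2).
  assert (LV := lip_V S HS i al be t r _ _ Him Him0 HD L1 L2 L3 L4 Hne).
  assert (LJal := lip_J_al S HS i al be t r _ _ Him Him0 HD L1 L2 L3 L4).
  assert (LJbe := lip_J_be S HS i al be t r _ _ Him Him0 HD L1 L2 L3 L4).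
  assert (LJt := lip_J_t S HS i al be t r _ _ Him Him0 HD L1 L2 L3 L4).
  assert (LJr := lip_J_r S HS i al be t r _ _ Him Him0 HD L1 L2 L3 L4).
  destruct (speeds_at_rest S HS) as [E1 [E2 _]].
  rewrite E1 in Lcin. rewrite E2 in Lcout. rewrite (V_at_rest S HS) in LV.
  assert (Lsg : lip (NE i) m (fun _ _ => sg) sg) by apply lip_const.
  (* the shock moves with speed V *)
  destruct (principal_part_relation m n _ _
    (fun k => near_edge_param S HS _ Heps i _ (fun s Hs =>
       edge_boundary_relation S HS _ _ _ (X k) (HX k) i s Hs))
    (principal_part_plus m n _ _ _ _
      (principal_part_mult m n _ _ _ _ n_nonneg
         (lip_mult _ _ _ _ Lsg (lip_minus _ _ _ _ Lcin LV)) L5)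
      (principal_part_mult m n _ _ _ _ n_nonneg (lip_minus _ _ _ _ Lcout LV) L6)))
    as [C1 [HC1 R1]].
  (* the jump condition, differentiated along the edge *)
  destruct (Dom_strict_diff S HS i) as [tau [Htau Hstrict]].
  assert (Lctu := lip_mult _ _ _ _ Lsg (lip_plus _ _ _ _
    (lip_plus _ _ _ _ (lip_mult _ _ _ _ LJbe LA) LJt) (lip_mult _ _ _ _ LJr Lcin))).
  assert (Lctv := lip_plus _ _ _ _
    (lip_plus _ _ _ _ (lip_mult _ _ _ _ LJal LA) LJt) (lip_mult _ _ _ _ LJr Lcout)).
  set (ctu := sg * (_ + _ + _ * - eta0 S)) in Lctu.
  set (ctv := _ + _ + _ * eta0 S) in Lctv.
  assert (Hrel : forall k, NE i (fun z =>
     sg * (J_be S i (al k z) (be k z) (t k z) (r k z) * A_at S (al k z) (be k z) (r k z)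
           + J_t S i (al k z) (be k z) (t k z) (r k z)
           + J_r S i (al k z) (be k z) (t k z) (r k z) * cin_at S (al k z) (be k z)) * tu k z
     + (J_al S i (al k z) (be k z) (t k z) (r k z) * A_at S (al k z) (be k z) (r k z)
           + J_t S i (al k z) (be k z) (t k z) (r k z)
           + J_r S i (al k z) (be k z) (t k z) (r k z) * cout_at S (al k z) (be k z)) * tv k z
     + sg * J_al S i (al k z) (be k z) (t k z) (r k z) * au k z
     + J_be S i (al k z) (be k z) (t k z) (r k z) * bv k z = 0)).
  { intros k.
    assert (Ht : NE i (fun z => t k z < tau)).
    { generalize (proj1 (filterlim_locally_eps (NE i) _ _) (proj1 L3 k) tau Htau).
      apply filter_imp. intros z Hz. apply Rabs_lt_between in Hz. lra. }
    assert (Hz : NE i (fun z => 0 < snd z < a * eps /\ z = (sg * snd z, snd z))).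
    { apply (near_edge_param S HS _ Heps). intros s Hs. simpl. now split. }
    generalize (filter_and _ _ Ht Hz). apply filter_imp. intros z [H1 [H2 H3]].
    rewrite H3 in H1 |- *.
    exact (edge_jump_relation S HS _ _ _ (X k) (HX k) i tau (snd z) H2 Hstrict H1). }
  destruct (principal_part_relation m n _ _ Hrel
    (principal_part_plus m n _ _ _ _
      (principal_part_plus m n _ _ _ _
        (principal_part_plus m n _ _ _ _
          (principal_part_mult m n _ _ _ _ n_nonneg Lctu L5)
          (principal_part_mult m n _ _ _ _ n_nonneg Lctv L6))
        (principal_part_mult m n _ _ _ _ n_nonneg (lip_mult _ _ _ _ Lsg LJal) L7))
      (principal_part_mult m n _ _ _ _ n_nonneg LJbe L8)))
    as [C2 [HC2 R2]].
  assert (P1 := Rabs_pos ctu). assert (P2 := Rabs_pos ctv).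
  exists (C1 + C2 + Rabs ctu + Rabs ctv). split; [lra|]. intros e He.
  generalize (filter_and _ _ (R1 e He) (R2 e He)). apply filter_imp. intros z [B1 B2].
  assert (Hm := m_nonneg z).
  assert (Q1 := Rabs_pos (d tu z)). assert (Q2 := Rabs_pos (d tv z)).
  assert (K1 : 0 <= Rabs ctu * m z) by now apply Rmult_le_pos.
  assert (K2 : 0 <= Rabs ctv * m z) by now apply Rmult_le_pos.
  assert (K3 : 0 <= C1 * m z) by now apply Rmult_le_pos.
  assert (K4 : 0 <= C2 * m z) by now apply Rmult_le_pos.
  split.
  - cbv beta in B1. fold (d tu z) (d tv z) in B1.
    eapply Rle_trans; [exact B1|]. lra.
  - cbv beta in B2. fold (d tu z) (d tv z) (d au z) (d bv z) in B2.
    set (x := sg * J_al S i (beta0 S) (beta0 S) 0 (r0 S) * d au z) in *.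
    set (y := J_be S i (beta0 S) (beta0 S) 0 (r0 S) * d bv z) in *.
    replace (x + y) with ((ctu * d tu z + ctv * d tv z + x + y)
      + (- (ctu * d tu z) + - (ctv * d tv z))) by ring.
    eapply Rle_trans; [apply Rabs_triang|].
    eapply Rle_trans; [apply Rplus_le_compat; [exact B2 | apply Rabs_triang]|].
    rewrite !Rabs_Ropp, !Rabs_mult.
    assert (K5 : 0 <= (C1 + C2 + Rabs ctv) * Rabs (d tu z)) by (apply Rmult_le_pos; lra).
    assert (K6 : 0 <= (C1 + C2 + Rabs ctu) * Rabs (d tv z)) by (apply Rmult_le_pos; lra).
    lra.
Qed.

Lemma continuous_along_curve (g : bool -> R -> R -> R) (x y : R -> R) (p q : R) :
  (forall k, continuous_on T (uncurry2 (g k))) ->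
  (forall s, p <= s <= q -> T (x s, y s)) ->
  (forall s s', Rabs (x s' - x s) <= Rabs (s' - s)) ->
  (forall s s', Rabs (y s' - y s) <= Rabs (s' - s)) ->
  forall s e, p <= s <= q -> 0 < e -> exists dl, 0 < dl /\
    forall s', p <= s' <= q -> Rabs (s' - s) < dl ->
    Rabs (g true (x s') (y s') - g false (x s') (y s')
          - (g true (x s) (y s) - g false (x s) (y s))) < e.
Proof.
  intros Hg HT Hx Hy s e Hs He.
  destruct (continuous_on_eps _ _ _ _ (e / 2) (Hg true) (HT s Hs) ltac:(lra)) as [d1 [Hd1 C1]].
  destruct (continuous_on_eps _ _ _ _ (e / 2) (Hg false) (HT s Hs) ltac:(lra)) as [d2 [Hd2 C2]].
  exists (Rmin d1 d2). split; [now apply Rmin_glb_lt|]. intros s' Hs' Hss.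
  assert (M1 := Rmin_l d1 d2). assert (M2 := Rmin_r d1 d2).
  specialize (Hx s s'). specialize (Hy s s').
  specialize (C1 _ _ (HT s' Hs') ltac:(lra) ltac:(lra)).
  specialize (C2 _ _ (HT s' Hs') ltac:(lra) ltac:(lra)).
  apply Rabs_lt_between in C1. apply Rabs_lt_between in C2. apply Rabs_lt_between. lra.
Qed.

Section Transport.
Context (e0 : R) (He0 : 0 < e0 < eps).

Lemma small_sector_interior (u v : R) :
  0 < u -> u < v -> a * v < u -> u <= a * e0 -> locally (u, v) T.
Proof.
  intros H1 H2 H3 H4. assert (Ha := acst_bounds S HS). fold a in Ha.
  apply Teps_interior; try lra.
  assert (a * e0 < a * eps) by (apply Rmult_lt_compat_l; lra). lra.
Qed.

Lemma small_sector_in_T (u v : R) : Teps a e0 (u, v) -> T (u, v).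
Proof. apply (Teps_mono S HS). lra. Qed.

Lemma vertical_transport (g : bool -> R -> R -> R) (g' : bool -> R * R -> R) (u v M : R) :
  (forall k, continuous_on T (uncurry2 (g k))) ->
  (forall k u v, locally (u, v) T -> is_derive (fun s => g k u s) v (g' k (u, v))) ->
  Teps a e0 (u, v) -> 0 < u ->
  (forall s, u <= s <= v -> Rabs (d g' (u, s)) <= M) ->
  Rabs (g true u v - g false u v - (g true u u - g false u u)) <= M * (v - u).
Proof.
  intros Hg Hg' HT Hu HM. destruct (Teps_range S HS _ _ _ HT) as (R1 & R2 & R3). fold a in R2.
  assert (Ha := acst_bounds S HS). fold a in Ha.
  apply (mean_value_bound_on (fun s => g true u s - g false u s) (fun s => d g' (u, s))).
  - lra.
  - intros s Hs. apply (is_derive_minus (V := R_NormedModule)); apply Hg';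
      (apply small_sector_interior; try lra;
       assert (a * s < a * v) by (apply Rmult_lt_compat_l; lra); lra).
  - apply (continuous_along_curve g (fun _ => u) (fun s => s) u v Hg).
    + intros s Hs. apply small_sector_in_T, Teps_iff; [lra|].
      assert (a * s <= a * v) by (apply Rmult_le_compat_l; lra). lra.
    + intros s s'. rewrite Rminus_diag, Rabs_R0. apply Rabs_pos.
    + intros s s'. apply Rle_refl.
  - intros s Hs. apply HM. lra.
Qed.

Lemma horizontal_transport (g : bool -> R -> R -> R) (g' : bool -> R * R -> R) (u v M : R) :
  (forall k, continuous_on T (uncurry2 (g k))) ->
  (forall k u v, locally (u, v) T -> is_derive (fun s => g k s v) u (g' k (u, v))) ->
  Teps a e0 (u, v) -> 0 < u ->
  (forall s, a * v <= s <= u -> Rabs (d g' (s, v)) <= M) ->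
  Rabs (g true u v - g false u v - (g true (a * v) v - g false (a * v) v)) <= M * (u - a * v).
Proof.
  intros Hg Hg' HT Hu HM. destruct (Teps_range S HS _ _ _ HT) as (R1 & R2 & R3). fold a in R2.
  assert (Ha := acst_bounds S HS). fold a in Ha.
  assert (Hav : 0 < a * v) by (apply Rmult_lt_0_compat; lra).
  apply (mean_value_bound_on (fun s => g true s v - g false s v) (fun s => d g' (s, v))).
  - lra.
  - intros s Hs. apply (is_derive_minus (V := R_NormedModule)); apply Hg';
      apply small_sector_interior; lra.
  - apply (continuous_along_curve g (fun s => s) (fun _ => v) (a * v) u Hg).
    + intros s Hs. apply small_sector_in_T, Teps_iff; lra.
    + intros s s'. apply Rle_refl.
    + intros s s'. rewrite Rminus_diag, Rabs_R0. apply Rabs_pos.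
  - intros s Hs. apply HM. lra.
Qed.

(** Along the edge [u = v] from the corner, then along a vertical characteristic. *)
Lemma gradient_integral_bound (g : bool -> R -> R -> R) (u v M : R) :
  (forall k, Ck 1 T (g k)) -> g true 0 0 = g false 0 0 ->
  Teps a e0 (u, v) -> 0 < u ->
  (forall u' v', Teps a e0 (u', v') -> u' <= u -> v' <= v ->
     Rabs (d (fun k => uncurry2 (pd1 T (g k))) (u', v')) <= M /\
     Rabs (d (fun k => uncurry2 (pd2 T (g k))) (u', v')) <= M) ->
  Rabs (g true u v - g false u v) <= 2 * M * v.
Proof.
  intros Hg H0 HT Hu HM. destruct (Teps_range S HS _ _ _ HT) as (R1 & R2 & R3). fold a in R2.
  assert (Ha := acst_bounds S HS). fold a in Ha.
  assert (Hgc : forall k, continuous_on T (uncurry2 (g k)))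
    by (intros k; exact (Ck_continuous_on _ _ _ (Hg k))).
  assert (Hdiag : forall s, 0 <= s <= u -> Teps a e0 (s, s)).
  { intros s Hs. apply Teps_iff; [lra|].
    assert (a * s <= 1 * s) by (apply Rmult_le_compat_r; lra). lra. }
  assert (HM0 : 0 <= M).
  { eapply Rle_trans; [apply Rabs_pos | apply (HM u v HT); lra]. }
  assert (HE : a * e0 < a * eps) by (apply Rmult_lt_compat_l; lra).
  assert (B1 : Rabs (g true u u - g false u u - (g true 0 0 - g false 0 0)) <= 2 * M * (u - 0)).
  { apply (mean_value_bound_on (fun s => g true s s - g false s s)
      (fun s => (pd1 T (g true) s s + pd2 T (g true) s s)
                - (pd1 T (g false) s s + pd2 T (g false) s s))).
    - lra.
    - intros s Hs.
      assert (Hk : forall k, is_derive (fun s => g k s s) s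
                 (pd1 T (g k) s s + pd2 T (g k) s s)).
      { intros k. assert (HD := is_derive_edge S HS eps Lft (g k) s (Hg k) ltac:(fold a; lra)).
        simpl edge_slope in HD. fold a T in HD. rewrite !Rmult_1_l in HD.
        apply is_derive_ext with (2 := HD). intros s'. now rewrite Rmult_1_l. }
      apply (is_derive_minus (V := R_NormedModule)); apply Hk.
    - apply (continuous_along_curve g (fun s => s) (fun s => s) 0 u Hgc).
      + intros s Hs. now apply small_sector_in_T, Hdiag.
      + intros s s'. apply Rle_refl.
      + intros s s'. apply Rle_refl.
    - intros s Hs. destruct (HM s s (Hdiag s ltac:(lra)) ltac:(lra) ltac:(lra)) as [M1 M2].
      unfold d, uncurry2 in M1, M2. simpl in M1, M2.
      apply Rabs_le_between in M1. apply Rabs_le_between in M2. apply Rabs_le_between. lra. }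
  assert (B2 : Rabs (g true u v - g false u v - (g true u u - g false u u)) <= M * (v - u)).
  { apply (vertical_transport g (fun k => uncurry2 (pd2 T (g k)))); try assumption.
    - intros k u' v' HT'. destruct (Ck_pd _ _ _ (Hg k)) as [_ [_ [P2 _]]]. now apply P2.
    - intros s Hs. apply HM; [|lra|lra]. apply Teps_iff; [lra|].
      assert (a * s <= a * v) by (apply Rmult_le_compat_l; lra). lra. }
  rewrite H0 in B1. apply Rabs_le_between in B1. apply Rabs_le_between in B2.
  apply Rabs_le_between.
  assert (0 <= M * (v - u)) by (apply Rmult_le_pos; lra). lra.
Qed.
End Transport.

(** The quantities that enter [n]. *)
Let initial_unknowns : list (bool -> R -> R -> R) :=
  ((fun k => pd1 T (f_t (X k))) :: (fun k => pd2 T (f_t (X k))) ::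
   (fun k => pd1 T (f_al (X k))) :: (fun k => pd2 T (f_be (X k))) ::
   (fun k => f_al (X k)) :: (fun k => f_be (X k)) ::
   (fun k => f_t (X k)) :: (fun k => f_r (X k)) :: nil)%list.

Lemma unknowns_agree_at_corner : List.Forall
  (fun g => (forall k, Ck 1 T (g k)) /\ g true 0 0 = g false 0 0) initial_unknowns.
Proof.
  destruct (pair_corner_values true) as (E1 & E2 & E3 & E4).
  destruct (pair_corner_values false) as (E1' & E2' & E3' & E4').
  repeat apply List.Forall_cons; [.. | apply List.Forall_nil]; (split; [|try lra]).
  - exact Ck_tu.
  - exact Ck_tv.
  - exact Ck_au.
  - exact Ck_bv.
  - intros k. exact (Ck_pred _ _ _ (si_C2_al _ _ _ _ _ (HX k))).
  - now rewrite !(si_al0 _ _ _ _ _ (HX _)).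
  - intros k. exact (Ck_pred _ _ _ (si_C2_be _ _ _ _ _ (HX k))).
  - now rewrite !(si_be0 _ _ _ _ _ (HX _)).
  - intros k. exact (Ck_pred _ _ _ (si_C2_t _ _ _ _ _ (HX k))).
  - now rewrite !(si_t0 _ _ _ _ _ (HX _)).
  - intros k. exact (Ck_pred _ _ _ (si_C2_r _ _ _ _ _ (HX k))).
  - now rewrite !(si_r0 _ _ _ _ _ (HX _)).
Qed.

Lemma pair_initial_bound : exists Q e, 0 <= Q /\ 0 < e /\
  forall g, List.In g initial_unknowns -> forall u v, Teps a e (u, v) ->
    Rabs (d (fun k => uncurry2 (g k)) (u, v)) <= Q * u.
Proof.
  induction unknowns_agree_at_corner as [|g l [Hg H0] _ [Q [e [HQ [He IH]]]]].
  - exists 0, 1. split; [lra|]. split; [lra|]. intros q [].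
  - destruct (corner_lipschitz S HS eps _ Heps (Hg true)) as [L1 [e1 [HL1 [He1 B1]]]].
    destruct (corner_lipschitz S HS eps _ Heps (Hg false)) as [L2 [e2 [HL2 [He2 B2]]]].
    exists (L1 + L2 + Q), (Rmin e (Rmin e1 e2)). split; [lra|].
    split; [now repeat apply Rmin_glb_lt|].
    intros g' Hin u v HT.
    assert (HT' := Teps_mono S HS _ _ _ _ (Rmin_r _ _) HT).
    specialize (B1 u v (Teps_mono S HS _ _ _ _ (Rmin_l _ _) HT')).
    specialize (B2 u v (Teps_mono S HS _ _ _ _ (Rmin_r _ _) HT')).
    destruct (Teps_range S HS _ _ _ HT) as (R1 & _).
    assert (K1 : 0 <= Q * u) by (apply Rmult_le_pos; lra).
    assert (K2 : 0 <= L1 * u) by (apply Rmult_le_pos; lra).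
    assert (K3 : 0 <= L2 * u) by (apply Rmult_le_pos; lra).
    destruct Hin as [<- | Hin].
    + unfold d, uncurry2; simpl. apply Rabs_le_between in B1. apply Rabs_le_between in B2.
      apply Rabs_le_between. lra.
    + assert (IH' := IH g' Hin u v (Teps_mono S HS _ _ _ _ (Rmin_l _ _) HT)). lra.
Qed.

(** Minus the constant [Gamma0]. *)
Let gam := (eta0 S + V0 S Lft) / (eta0 S - V0 S Lft).

Lemma J_factor_neq (i : side) : (rho0 S - rho_m0 S i) * rho0 S / (2 * eta0 S) <> 0.
Proof.
  assert (He := eta0_pos S HS). assert (Hr := adm_rho0 S HS).
  assert (Hne := density_jump_neq S HS i).
  unfold Rdiv. apply Rmult_integral_contrapositive_currified.
  - apply Rmult_integral_contrapositive_currified; lra.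
  - apply Rinv_neq_0_compat. lra.
Qed.

(** The edge relations, solved for the unknowns that leave the edge. *)
Lemma solve_edge_relations (i : side) (x1 x2 y1 y2 : bool -> R * R -> R)
    (c1 c2 c3 c4 b1 b2 C : R) :
  0 <= C -> c1 <> 0 -> c3 <> 0 -> Rabs (c2 / c1) <= b1 -> Rabs (c4 / c3) <= b2 ->
  (forall e, 0 < e -> NE i (fun z =>
     Rabs (c1 * d x1 z + c2 * d x2 z) <= C * m z + e * n z /\
     Rabs (c3 * d y1 z + c4 * d y2 z)
       <= C * (Rabs (d tu z) + Rabs (d tv z)) + C * m z + e * n z)) ->
  exists C', 0 <= C' /\ forall e, 0 < e -> NE i (fun z =>
    Rabs (d x1 z) <= b1 * Rabs (d x2 z) + C' * m z + e * n z /\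
    Rabs (d y1 z) <= b2 * Rabs (d y2 z) + C' * (Rabs (d tu z) + Rabs (d tv z))
                     + C' * m z + e * n z).
Proof.
  intros HC Hc1 Hc3 Hb1 Hb2 HR.
  assert (I1 := Rinv_0_lt_compat _ (Rabs_pos_lt c1 Hc1)).
  assert (I3 := Rinv_0_lt_compat _ (Rabs_pos_lt c3 Hc3)).
  exists ((/ Rabs c1 + / Rabs c3) * C). split; [apply Rmult_le_pos; lra|].
  intros e Hep.
  set (e' := e / (/ Rabs c1 + / Rabs c3)).
  assert (He' : 0 < e') by (apply Rdiv_lt_0_compat; lra).
  assert (Ee : (/ Rabs c1 + / Rabs c3) * e' = e).
  { unfold e'. set (y := / Rabs c1 + / Rabs c3) in *. field. unfold y. lra. }
  generalize (HR e' He'). apply filter_imp. intros z [B1 B2].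
  assert (Hm := m_nonneg z). assert (Hn := n_nonneg z).
  assert (Q1 := Rabs_pos (d tu z)). assert (Q2 := Rabs_pos (d tv z)).
  assert (G1 : 0 <= C * m z) by now apply Rmult_le_pos.
  assert (G2 : 0 <= e' * n z) by (apply Rmult_le_pos; lra).
  assert (G3 : 0 <= C * (Rabs (d tu z) + Rabs (d tv z))) by (apply Rmult_le_pos; lra).
  rewrite <- (Rplus_0_r (c1 * _ + _)) in B1. rewrite <- (Rplus_0_r (c3 * _ + _)) in B2.
  apply solve_linear_bound in B1; [|exact Hc1].
  apply solve_linear_bound in B2; [|exact Hc3].
  rewrite Rabs_R0 in B1, B2. rewrite <- Ee.
  apply (Rmult_le_compat_r _ _ _ (Rabs_pos (d x2 z))) in Hb1.
  apply (Rmult_le_compat_r _ _ _ (Rabs_pos (d y2 z))) in Hb2.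
  assert (F1 : 0 <= / Rabs c3 * (C * m z + e' * n z)) by (apply Rmult_le_pos; lra).
  assert (F2 : 0 <= / Rabs c1 * (C * (Rabs (d tu z) + Rabs (d tv z)) + C * m z + e' * n z))
    by (apply Rmult_le_pos; lra).
  split; lra.
Qed.

Lemma left_edge_bounds : exists C, 0 <= C /\ forall e, 0 < e -> NE Lft (fun z =>
  Rabs (d tu z) <= / gam * Rabs (d tv z) + C * m z + e * n z /\
  Rabs (d au z) <= gam ^ 2 * Rabs (d bv z) + C * (Rabs (d tu z) + Rabs (d tv z))
                   + C * m z + e * n z).
Proof.
  assert (He := eta0_pos S HS). assert (HV := shock_speeds_bounds S HS).
  destruct (J_derivatives_at_rest S HS Lft) as [EJa EJb].
  assert (Hk := J_factor_neq Lft).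
  set (k := (rho0 S - rho_m0 S Lft) * rho0 S / (2 * eta0 S)) in *.
  destruct (pair_edge_relations Lft) as [C [HC HR]].
  apply solve_edge_relations with (6 := HR); simpl edge_slope; rewrite ?EJa, ?EJb, ?Rmult_1_l.
  - exact HC.
  - lra.
  - apply Rmult_integral_contrapositive_currified; [lra|]. apply pow_nonzero. lra.
  - replace ((eta0 S - V0 S Lft) / (- eta0 S - V0 S Lft)) with (- / gam)
      by (unfold gam; field; lra).
    rewrite Rabs_Ropp, Rabs_pos_eq; [lra|].
    apply Rlt_le, Rinv_0_lt_compat. unfold gam. apply Rdiv_lt_0_compat; lra.
  - replace (- k * (eta0 S + V0 S Lft) ^ 2 / (- k * (eta0 S - V0 S Lft) ^ 2))
      with (gam ^ 2) by (unfold gam; field; repeat split; lra).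
    rewrite Rabs_pos_eq; [lra | apply pow2_ge_0].
Qed.

Lemma right_edge_bounds : exists C, 0 <= C /\ forall e, 0 < e -> NE Rgt (fun z =>
  Rabs (d tv z) <= gam * Rabs (d tu z) + C * m z + e * n z /\
  Rabs (d bv z) <= a * Rabs (d au z) + C * (Rabs (d tu z) + Rabs (d tv z))
                   + C * m z + e * n z).
Proof.
  assert (He := eta0_pos S HS). assert (HV := shock_speeds_bounds S HS).
  assert (Ha := acst_bounds S HS). fold a in Ha.
  destruct (J_derivatives_at_rest S HS Rgt) as [EJa EJb].
  assert (Hk := J_factor_neq Rgt).
  set (k := (rho0 S - rho_m0 S Rgt) * rho0 S / (2 * eta0 S)) in *.
  destruct (pair_edge_relations Rgt) as [C [HC HR]]. simpl edge_slope in HR. fold a in HR.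
  apply (solve_edge_relations Rgt tv tu bv au
    (eta0 S - V0 S Rgt) (a * (- eta0 S - V0 S Rgt))
    (J_be S Rgt (beta0 S) (beta0 S) 0 (r0 S)) (a * J_al S Rgt (beta0 S) (beta0 S) 0 (r0 S))
    gam a C); rewrite ?EJa, ?EJb.
  - exact HC.
  - lra.
  - apply Rmult_integral_contrapositive_currified; [lra|]. apply pow_nonzero. lra.
  - replace (a * (- eta0 S - V0 S Rgt) / (eta0 S - V0 S Rgt)) with (- gam).
    + rewrite Rabs_Ropp, Rabs_pos_eq; [lra|].
      apply Rlt_le. unfold gam. apply Rdiv_lt_0_compat; lra.
    + unfold gam, a, acst. field. repeat split; lra.
  - assert (HL := ratio_lt_1 (eta0 S - V0 S Rgt) (eta0 S + V0 S Rgt) ltac:(lra)).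
    set (q := (eta0 S - V0 S Rgt) / (eta0 S + V0 S Rgt)) in *.
    replace (a * (- k * (eta0 S - V0 S Rgt) ^ 2) / (- k * (eta0 S + V0 S Rgt) ^ 2))
      with (a * q ^ 2) by (unfold q; field; repeat split; lra).
    assert (Hq : 0 <= q ^ 2 <= 1)
      by (split; [apply pow2_ge_0 |]; rewrite <- (pow1 2); apply pow_incr; lra).
    rewrite Rabs_pos_eq by (apply Rmult_le_pos; lra).
    rewrite <- (Rmult_1_r a) at 2. apply Rmult_le_compat_l; lra.
  - intros e Hep. generalize (HR e Hep). apply filter_imp. intros z [B1 B2].
    rewrite (Rplus_comm (a * _ * _)) in B1. rewrite EJa, EJb, (Rplus_comm (a * _ * _)) in B2.
    now split.
Qed.

Lemma solutions_coincide_near_corner : exists e, 0 < e <= eps /\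
  forall u v, Teps a e (u, v) ->
    f_al (X true) u v = f_al (X false) u v /\ f_be (X true) u v = f_be (X false) u v /\
    f_t (X true) u v = f_t (X false) u v /\ f_r (X true) u v = f_r (X false) u v.
Proof.
  assert (Ha := acst_bounds S HS). fold a in Ha.
  assert (He := eta0_pos S HS). assert (HV := shock_speeds_bounds S HS).
  assert (Hgam : 0 < gam < 1) by (apply ratio_lt_1; lra).
  destruct (difference_bound_and _ pair_difference_bounds) as [Cd [ed [HCd [Hed HD]]]].
  destruct pair_initial_bound as [Q0 [ei [HQ0 [Hei HI]]]].
  destruct left_edge_bounds as [Cl [HCl HL]].
  destruct right_edge_bounds as [Cr [HCr HR]].
  set (e0 := Rmin (eps / 2) (Rmin ed ei)).
  assert (He0 : 0 < e0) by (unfold e0; repeat apply Rmin_glb_lt; lra).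
  assert (M1 : e0 <= eps / 2) by apply Rmin_l.
  assert (M2 : e0 <= ed) by (unfold e0; eapply Rle_trans; [apply Rmin_r | apply Rmin_l]).
  assert (M3 : e0 <= ei) by (unfold e0; eapply Rle_trans; [apply Rmin_r | apply Rmin_r]).
  assert (He0' : 0 < e0 < eps) by lra.
  set (C := 2 * Cd + Cl + Cr).
  assert (HC : 0 <= C) by (unfold C; lra).
  assert (HD0 : forall q, List.In q gradients_and_sources -> forall u v M, Teps a e0 (u, v) -> n (u, v) <= M ->
     Rabs (d q (u, v)) <= Cd * M).
  { intros q Hq u v M HT HM. eapply Rle_trans.
    - apply (HD q Hq). revert HT. now apply (Teps_mono S HS).
    - now apply Rmult_le_compat_l. }
  assert (HM0 : forall u v M, n (u, v) <= M -> 0 <= M)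
    by (intros u v M HM; eapply Rle_trans; [apply (n_nonneg (u, v)) | exact HM]).
  assert (HCM : forall M x, 0 <= M -> 0 <= x -> Cd * M * x <= C * M * x /\ 2 * (Cd * M) * x <= C * M * x).
  { intros M x HM Hx. assert (0 <= M * x) by now apply Rmult_le_pos.
    assert (0 <= Cd * (M * x)) by now apply Rmult_le_pos.
    assert (0 <= Cl * (M * x)) by now apply Rmult_le_pos.
    assert (0 <= Cr * (M * x)) by now apply Rmult_le_pos. unfold C. split; lra. }
  assert (HW := fun k u v HT => solution_wave_equations S HS _ _ _ (X k) (HX k) u v HT).
  destruct (contraction_vanishing a gam e0 C Q0 Ha Hgam He0 HC HQ0
    (fun u v => d al (u, v)) (fun u v => d be (u, v)) (fun u v => d t (u, v))
    (fun u v => d r (u, v)) (fun u v => d tu (u, v)) (fun u v => d tv (u, v))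
    (fun u v => d au (u, v)) (fun u v => d bv (u, v))) as [e1 [He1 Hfin]].
  - (* dt/du and dalpha/du on a line of constant u, by the wave equations *)
    intros u v M HT Hu HM. destruct (Teps_range S HS _ _ _ HT) as (R1 & R2 & R3). fold a in R2.
    assert (HMp := HM0 u u M (HM u ltac:(lra))).
    assert (HTs : forall s, u <= s <= v -> Teps a e0 (u, s)).
    { intros s Hs. apply Teps_iff; [lra|].
      assert (a * s <= a * v) by (apply Rmult_le_compat_l; lra). lra. }
    split; (eapply Rle_trans; [|exact (proj1 (HCM M (v - u) HMp ltac:(lra)))]).
    + apply (vertical_transport e0 He0' (fun k => pd1 T (f_t (X k))) (second (t_uv S)));
        try assumption.
      * intros k. exact (Ck_continuous_on _ _ _ (Ck_tu k)).
      * intros k u' v' HT'. destruct (HW k u' v' HT') as (W1 & W2 & W3 & W4). exact W1.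
      * intros s Hs. apply HD0; [|now apply HTs | now apply HM]. simpl; tauto.
    + apply (vertical_transport e0 He0' (fun k => pd1 T (f_al (X k))) (second (al_uv S)));
        try assumption.
      * intros k. exact (Ck_continuous_on _ _ _ (Ck_au k)).
      * intros k u' v' HT'. destruct (HW k u' v' HT') as (W1 & W2 & W3 & W4). exact W3.
      * intros s Hs. apply HD0; [|now apply HTs | now apply HM]. simpl; tauto.
  - (* dt/dv and dbeta/dv on a line of constant v, by the wave equations *)
    intros u v M HT Hu HM. destruct (Teps_range S HS _ _ _ HT) as (R1 & R2 & R3). fold a in R2.
    assert (HMp := HM0 u v M (HM u ltac:(lra))).
    assert (Hav : 0 <= a * v) by (apply Rmult_le_pos; lra).
    assert (HTs : forall s, a * v <= s <= u -> Teps a e0 (s, v))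
      by (intros s Hs; apply Teps_iff; lra).
    split; (eapply Rle_trans; [|exact (proj1 (HCM M (u - a * v) HMp ltac:(lra)))]).
    + apply (horizontal_transport e0 He0' (fun k => pd2 T (f_t (X k))) (second (t_uv S)));
        try assumption.
      * intros k. exact (Ck_continuous_on _ _ _ (Ck_tv k)).
      * intros k u' v' HT'. destruct (HW k u' v' HT') as (W1 & W2 & W3 & W4). exact W2.
      * intros s Hs. apply HD0; [|now apply HTs | now apply HM]. simpl; tauto.
    + apply (horizontal_transport e0 He0' (fun k => pd2 T (f_be (X k))) (second (be_uv S)));
        try assumption.
      * intros k. exact (Ck_continuous_on _ _ _ (Ck_bv k)).
      * intros k u' v' HT'. destruct (HW k u' v' HT') as (W1 & W2 & W3 & W4). exact W4.
      * intros s Hs. apply HD0; [|now apply HTs | now apply HM]. simpl; tauto.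
  - (* the unknowns, which agree at the corner, from their gradients *)
    intros u v M HT Hu HM. destruct (Teps_range S HS _ _ _ HT) as (R1 & R2 & R3). fold a in R2.
    assert (HMp := HM0 u v M (HM u v HT ltac:(lra) ltac:(lra))).
    assert (HCMv := proj2 (HCM M v HMp ltac:(lra))).
    assert (HG : forall g : bool -> R -> R -> R, List.In g initial_unknowns ->
      List.In (fun k => uncurry2 (pd1 T (g k))) gradients_and_sources ->
      List.In (fun k => uncurry2 (pd2 T (g k))) gradients_and_sources ->
      Rabs (g true u v - g false u v) <= C * M * v).
    { intros g Hg G1 G2.
      destruct (proj1 (List.Forall_forall _ _) unknowns_agree_at_corner g Hg) as [K1 K2].
      eapply Rle_trans; [|exact HCMv].
      apply (gradient_integral_bound e0 He0' g); try assumption.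
      intros u' v' HT' Hu' Hv'. assert (HMz := HM u' v' HT' Hu' Hv').
      split; now apply HD0. }
    split; [|split; [|split]];
      [apply (HG (fun k => f_al (X k))) | apply (HG (fun k => f_be (X k))) |
       apply (HG (fun k => f_t (X k))) | apply (HG (fun k => f_r (X k)))]; simpl; tauto.
  - intros e Hep. destruct (HL e Hep) as [e1 [He1 HB]]. exists e1. split; [exact He1|].
    intros s Hs. specialize (HB s Hs). simpl edge_slope in HB. rewrite Rmult_1_l in HB.
    assert (Hm := m_nonneg (s, s)).
    assert (Q1 := Rabs_pos (d tu (s, s))). assert (Q2 := Rabs_pos (d tv (s, s))).
    assert (G1 : 0 <= (2 * Cd + Cr) * m (s, s)) by (apply Rmult_le_pos; lra).
    assert (G2 : 0 <= (2 * Cd + Cr) * (Rabs (d tu (s, s)) + Rabs (d tv (s, s))))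
      by (apply Rmult_le_pos; lra).
    destruct HB as [B1 B2]. split.
    + eapply Rle_trans; [exact B1|]. fold (m (s, s)). fold (n (s, s)). unfold C. lra.
    + eapply Rle_trans; [exact B2|]. fold (m (s, s)). fold (n (s, s)). unfold C. lra.
  - intros e Hep. destruct (HR e Hep) as [e1 [He1 HB]]. exists e1. split; [exact He1|].
    intros s Hs. specialize (HB s Hs). simpl edge_slope in HB. fold a in HB.
    assert (Hm := m_nonneg (a * s, s)).
    assert (Q1 := Rabs_pos (d tu (a * s, s))). assert (Q2 := Rabs_pos (d tv (a * s, s))).
    assert (G1 : 0 <= (2 * Cd + Cl) * m (a * s, s)) by (apply Rmult_le_pos; lra).
    assert (G2 : 0 <= (2 * Cd + Cl) * (Rabs (d tu (a * s, s)) + Rabs (d tv (a * s, s))))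
      by (apply Rmult_le_pos; lra).
    destruct HB as [B1 B2]. split.
    + eapply Rle_trans; [exact B1|]. fold (m (a * s, s)). fold (n (a * s, s)). unfold C. lra.
    + eapply Rle_trans; [exact B2|]. fold (m (a * s, s)). fold (n (a * s, s)). unfold C. lra.
  - intros u v HT. destruct (Teps_range S HS _ _ _ HT) as (R1 & _).
    assert (HT' := Teps_mono S HS _ _ _ _ M3 HT).
    assert (Hv : Q0 * u <= Q0 * v) by (apply Rmult_le_compat_l; lra).
    repeat split; (eapply Rle_trans;
      [refine (HI _ _ u v HT'); simpl; tauto | lra]).
  - exists e1. split; [lra|]. intros u v HT.
    destruct (Hfin u v HT) as (F1 & F2 & F3 & F4).
    unfold d, al, be, t, r, uncurry2 in F1, F2, F3, F4. simpl in F1, F2, F3, F4.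
    repeat split; lra.
Qed.
End TwoSolutions.

Theorem theorem2 (S : setting) (HS : admissible S)
    (H : side -> R -> R -> R -> R) (HH : forall i, solves_jump S i (H i))
    (al0' be0' : R) (Hslopes : corner_slopes S H al0' be0')
    (epsbar : R) (Hepsbar : 0 < epsbar)
    (X1 X2 : fields)
    (HX1 : shock_interaction S al0' be0' epsbar X1)
    (HX2 : shock_interaction S al0' be0' epsbar X2) :
  exists eps0 : R, 0 < eps0 <= epsbar /\
    forall eps : R, 0 < eps <= eps0 ->
      forall u v : R, Teps (acst S) eps (u, v) ->
        f_al X1 u v = f_al X2 u v /\
        f_be X1 u v = f_be X2 u v /\
        f_t X1 u v = f_t X2 u v /\
        f_r X1 u v = f_r X2 u v.
Proof.
  destruct (solutions_coincide_near_corner S HS al0' be0' epsbar Hepsbar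
    (fun k : bool => if k then X1 else X2)
    (fun k => match k with true => HX1 | false => HX2 end)) as [eps0 [Heps0 HE]].
  exists eps0. split; [exact Heps0|]. intros eps Heps u v HT.
  apply HE. revert HT. now apply (Teps_mono S HS).
Qed.
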